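(* Let $f_\ast\cup g_\ast\to h_\ast$ be a cup-pairing of pre-$\cup$-functors $\mathscr A\to\mathscr B$. (i) There exists a cup-pairing $\mathrm Rf_\ast\cup\mathrm Rg_\ast\to\mathrm Rh_\ast$, i.e. there exists a functorial morphism, the derived cup product, $$\mathrm Rf_\ast X\otimes^{\mathrm L}\mathrm Rg_\ast Y\longrightarrow\mathrm Rh_\ast(X\otimes^{\mathrm L}Y),$$ for complexes $X$ and $Y$ in the derived category. (ii) This morphism induces the cup product $$\cup\colon\mathrm R^rf_\ast A\otimes\mathrm R^sg_\ast B\longrightarrow\mathrm R^{r+s}h_\ast(A\otimes B)$$ for objects $A,B\in\mathscr A$ and every pair of integers $r,s\in\mathbb N$ (including $0$), with the following properties: (iii) For $r=s=0$, this is the pairing of functors $f_\ast A\otimes g_\ast B\to h_\ast(A\otimes B)$ we started with, and it is compatible with exact sequences in the following sense: (iv) Let $0\to A'\to A\to A''\to 0$ be an exact sequence in $\mathscr A$ and let $B\in\mathscr A$ be another object. There is a commutative diagram $$\begin{array}{ccc} \mathrm R^rf_\ast A''\otimes\mathrm R^sg_\ast B & \longrightarrow & \mathrm R^{r+s}h_\ast(A''\otimes B)\\ \downarrow & & \downarrow\\ \mathrm R^{r+1}f_\ast A'\otimes\mathrm R^sg_\ast B & \longrightarrow & \mathrm R^{r+s+1}h_\ast(A'\otimes B) \end{array}$$ whose rows are the cup products and whose vertical arrows are the connecting morphisms, and a diagram, which commutes up to sign, with interchanged roles of the exact sequence and $B$. By the properties (iii) and (iv), the cup product is uniquely determined.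
   Context: $\mathscr A$ and $\mathscr B$ are abelian categories which are symmetric monoidal with respect to a right exact tensor product $\otimes$. An object $P$ is called flat if it is acyclic for the tensor product. It is assumed that the categories have finite Tor-dimension: there is $n\in\mathbb N$ such that every object has a flat resolution of length $\le n$. The derived category is $\mathrm D^+\mathscr A$, the derived category of complexes that are bounded from below (that is, with $\mathrm H^i(X)=0$ for all sufficiently small $i$); $\otimes^{\mathrm L}$ is the derived tensor product. For a left exact functor $f_\ast$, $\mathrm Rf_\ast$ denotes its right derived functor on the derived category and $\mathrm R^rf_\ast$ its $r$-th right derived functor. A cup-pairing of functors $f\cup g\to h$, for $f,g,h\colon\mathscr A\to\mathscr B$, is a functorial morphism $fA\otimes gB\to h(A\otimes B)$ for every pair of objects $A,B\in\mathscr A$ (and likewise for functors between the derived categories, with $\otimes^{\mathrm L}$ in place of $\otimes$). Functors are not required to be compatible with tensor products. A functor $f_\ast\colon\mathscr A\to\mathscr B$ is a pre-$\cup$-functor if it has a left adjoint $f^\ast$ and $f^\ast$ is exact and preserves flat objects.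
   Formalization: In (iv) the diagrams are stated when the exact sequence stays exact after tensoring with the other object, since otherwise the connecting morphism on the right is undefined; ''up to sign'' is fixed as (-1)^r, since with an arbitrary sign the cup product would not be unique. *)

(* Defs.v *)
From HB Require Import structures.
From mathcomp Require Import all_boot all_order all_algebra.
From mathcomp Require Import generic_quotient boolp.
Set Implicit Arguments.
Unset Strict Implicit.
Unset Printing Implicit Defensive.
Import Order.TTheory GRing.Theory Num.Theory.
Local Open Scope ring_scope.
Local Open Scope quotient_scope.

Declare Scope cat_scope.
Delimit Scope cat_scope with cat.
Local Open Scope cat_scope.

Record category := Category {
  ob :> Type;
  hom : ob -> ob -> Type;
  idm : forall X, hom X X;
  comp : forall X Y Z, hom Y Z -> hom X Y -> hom X Z;
  compA : forall X Y Z T (w : hom Z T) (v : hom Y Z) (u : hom X Y),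
    comp w (comp v u) = comp (comp w v) u;
  comp1m : forall X Y (u : hom X Y), comp (idm Y) u = u;
  compm1 : forall X Y (u : hom X Y), comp u (idm X) = u }.
Arguments hom {c}.
Arguments idm {c}.
Arguments comp {c X Y Z}.

Notation "v ∘ u" := (comp v u) (at level 40, left associativity) : cat_scope.

Record functor (C D : category) := Functor {
  fob :> C -> D;
  fmap : forall X Y, hom X Y -> hom (fob X) (fob Y);
  fmap1 : forall X, fmap (idm X) = idm (fob X);
  fmapM : forall X Y Z (v : hom Y Z) (u : hom X Y),
    fmap (v ∘ u) = fmap v ∘ fmap u }.
Arguments fmap {C D} f {X Y}.

Record nat_trans (C D : category) (F G : functor C D) := NatTrans {
  ntc :> forall X : C, hom (F X) (G X);
  ntcE : forall (X Y : C) (u : hom X Y), ntc Y ∘ fmap F u = fmap G u ∘ ntc X }.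

Definition is_iso (C : category) (X Y : C) (u : hom X Y) :=
  exists v : hom Y X, v ∘ u = idm X /\ u ∘ v = idm Y.

Definition inv_iso (C : category) (X Y : C) (u : hom X Y) (h : is_iso u) :
  hom Y X := projT1 (cid h).

Lemma inv_isoK (C : category) (X Y : C) (u : hom X Y) (h : is_iso u) :
  inv_iso h ∘ u = idm X.
Proof. by rewrite /inv_iso; case: cid => v []. Qed.

Lemma inv_isoKV (C : category) (X Y : C) (u : hom X Y) (h : is_iso u) :
  u ∘ inv_iso h = idm Y.
Proof. by rewrite /inv_iso; case: cid => v []. Qed.

Lemma is_iso1 (C : category) (X : C) : is_iso (idm X).
Proof. by exists (idm X); rewrite comp1m. Qed.

Lemma is_isoM (C : category) (X Y Z : C) (v : hom Y Z) (u : hom X Y) :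
  is_iso v -> is_iso u -> is_iso (v ∘ u).
Proof.
move=> [v' [v'v vv']] [u' [u'u uu']]; exists (u' ∘ v'); split.
  by rewrite compA -[u' ∘ _ ∘ _]compA v'v compm1.
by rewrite compA -[v ∘ _ ∘ _]compA uu' compm1.
Qed.

Lemma is_iso_fmap (C D : category) (F : functor C D) (X Y : C) (u : hom X Y) :
  is_iso u -> is_iso (fmap F u).
Proof.
move=> [v [vu uv]]; exists (fmap F v).
by rewrite -!fmapM vu uv !fmap1.
Qed.

Definition comp_functor (C D E : category) (G : functor D E) (F : functor C D) :
  functor C E.
Proof.
refine (@Functor C E (fun X => G (F X)) (fun X Y u => fmap G (fmap F u)) _ _).
- by move=> X; rewrite !fmap1.
- by move=> X Y Z v u; rewrite !fmapM.
Defined.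
Notation "G ⊚ F" := (comp_functor G F) (at level 40, left associativity) :
  cat_scope.

Definition id_functor (C : category) : functor C C :=
  @Functor C C id (fun _ _ u => u) (fun _ => erefl) (fun _ _ _ _ _ => erefl).

Definition prod_cat (C D : category) : category.
Proof.
refine (@Category (C * D)%type
  (fun X Y => (hom X.1 Y.1 * hom X.2 Y.2)%type)
  (fun X => (idm X.1, idm X.2))
  (fun X Y Z v u => (v.1 ∘ u.1, v.2 ∘ u.2)) _ _ _).
- by move=> *; rewrite !compA.
- by move=> X Y [u v]; rewrite !comp1m.
- by move=> X Y [u v]; rewrite !compm1.
Defined.
Notation "C × D" := (prod_cat C D) (at level 40, left associativity) :
  cat_scope.

Definition prod_functor (C C' D D' : category)
  (F : functor C D) (G : functor C' D') : functor (C × C') (D × D').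
Proof.
refine (@Functor (C × C') (D × D') (fun X => (F X.1, G X.2))
  (fun X Y u => (fmap F u.1, fmap G u.2)) _ _).
- by move=> X; rewrite /= !fmap1.
- by move=> X Y Z v u; rewrite /= !fmapM.
Defined.

Definition full_sub (C : category) (P : C -> Prop) : category :=
  @Category {X : C | P X} (fun X Y => hom (sval X) (sval Y))
    (fun X => idm (sval X)) (fun X Y Z v u => v ∘ u)
    (fun _ _ _ _ _ _ _ => compA _ _ _) (fun _ _ _ => comp1m _)
    (fun _ _ _ => compm1 _).

Definition incl (C : category) (P : C -> Prop) : functor (full_sub P) C :=
  @Functor (full_sub P) C (fun X => sval X) (fun _ _ u => u)
    (fun _ => erefl) (fun _ _ _ _ _ => erefl).

Definition full_sub_functor (C D : category) (P : C -> Prop) (P' : D -> Prop)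
  (F : functor C D) (h : forall X, P X -> P' (F X)) :
  functor (full_sub P) (full_sub P').
Proof.
refine (@Functor (full_sub P) (full_sub P')
  (fun X => exist _ (F (sval X)) (h _ (svalP X))) (fun X Y u => fmap F u) _ _).
- by move=> X; rewrite /= fmap1.
- by move=> X Y Z v u; rewrite /= fmapM.
Defined.

Record adjunction (C D : category) (L : functor D C) (R : functor C D) := {
  adj_unit : nat_trans (id_functor D) (R ⊚ L);
  adj_counit : nat_trans (L ⊚ R) (id_functor C);
  adj_triL : forall Y : D, adj_counit (L Y) ∘ fmap L (adj_unit Y) = idm (L Y);
  adj_triR : forall X : C, fmap R (adj_counit X) ∘ adj_unit (R X) = idm (R X) }.

Section Localization.
Variables (C : category) (W : forall X Y : C, hom X Y -> Prop).

(** The Gabriel-Zisman localization of [C] at [W]: morphisms are classes of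
    zigzags, in which the arrows pointing backwards are in [W], modulo the
    equivalence relation generated by composition and cancellation. *)

Inductive zigzag (X : C) : C -> Type :=
| znil : zigzag X X
| zfwd Y Z (u : hom Y Z) of zigzag X Y : zigzag X Z
| zbwd Y Z (w : hom Z Y) of W w & zigzag X Y : zigzag X Z.

Inductive zeq (X : C) : forall Y, zigzag X Y -> zigzag X Y -> Prop :=
| zeq_refl Y (p : zigzag X Y) : zeq p p
| zeq_sym Y (p q : zigzag X Y) : zeq p q -> zeq q p
| zeq_trans Y (p q r : zigzag X Y) : zeq p q -> zeq q r -> zeq p r
| zeq_fwd Y Z (u : hom Y Z) p q : zeq p q -> zeq (zfwd u p) (zfwd u q)
| zeq_bwd Y Z (w : hom Z Y) (h : W w) p q :
    zeq p q -> zeq (zbwd h p) (zbwd h q)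
| zeq_id Y (p : zigzag X Y) : zeq (zfwd (idm Y) p) p
| zeq_comp Y Z T (v : hom Z T) (u : hom Y Z) p :
    zeq (zfwd v (zfwd u p)) (zfwd (v ∘ u) p)
| zeq_fb Y Z (w : hom Z Y) (h : W w) p : zeq (zfwd w (zbwd h p)) p
| zeq_bf Y Z (w : hom Z Y) (h : W w) p : zeq (zbwd h (zfwd w p)) p.

Fixpoint zcat X Y Z (q : zigzag Y Z) : zigzag X Y -> zigzag X Z :=
  match q with
  | znil => fun p => p
  | zfwd _ _ u q' => fun p => zfwd u (zcat q' p)
  | zbwd _ _ _ h q' => fun p => zbwd h (zcat q' p)
  end.

HB.instance Definition _ X Y := gen_eqMixin (zigzag X Y).
HB.instance Definition _ X Y := gen_choiceMixin (zigzag X Y).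

Definition zeqb X Y : rel (zigzag X Y) := fun p q => `[< zeq p q >].

Lemma zeqb_equiv X Y : equiv_class_of (@zeqb X Y).
Proof.
split.
- by move=> p; apply/asboolP; exact: zeq_refl.
- by move=> p q; apply/asboolP/asboolP; exact: zeq_sym.
- by move=> q p r /asboolP pq /asboolP qr; apply/asboolP; exact: zeq_trans pq qr.
Qed.

Canonical zeqb_equiv_rel X Y := EquivRelPack (@zeqb_equiv X Y).

Definition loc_hom X Y := {eq_quot (@zeqb X Y)}.

Definition loc_pi X Y (p : zigzag X Y) : loc_hom X Y := \pi_(loc_hom X Y) p.

Lemma loc_piP X Y (p q : zigzag X Y) : zeq p q -> loc_pi p = loc_pi q.
Proof. by move=> pq; apply/eqmodP/asboolP. Qed.

Lemma loc_repr X Y (p : zigzag X Y) : zeq (repr (loc_pi p)) p.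
Proof.
have /eqmodP/asboolP : loc_pi (repr (loc_pi p)) = loc_pi p by exact: reprK.
by [].
Qed.

Lemma zcat_eql X Y Z (q q' : zigzag Y Z) (p : zigzag X Y) :
  zeq q q' -> zeq (zcat q p) (zcat q' p).
Proof.
elim=> /= [? ?|? ? ? _|? ? ? ? _ + _|? ? ? ? ? _|? ? ? ? ? ? _|? ?|*|*|*].
- exact: zeq_refl.
- exact: zeq_sym.
- exact: zeq_trans.
- exact: zeq_fwd.
- exact: zeq_bwd.
- exact: zeq_id.
- exact: zeq_comp.
- exact: zeq_fb.
- exact: zeq_bf.
Qed.

Lemma zcat_eqr X Y Z (q : zigzag Y Z) (p p' : zigzag X Y) :
  zeq p p' -> zeq (zcat q p) (zcat q p').
Proof. by move=> h; elim: q => //= *; [apply: zeq_fwd | apply: zeq_bwd]. Qed.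

Lemma zcatA X Y Z T (r : zigzag Z T) (q : zigzag Y Z) (p : zigzag X Y) :
  zcat r (zcat q p) = zcat (zcat r q) p.
Proof. by elim: r => //= [? ? ? ? ->|? ? ? ? ? ->]. Qed.

Lemma zcat0 X Y (p : zigzag X Y) : zcat p (znil X) = p.
Proof. by elim: p => //= [? ? ? ? ->|? ? ? ? ? ->]. Qed.

Definition loc_comp X Y Z (v : loc_hom Y Z) (u : loc_hom X Y) : loc_hom X Z :=
  loc_pi (zcat (repr v) (repr u)).

Lemma loc_compE X Y Z (q : zigzag Y Z) (p : zigzag X Y) :
  loc_comp (loc_pi q) (loc_pi p) = loc_pi (zcat q p).
Proof.
apply: loc_piP; apply: zeq_trans (zcat_eql _ (loc_repr q)) _.
exact: zcat_eqr (loc_repr p).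
Qed.

Lemma loc_ind X Y (u : loc_hom X Y) : exists p, u = loc_pi p.
Proof. by exists (repr u); rewrite /loc_pi reprK. Qed.

Definition loc : category.
Proof.
refine (@Category C loc_hom (fun X => loc_pi (znil X)) loc_comp _ _ _).
- move=> X Y Z T w v u.
  have [[r ->] [q ->] [p ->]] := And3 (loc_ind w) (loc_ind v) (loc_ind u).
  by rewrite !loc_compE zcatA.
- by move=> X Y u; have [p ->] := loc_ind u; rewrite loc_compE.
- by move=> X Y u; have [p ->] := loc_ind u; rewrite loc_compE zcat0.
Defined.

Definition loc_functor : functor C loc.
Proof.
refine (@Functor C loc id (fun X Y u => loc_pi (zfwd u (znil X))) _ _).
- by move=> X; apply: loc_piP; exact: zeq_id.
- move=> X Y Z v u; rewrite /= loc_compE /=.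
  by apply: loc_piP; apply: zeq_sym; exact: zeq_comp.
Defined.

Definition loc_inv X Y (w : hom X Y) (h : W w) : @hom loc Y X :=
  loc_pi (zbwd h (znil Y)).

Lemma loc_invK X Y (w : hom X Y) (h : W w) :
  loc_inv h ∘ fmap loc_functor w = idm (X : loc).
Proof. by rewrite /= loc_compE; apply: loc_piP; exact: zeq_bf. Qed.

Lemma loc_invKV X Y (w : hom X Y) (h : W w) :
  fmap loc_functor w ∘ loc_inv h = idm (Y : loc).
Proof. by rewrite /= loc_compE; apply: loc_piP; exact: zeq_fb. Qed.

Section Lift.
Variables (E : category) (F : functor C E).
Hypothesis hF : forall X Y (w : hom X Y), W w -> is_iso (fmap F w).

Fixpoint zeval X Y (p : zigzag X Y) : hom (F X) (F Y) :=
  match p with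
  | znil => idm (F X)
  | zfwd _ _ u p' => fmap F u ∘ zeval p'
  | zbwd _ _ _ h p' => inv_iso (hF h) ∘ zeval p'
  end.

Lemma zeval_eq X Y (p q : zigzag X Y) : zeq p q -> zeval p = zeval q.
Proof.
elim=> //=.
- by move=> ? ? ? ? _ -> _ ->.
- by move=> ? ? ? ? ? _ ->.
- by move=> ? ? ? ? ? ? _ ->.
- by move=> *; rewrite fmap1 comp1m.
- by move=> *; rewrite fmapM compA.
- by move=> *; rewrite compA inv_isoKV comp1m.
- by move=> *; rewrite compA inv_isoK comp1m.
Qed.

Lemma zeval_cat X Y Z (q : zigzag Y Z) (p : zigzag X Y) :
  zeval (zcat q p) = zeval q ∘ zeval p.
Proof.
elim: q => /= [|? ? ? ? ->|? ? ? ? ? ->]; by rewrite ?comp1m ?compA.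
Qed.

Definition loc_lift : functor loc E.
Proof.
refine (@Functor loc E (fun X => F X) (fun X Y u => zeval (repr u)) _ _).
- by move=> X /=; exact: zeval_eq (loc_repr _).
- by move=> X Y Z v u /=; rewrite -zeval_cat; exact: zeval_eq (loc_repr _).
Defined.

Lemma loc_lift_functor X Y (u : hom X Y) :
  fmap loc_lift (fmap loc_functor u) = fmap F u.
Proof. by rewrite /= (zeval_eq (loc_repr _)) /= compm1. Qed.

End Lift.
End Localization.
Arguments comp : simpl never.
Arguments idm : simpl never.

Record preadditive := Preadditive {
  pob : Type;
  phom : pob -> pob -> zmodType;
  pid : forall X, phom X X;
  pcomp : forall X Y Z, phom Y Z -> phom X Y -> phom X Z;
  pcompA : forall X Y Z T (w : phom Z T) (v : phom Y Z) (u : phom X Y),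
    pcomp w (pcomp v u) = pcomp (pcomp w v) u;
  pcomp1m : forall X Y (u : phom X Y), pcomp (pid Y) u = u;
  pcompm1 : forall X Y (u : phom X Y), pcomp u (pid X) = u;
  pcompDl : forall X Y Z (v v' : phom Y Z) (u : phom X Y),
    pcomp (v + v') u = pcomp v u + pcomp v' u;
  pcompDr : forall X Y Z (v : phom Y Z) (u u' : phom X Y),
    pcomp v (u + u') = pcomp v u + pcomp v u' }.

Definition preadditive_cat (C : preadditive) : category :=
  @Category (pob C) (fun X Y => phom X Y) (@pid C) (@pcomp C)
    (@pcompA C) (@pcomp1m C) (@pcompm1 C).
Coercion preadditive_cat : preadditive >-> category.

Definition mono (C : category) (X Y : C) (u : hom X Y) :=
  forall Z (v w : hom Z X), u ∘ v = u ∘ w -> v = w.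

Definition epi (C : category) (X Y : C) (u : hom X Y) :=
  forall Z (v w : hom Y Z), v ∘ u = w ∘ u -> v = w.

Definition is_kernel (C : preadditive) (X Y K : C) (u : hom X Y)
    (k : hom K X) :=
  u ∘ k = 0 /\
  forall Z (v : hom Z X), u ∘ v = 0 -> exists! w : hom Z K, k ∘ w = v.

Definition is_cokernel (C : preadditive) (X Y Q : C) (u : hom X Y)
    (q : hom Y Q) :=
  q ∘ u = 0 /\
  forall Z (v : hom Y Z), v ∘ u = 0 -> exists! w : hom Q Z, w ∘ q = v.

Definition is_zero (C : preadditive) (X : C) := idm X = 0 :> hom X X.

Record abelian := Abelian {
  apre :> preadditive;
  zero_ob : apre;
  zero_obP : is_zero zero_ob;
  bisum : apre -> apre -> apre;
  in1 : forall X Y, hom X (bisum X Y);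
  in2 : forall X Y, hom Y (bisum X Y);
  pr1 : forall X Y, hom (bisum X Y) X;
  pr2 : forall X Y, hom (bisum X Y) Y;
  pr1in1 : forall X Y, pr1 X Y ∘ in1 X Y = idm X;
  pr2in2 : forall X Y, pr2 X Y ∘ in2 X Y = idm Y;
  pr1in2 : forall X Y, pr1 X Y ∘ in2 X Y = 0;
  pr2in1 : forall X Y, pr2 X Y ∘ in1 X Y = 0;
  bisumE : forall X Y,
    in1 X Y ∘ pr1 X Y + in2 X Y ∘ pr2 X Y = idm (bisum X Y);
  ker : forall (X Y : apre) (u : hom X Y), apre;
  kerm : forall (X Y : apre) (u : hom X Y), hom (ker u) X;
  kermP : forall (X Y : apre) (u : hom X Y), is_kernel u (kerm u);
  coker : forall (X Y : apre) (u : hom X Y), apre;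
  cokm : forall (X Y : apre) (u : hom X Y), hom Y (coker u);
  cokmP : forall (X Y : apre) (u : hom X Y), is_cokernel u (cokm u);
  mono_normal : forall (X Y : apre) (u : hom X Y),
    mono u -> is_kernel (cokm u) u;
  epi_normal : forall (X Y : apre) (u : hom X Y),
    epi u -> is_cokernel (kerm u) u }.
Arguments zero_ob {a}.

Section PreadditiveTheory.
Variable C : preadditive.
Implicit Types X Y Z : C.

Lemma compDl X Y Z (v v' : hom Y Z) (u : hom X Y) :
  (v + v' : hom Y Z) ∘ u = v ∘ u + v' ∘ u.
Proof. exact: pcompDl. Qed.

Lemma compDr X Y Z (v : hom Y Z) (u u' : hom X Y) :
  v ∘ (u + u' : hom X Y) = v ∘ u + v ∘ u'.
Proof. exact: pcompDr. Qed.

Lemma comp0m X Y Z (u : hom X Y) : (0 : hom Y Z) ∘ u = 0.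
Proof. by apply: (@addIr _ ((0 : hom Y Z) ∘ u)); rewrite -compDl !add0r. Qed.

Lemma compm0 X Y Z (v : hom Y Z) : v ∘ (0 : hom X Y) = 0.
Proof. by apply: (@addIr _ (v ∘ (0 : hom X Y))); rewrite -compDr !add0r. Qed.

Lemma compNm X Y Z (v : hom Y Z) (u : hom X Y) : (- v : hom Y Z) ∘ u = - (v ∘ u).
Proof. by apply/eqP; rewrite -addr_eq0 -compDl addNr comp0m. Qed.

Lemma compmN X Y Z (v : hom Y Z) (u : hom X Y) : v ∘ (- u : hom X Y) = - (v ∘ u).
Proof. by apply/eqP; rewrite -addr_eq0 -compDr addNr compm0. Qed.

Lemma comp_mulrz X Y Z (v : hom Y Z) (u : hom X Y) k :
  v ∘ (u *~ k : hom X Y) = (v ∘ u) *~ k.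
Proof.
have nat n : v ∘ (u *+ n : hom X Y) = (v ∘ u) *+ n.
  by elim: n => [|n IH]; rewrite ?compm0 // !mulrS compDr IH.
by case: k => n; rewrite -?pmulrn ?NegzE ?mulrNz -?pmulrn ?compmN ?nat.
Qed.

Lemma mulrz_comp X Y Z (v : hom Y Z) (u : hom X Y) k :
  (v *~ k : hom Y Z) ∘ u = (v ∘ u) *~ k.
Proof.
have nat n : (v *+ n : hom Y Z) ∘ u = (v ∘ u) *+ n.
  by elim: n => [|n IH]; rewrite ?comp0m // !mulrS compDl IH.
by case: k => n; rewrite -?pmulrn ?NegzE ?mulrNz -?pmulrn ?compNm ?nat.
Qed.

Lemma zero_in X Y (u : hom X Y) : is_zero X -> u = 0.
Proof. by move=> h; rewrite -[u]compm1 h compm0. Qed.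

Lemma zero_out X Y (u : hom X Y) : is_zero Y -> u = 0.
Proof. by move=> h; rewrite -[u]comp1m h comp0m. Qed.

Lemma zero_obE X Y (u v : hom X Y) : is_zero X -> u = v.
Proof. by move=> h; rewrite (zero_in u h) (zero_in v h). Qed.

End PreadditiveTheory.

Section AbelianTheory.
Variable A : abelian.
Implicit Types X Y Z : A.

Lemma kerm0 X Y (u : hom X Y) : u ∘ kerm u = 0.
Proof. by case: (kermP u). Qed.

Lemma cokm0 X Y (u : hom X Y) : cokm u ∘ u = 0.
Proof. by case: (cokmP u). Qed.

Lemma mono_kerm X Y (u : hom X Y) : mono (kerm u).
Proof.
move=> Z v w vw; have [_ /(_ _ (kerm u ∘ v))] := kermP u.
rewrite compA kerm0 comp0m => /(_ erefl)[t [_ t_uniq]].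
by rewrite -(t_uniq v) // -(t_uniq w).
Qed.

Lemma epi_cokm X Y (u : hom X Y) : epi (cokm u).
Proof.
move=> Z v w vw; have [_ /(_ _ (v ∘ cokm u))] := cokmP u.
rewrite -compA cokm0 compm0 => /(_ erefl)[t [_ t_uniq]].
by rewrite -(t_uniq v) // -(t_uniq w).
Qed.

Definition klift X Y Z (u : hom X Y) (v : hom Z X) (h : u ∘ v = 0) :
  hom Z (ker u) := projT1 (cid ((kermP u).2 Z v h)).

Lemma kliftK X Y Z (u : hom X Y) (v : hom Z X) (h : u ∘ v = 0) :
  kerm u ∘ klift h = v.
Proof. by rewrite /klift; case: cid => w []. Qed.

Definition cdesc X Y Z (u : hom X Y) (v : hom Y Z) (h : v ∘ u = 0) :
  hom (coker u) Z := projT1 (cid ((cokmP u).2 Z v h)).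

Lemma cdescK X Y Z (u : hom X Y) (v : hom Y Z) (h : v ∘ u = 0) :
  cdesc h ∘ cokm u = v.
Proof. by rewrite /cdesc; case: cid => w []. Qed.

Definition short_exact X Y Z (i : hom X Y) (p : hom Y Z) :=
  is_kernel p i /\ is_cokernel i p.

End AbelianTheory.

Record additive_functor (A B : abelian) := AdditiveFunctor {
  afun :> functor A B;
  afunD : forall (X Y : A) (u v : hom X Y),
    fmap afun (u + v) = fmap afun u + fmap afun v }.

Section AdditiveTheory.
Variables (A B : abelian) (f : additive_functor A B).

Lemma afun0 (X Y : A) : fmap f (0 : hom X Y) = 0.
Proof. by apply: (@addIr _ (fmap f (0 : hom X Y))); rewrite -afunD !add0r. Qed.

Lemma afunN (X Y : A) (u : hom X Y) : fmap f (- u) = - fmap f u.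
Proof. by apply/eqP; rewrite -addr_eq0 -afunD addNr afun0. Qed.

Lemma afun_zero (X : A) : is_zero X -> is_zero (f X).
Proof. by rewrite /is_zero -fmap1 => ->; rewrite afun0. Qed.

End AdditiveTheory.

Definition exact_functor (A B : abelian) (f : additive_functor A B) :=
  forall (X Y Z : A) (i : hom X Y) (p : hom Y Z),
    short_exact i p -> short_exact (fmap f i) (fmap f p).

Section Complexes.
Variable A : abelian.

Record complex := Complex {
  cx_ob :> int -> A;
  dif : forall i j, hom (cx_ob i) (cx_ob j);
  dif_shape : forall i j, j != 1 + i -> dif i j = 0;
  dif_dif : forall i j k, dif j k ∘ dif i j = 0 }.

Record chain_map (X Y : complex) := ChainMap {
  cm :> forall n, hom (X n) (Y n);
  cmE : forall i j, cm j ∘ dif X i j = dif Y i j ∘ cm i }.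

Lemma chain_mapP (X Y : complex) (u v : chain_map X Y) :
  (forall n, u n = v n) -> u = v.
Proof.
case: u v => [u uE] [v vE] /= uv.
have {uv}e : u = v by apply: functional_extensionality_dep.
by rewrite -{}e in vE *; rewrite (Prop_irrelevance uE vE).
Qed.

Definition complexes : category.
Proof.
refine (@Category complex chain_map
  (fun X => @ChainMap X X (fun n => idm (X n)) _)
  (fun X Y Z v u => @ChainMap X Z (fun n => v n ∘ u n) _) _ _ _).
- by move=> *; apply: chain_mapP => n; exact: compA.
- by move=> *; apply: chain_mapP => n; exact: comp1m.
- by move=> *; apply: chain_mapP => n; exact: compm1.
Unshelve.
- by move=> i j; rewrite compm1 comp1m.
- by move=> i j; rewrite -compA cmE compA cmE compA.
Defined.

Implicit Types (n : int) (X Y : complex).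

(** [cocyc n X] and [coh n X] are the usual Z^n(X) and H^n(X) = Z^n(X)/B^n(X). *)

Definition cocyc (n : int) (X : complex) : A := ker (dif X n (1 + n)).

Definition cocycm n X : hom (cocyc n X) (X n) := kerm (dif X n (1 + n)).

Definition cobound n X : hom (X (n - 1)) (cocyc n X) :=
  klift (dif_dif X (n - 1) n (1 + n)).

Definition coh n X : A := coker (cobound n X).

Definition cls n X : hom (cocyc n X) (coh n X) := cokm (cobound n X).

Lemma dif_cocyc n X j : dif X n j ∘ cocycm n X = 0.
Proof.
have [->|h] := eqVneq j (1 + n); first exact: kerm0.
by rewrite dif_shape // comp0m.
Qed.

Lemma cls_dif n X i Z (z : hom Z (cocyc n X)) (y : hom Z (X i)) :
  cocycm n X ∘ z = dif X i n ∘ y -> cls n X ∘ z = 0.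
Proof.
have [e|h] := eqVneq n (1 + i); last first.
  rewrite dif_shape // comp0m => zE.
  suff -> : z = 0 by rewrite compm0.
  by apply: (@mono_kerm _ _ _ (dif X n (1 + n))); rewrite compm0.
have {e} : i = n - 1 by rewrite e addrAC subrr add0r.
move=> e; subst i => zE.
suff -> : z = cobound n X ∘ y by rewrite compA cokm0 comp0m.
by apply: (@mono_kerm _ _ _ (dif X n (1 + n))); rewrite compA kliftK.
Qed.

Definition cocyc_lift n X Z (y : hom Z (X n)) (h : dif X n (1 + n) ∘ y = 0) :
  hom Z (cocyc n X) := klift h.

Lemma cocyc_liftK n X Z y h : cocycm n X ∘ @cocyc_lift n X Z y h = y.
Proof. exact: kliftK. Qed.

Lemma cocycm_mono n X : mono (cocycm n X).
Proof. exact: mono_kerm. Qed.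

Lemma cls_epi n X : epi (cls n X).
Proof. exact: epi_cokm. Qed.

Definition coh_desc n X Z (v : hom (cocyc n X) Z) (h : v ∘ cobound n X = 0) :
  hom (coh n X) Z := cdesc h.

Lemma coh_descK n X Z v h : @coh_desc n X Z v h ∘ cls n X = v.
Proof. exact: cdescK. Qed.

Lemma cocycm_cobound n X : cocycm n X ∘ cobound n X = dif X (n - 1) n.
Proof. exact: kliftK. Qed.

Lemma cocyc_map_subproof n X Y (u : chain_map X Y) :
  dif Y n (1 + n) ∘ (u n ∘ cocycm n X) = 0.
Proof. by rewrite compA -cmE -compA dif_cocyc compm0. Qed.

Definition cocyc_map n X Y (u : chain_map X Y) : hom (cocyc n X) (cocyc n Y) :=
  cocyc_lift (cocyc_map_subproof n u).

Lemma coh_map_subproof n X Y (u : chain_map X Y) :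
  cls n Y ∘ cocyc_map n u ∘ cobound n X = 0.
Proof.
rewrite -compA; apply: (@cls_dif _ _ (n - 1) _ _ (u (n - 1))).
by rewrite compA cocyc_liftK -compA cocycm_cobound cmE.
Qed.

Definition coh_map n X Y (u : chain_map X Y) : hom (coh n X) (coh n Y) :=
  coh_desc (coh_map_subproof n u).

Lemma coh_mapE n X Y (u : chain_map X Y) :
  coh_map n u ∘ cls n X = cls n Y ∘ cocyc_map n u.
Proof. exact: coh_descK. Qed.

Definition coh_functor n : functor complexes A.
Proof.
refine (@Functor complexes A (coh n) (@coh_map n) _ _).
- move=> X; apply: cls_epi; rewrite coh_mapE comp1m.
  rewrite -[RHS]compm1; congr (_ ∘ _).
  by apply: cocycm_mono; rewrite cocyc_liftK comp1m compm1.
- move=> X Y Z v u; apply: cls_epi.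
  rewrite -compA !coh_mapE compA coh_mapE -compA; congr (_ ∘ _).
  by apply: cocycm_mono; rewrite compA !cocyc_liftK -compA cocyc_liftK compA.
Defined.

Definition qis (X Y : complexes) (u : hom X Y) :=
  forall n, is_iso (fmap (coh_functor n) u).

(** [der_plus] is D^+: the full subcategory of the derived category on the
    complexes X with H^i(X) = 0 for all sufficiently small i.  Functors and
    total tensor products are applied termwise to the complexes that are
    themselves bounded from below, which form [cx_plus]; every object of
    [der_plus] is isomorphic to one of these by truncation. *)

Definition der : category := loc qis.

Definition coh_bounded (X : complex) :=
  exists m : int, forall n, n < m -> is_zero (coh n X).

Definition bounded (X : complex) :=
  exists m : int, forall n, n < m -> is_zero (X n).

Definition der_plus : category := @full_sub der coh_bounded.

Definition cx_plus : category := @full_sub complexes bounded.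

Lemma coh_zero n X : is_zero (X n) -> is_zero (coh n X).
Proof.
move=> h; apply: cls_epi; rewrite comp1m comp0m -[cls n X]compm1.
have -> : idm (cocyc n X) = 0 :> hom (cocyc n X) (cocyc n X); last exact: compm0.
by apply: cocycm_mono; apply: etrans (esym (zero_out _ h)); apply: zero_out.
Qed.

Lemma bounded_coh X : bounded X -> coh_bounded X.
Proof. by move=> [m h]; exists m => n /h; exact: coh_zero. Qed.

Definition loc_plus : functor cx_plus der_plus :=
  @full_sub_functor complexes der bounded coh_bounded (loc_functor qis)
    bounded_coh.

Definition der_coh n : functor der_plus A :=
  @loc_lift complexes qis A (coh_functor n) (fun X Y w hw => hw n)
    ⊚ @incl der coh_bounded.

Lemma eqz_add1 (i j : int) : (1 + j != 1 + (1 + i)) = (j != 1 + i).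
Proof. by rewrite (inj_eq (addrI _)). Qed.

(** The shift X[1], with (X[1])^n = X^{1+n} and differential -d. *)

Definition shift_ob (X : complex) : complex.
Proof.
refine (@Complex (fun n => X (1 + n)) (fun i j => - dif X (1 + i) (1 + j)) _ _).
- by move=> i j h; rewrite dif_shape ?oppr0 // eqz_add1.
- by move=> i j k; rewrite compNm compmN dif_dif !oppr0.
Defined.

Definition shift_map X Y (u : chain_map X Y) :
  chain_map (shift_ob X) (shift_ob Y).
Proof.
refine (@ChainMap (shift_ob X) (shift_ob Y) (fun n => u (1 + n)) _).
by move=> i j; rewrite /= compNm compmN cmE.
Defined.

Definition shift : functor complexes complexes.
Proof.
refine (@Functor complexes complexes shift_ob shift_map _ _).
- by move=> X; apply: chain_mapP.
- by move=> X Y Z v u; apply: chain_mapP.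
Defined.

Lemma coh_shift_subproof1 n X :
  dif X (1 + n) (1 + (1 + n)) ∘ cocycm n (shift_ob X) = 0.
Proof.
apply: oppr_inj; rewrite oppr0 -compNm.
exact: (dif_cocyc n (shift_ob X) (1 + n)).
Qed.

Lemma coh_shift_subproof2 n X :
  cls (1 + n) X ∘ cocyc_lift (coh_shift_subproof1 n X) ∘ cobound n (shift_ob X)
  = 0.
Proof.
rewrite -compA; pose y : hom (shift_ob X (n - 1)) (X (1 + (n - 1))) :=
  - idm (X (1 + (n - 1))).
apply: (@cls_dif _ _ (1 + (n - 1)) _ _ y).
by rewrite compA cocyc_liftK cocycm_cobound /= compmN compm1.
Qed.

(** The canonical isomorphism H^n(X[1]) -> H^{1+n}(X). *)

Definition coh_shift n X : hom (coh n (shift_ob X)) (coh (1 + n) X) :=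
  coh_desc (coh_shift_subproof2 n X).

Lemma coh_unshift_subproof1 n X :
  dif (shift_ob X) n (1 + n) ∘ (cocycm (1 + n) X : hom _ (shift_ob X n)) = 0.
Proof. by rewrite /= compNm dif_cocyc oppr0. Qed.

Lemma coh_unshift_subproof2 n X :
  cls n (shift_ob X) ∘ cocyc_lift (coh_unshift_subproof1 n X)
    ∘ cobound (1 + n) X = 0.
Proof.
have e : 1 + n - 1 = 1 + (n - 1) by rewrite addrA.
rewrite -compA.
have [y yE] : exists y : hom (X (1 + n - 1)) (X (1 + (n - 1))),
    dif X (1 + n - 1) (1 + n) = dif X (1 + (n - 1)) (1 + n) ∘ y.
  by rewrite e; exists (idm _); rewrite compm1.
apply: (@cls_dif n (shift_ob X) (n - 1) _ _ (- y)).
by rewrite compA cocyc_liftK cocycm_cobound /= compNm compmN opprK.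
Qed.

Definition coh_unshift n X : hom (coh (1 + n) X) (coh n (shift_ob X)) :=
  coh_desc (coh_unshift_subproof2 n X).

Lemma coh_shiftK n X : coh_unshift n X ∘ coh_shift n X = idm _.
Proof.
apply: cls_epi; rewrite -compA coh_descK compA coh_descK comp1m.
rewrite -[RHS]compm1 -compA; congr (_ ∘ _); apply: cocycm_mono.
by rewrite compA !cocyc_liftK compm1.
Qed.

Lemma coh_unshiftK n X : coh_shift n X ∘ coh_unshift n X = idm _.
Proof.
apply: cls_epi; rewrite -compA coh_descK compA coh_descK comp1m.
rewrite -[RHS]compm1 -compA; congr (_ ∘ _); apply: cocycm_mono.
by rewrite compA !cocyc_liftK compm1.
Qed.

Lemma coh_shift_nat n X Y (u : chain_map X Y) :
  coh_shift n Y ∘ coh_map n (shift_map u) = coh_map (1 + n) u ∘ coh_shift n X.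
Proof.
apply: cls_epi; rewrite -!compA coh_mapE /coh_shift [in RHS]coh_descK.
rewrite compA coh_descK compA coh_mapE -!compA; congr (_ ∘ _); apply: cocycm_mono.
rewrite compA !cocyc_liftK compA cocyc_liftK -compA.
by rewrite !cocyc_liftK.
Qed.

Lemma qis_shift X Y (u : @hom complexes X Y) : qis u -> qis (fmap shift u).
Proof.
move=> qu n; have -> : fmap (coh_functor n) (fmap shift u) =
    coh_unshift n Y ∘ (coh_map (1 + n) u ∘ coh_shift n X).
  by rewrite -coh_shift_nat compA coh_shiftK comp1m.
apply: is_isoM; first by exists (coh_shift n Y); rewrite coh_shiftK coh_unshiftK.
apply: is_isoM; first exact: qu.
by exists (coh_unshift n X); rewrite coh_shiftK coh_unshiftK.
Qed.

Lemma loc_functor_inv (X Y : complexes) (w : hom X Y) :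
  qis w -> is_iso (fmap (loc_functor qis) w).
Proof. by move=> h; exists (loc_inv h); rewrite loc_invK loc_invKV. Qed.

Lemma shift_coh_bounded X : coh_bounded X -> coh_bounded (shift_ob X).
Proof.
move=> [m h]; exists (m - 1) => n nm.
have /h z : 1 + n < m by rewrite addrC -ltrBrDr.
by rewrite /is_zero -(coh_shiftK n X) [coh_shift n X](zero_out _ z) compm0.
Qed.

Lemma shift_bounded X : bounded X -> bounded (shift_ob X).
Proof.
move=> [m h]; exists (m - 1) => n nm; apply: h.
by rewrite addrC -ltrBrDr.
Qed.

Definition der_shift : functor der_plus der_plus :=
  @full_sub_functor der der coh_bounded coh_bounded
    (@loc_lift complexes qis der (loc_functor qis ⊚ shift)
       (fun X Y w hw => loc_functor_inv (qis_shift hw)))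
    shift_coh_bounded.

Definition cx_shift : functor cx_plus cx_plus :=
  @full_sub_functor complexes complexes bounded bounded shift shift_bounded.
End Complexes.

Section Single.
Variable A : abelian.
Implicit Types X Y Z : A.

Definition single_cx_ob X (n : int) : A :=
  match n with Posz 0 => X | _ => zero_ob end.

(** The object [X] as a complex concentrated in degree 0. *)

Definition single_cx X : complex A.
Proof.
refine (@Complex A (single_cx_ob X) (fun _ _ => 0) _ _) => // i j k.
exact: compm0.
Defined.

Definition single_cx_map X Y (u : hom X Y) :
  chain_map (single_cx X) (single_cx Y).
Proof.
refine (@ChainMap A (single_cx X) (single_cx Y)
  (fun n => match n as n0 return
              hom (single_cx_ob X n0) (single_cx_ob Y n0) with
            | Posz 0 => u
            | _ => 0
            end) _).
by move=> i j; rewrite [RHS]comp0m [LHS]compm0.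
Defined.

Lemma single_zero X n : n != 0 -> is_zero (single_cx_ob X n).
Proof. by case: n => [[|n]|n] //= _; exact: zero_obP. Qed.

Lemma single_bounded X : bounded (single_cx X).
Proof. by exists 0 => n n0; apply: single_zero; rewrite lt_eqF. Qed.

Definition single : functor A (cx_plus A).
Proof.
refine (@Functor A (cx_plus A) (fun X => exist _ (single_cx X) (single_bounded X))
  single_cx_map _ _).
- move=> X; apply: chain_mapP => -[[|n]|n] //=; exact/zero_obE/zero_obP.
- move=> X Y Z v u; apply: chain_mapP => -[[|n]|n] //=; exact/zero_obE/zero_obP.
Defined.

(** The mapping cone of [i : X -> Y]: [X] in degree -1 and [Y] in degree 0. *)

Section Cone.
Variables (X Y : A) (i : hom X Y).

Definition cone_ob (n : int) : A :=
  match n with Negz 0 => X | Posz 0 => Y | _ => zero_ob end.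

Definition cone_dif (m n : int) : hom (cone_ob m) (cone_ob n) :=
  match m as m0, n as n0 return hom (cone_ob m0) (cone_ob n0) with
  | Negz 0, Posz 0 => i
  | _, _ => 0
  end.

Definition cone : complex A.
Proof.
refine (@Complex A cone_ob cone_dif _ _).
- by case=> [[|m]|[|m]] [[|n]|[|n]].
- by case=> [[|m]|[|m]] [[|n]|[|n]] [[|p]|[|p]]; rewrite ?comp0m ?compm0.
Defined.

(** Minus the projection to [X[1]]; with this sign the connecting morphism
    below induces the one of the snake lemma on cohomology. *)

Definition cone_shift : chain_map cone (shift_ob (single_cx X)).
Proof.
refine (@ChainMap A cone (shift_ob (single_cx X))
  (fun n => match n as n0 return
              hom (cone_ob n0) (single_cx_ob X (1 + n0)) with
            | Negz 0 => - idm X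
            | _ => 0
            end) _).
move=> m n; rewrite /= oppr0 [RHS]comp0m.
by case: m n => [[|m]|[|m]] [[|n]|[|n]]; rewrite /= ?comp0m ?compm0.
Defined.

Definition cone_single_def (Z : A) (p : hom Y Z) (n : int) :
    hom (cone_ob n) (single_cx_ob Z n) :=
  match n as n0 return hom (cone_ob n0) (single_cx_ob Z n0) with
  | Posz 0 => p
  | _ => 0
  end.

Lemma cone_single_subproof (Z : A) (p : hom Y Z) (pi0 : p ∘ i = 0) m n :
  cone_single_def p n ∘ cone_dif m n
  = (0 : hom (single_cx_ob Z m) (single_cx_ob Z n)) ∘ cone_single_def p m.
Proof.
rewrite [RHS]comp0m.
by case: m n => [[|m]|[|m]] [[|n]|[|n]]; rewrite /= ?comp0m ?compm0.
Qed.

Definition cone_single (Z : A) (p : hom Y Z) (pi0 : p ∘ i = 0) :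
  chain_map cone (single_cx Z) :=
  @ChainMap A cone (single_cx Z) (cone_single_def p) (cone_single_subproof pi0).

Lemma zero_iso (U V : A) (u : hom U V) : is_zero U -> is_zero V -> is_iso u.
Proof. by move=> hU hV; exists 0; split; apply: zero_obE. Qed.

Lemma kernel_mono (U V K : A) (u : hom U V) (k : hom K U) :
  is_kernel u k -> mono k.
Proof.
move=> [uk h] T v w vw; have [|t [_ tu]] := h _ (k ∘ v).
  by rewrite compA uk comp0m.
by rewrite -(tu v) // -(tu w).
Qed.

Lemma cokernel_epi (U V Q : A) (u : hom U V) (q : hom V Q) :
  is_cokernel u q -> epi q.
Proof.
move=> [qu h] T v w vw; have [|t [_ tu]] := h _ (v ∘ q).
  by rewrite -compA qu compm0.
by rewrite -(tu v) // -(tu w).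
Qed.

Lemma cone_qis (Z : A) (p : hom Y Z) (ip : short_exact i p) :
  @qis A cone (single_cx Z) (cone_single ip.1.1).
Proof.
have [[pi0 ker_i] [_ coker_p]] := ip.
case=> [[|n]|[|n]]; last first.
- by apply: zero_iso; apply: coh_zero; exact: zero_obP.
- apply: zero_iso; last by apply: coh_zero; exact: zero_obP.
  apply: cls_epi; rewrite comp1m comp0m -[LHS]compm1.
  have -> : idm (cocyc (-1) cone) = 0 :> hom (cocyc (-1) cone) (cocyc (-1) cone); last exact: compm0.
  apply: cocycm_mono; rewrite compm1 compm0.
  apply: (kernel_mono ip.1); rewrite compm0.
  exact: (dif_cocyc (-1) cone 0).
- by apply: zero_iso; apply: coh_zero; exact: zero_obP.
- have cyc0 : dif cone 0 (1 + 0) ∘ (idm Y : hom Y (cone 0)) = 0 by exact: comp0m.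
  pose y : hom Y (cocyc 0 cone) := cocyc_lift cyc0.
  have cycZ : dif (single_cx Z) 0 (1 + 0) ∘ (idm Z : hom Z (single_cx Z 0)) = 0.
    exact: comp0m.
  pose z : hom Z (cocyc 0 (single_cx Z)) := cocyc_lift cycZ.
  have yK : y ∘ cocycm 0 cone = idm _.
    apply: cocycm_mono; rewrite compA cocyc_liftK compm1; exact: comp1m.
  have zK : z ∘ cocycm 0 (single_cx Z) = idm _.
    apply: cocycm_mono; rewrite compA cocyc_liftK compm1; exact: comp1m.
  have y0 : cls 0 cone ∘ y ∘ i = 0.
    rewrite -compA.
    apply: (@cls_dif A 0 cone (Negz 0) X (y ∘ i) (idm X : hom X (cone (Negz 0)))).
    rewrite compA cocyc_liftK [RHS]compm1; exact: comp1m.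
  have [w [wE _]] := coker_p _ _ y0.
  have w0 : w ∘ cocycm 0 (single_cx Z) ∘ cobound 0 (single_cx Z) = 0.
    by rewrite -compA cocycm_cobound; exact: compm0.
  have mE : cocyc_map 0 (cone_single ip.1.1) = z ∘ (p ∘ cocycm 0 cone).
    apply: cocycm_mono; rewrite cocyc_liftK compA cocyc_liftK.
    by rewrite [RHS]comp1m.
  exists (coh_desc w0); split.
  + apply: cls_epi; rewrite -compA coh_mapE compA coh_descK mE.
    rewrite -compA [cocycm 0 _ ∘ (_ ∘ _)]compA cocyc_liftK [idm _ ∘ _]comp1m.
    by rewrite compA wE -compA yK compm1 comp1m.
  + apply: cls_epi; rewrite -compA coh_descK comp1m -[RHS]compm1 -zK compA.
    rewrite [RHS]compA; congr (_ ∘ _).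
    apply: (cokernel_epi ip.2); rewrite -compA wE compA coh_mapE mE.
    rewrite -[_ ∘ _ ∘ y]compA -!compA cocyc_liftK; congr (_ ∘ (_ ∘ _)).
    exact: compm1.
Qed.

End Cone.

(** The morphism [Z -> X[1]] in the derived category defined by a short exact
    sequence 0 -> X -> Y -> Z -> 0. *)

Definition der_connecting X Y Z (i : hom X Y) (p : hom Y Z)
    (ip : short_exact i p) :
  @hom (der_plus A) (loc_plus A (single Z)) (der_shift A (loc_plus A (single X))) :=
  fmap (loc_functor (@qis A)) (cone_shift i : @hom (complexes A) _ _)
    ∘ loc_inv (cone_qis ip).

End Single.

(** [(R, eta)] is a left Kan extension of [F] along [Q], preserved by every
    functor [G] out of [E].  For a localization functor [Q] this is the notion
    of (absolute) total right derived functor, equivalent to the one of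
    Deligne; it holds for functors computed by injective resolutions. *)

Definition absolute_lan (C D E : category) (Q : functor C D) (F : functor C E)
    (R : functor D E) (eta : nat_trans F (R ⊚ Q)) :=
  forall (E' : category) (G : functor E E') (H : functor D E')
    (a : nat_trans (G ⊚ F) (H ⊚ Q)),
  exists! b : nat_trans (G ⊚ R) H,
    forall X : C, b (Q X) ∘ fmap G (eta X) = a X.

Section RightDerived.
Variables (A B : abelian) (f : additive_functor A B).

Definition cx_map_ob (X : complex A) : complex B.
Proof.
refine (@Complex B (fun n => f (X n)) (fun i j => fmap f (dif X i j)) _ _).
- by move=> i j h; rewrite dif_shape // afun0.
- by move=> i j k; rewrite -fmapM dif_dif afun0.
Defined.

Definition cx_map_hom (X Y : complex A) (u : chain_map X Y) :
  chain_map (cx_map_ob X) (cx_map_ob Y).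
Proof.
refine (@ChainMap B (cx_map_ob X) (cx_map_ob Y) (fun n => fmap f (u n)) _).
by move=> i j; rewrite /= -!fmapM cmE.
Defined.

Definition cx_map : functor (complexes A) (complexes B).
Proof.
refine (@Functor (complexes A) (complexes B) cx_map_ob cx_map_hom _ _).
- by move=> X; apply: chain_mapP => n; exact: (fmap1 f (X n)).
- by move=> X Y Z v u; apply: chain_mapP => n; exact: (fmapM f (cm v n) (cm u n)).
Defined.

Lemma cx_map_bounded X : bounded X -> bounded (cx_map X).
Proof. by move=> [m h]; exists m => n /h; exact: afun_zero. Qed.

Definition cx_plus_map : functor (cx_plus A) (cx_plus B) :=
  @full_sub_functor (complexes A) (complexes B) (@bounded A) (@bounded B)
    cx_map cx_map_bounded.

Definition cx_map_shift (X : complex A) :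
  chain_map (shift_ob (cx_map_ob X)) (cx_map_ob (shift_ob X)).
Proof.
refine (@ChainMap B (shift_ob (cx_map_ob X)) (cx_map_ob (shift_ob X))
  (fun n => idm _) _).
by move=> i j; rewrite [RHS]compm1 [LHS]comp1m /= afunN.
Defined.

(** [der_shift (loc_plus X)] and [loc_plus (cx_shift X)] are the same complex,
    but carry different proofs of boundedness. *)

Definition loc_plus_shift (X : cx_plus A) :
  @hom (der_plus A) (loc_plus A (cx_shift A X)) (der_shift A (loc_plus A X)) :=
  @idm (der A) (shift A (sval X)).

Definition cx_plus_map_shift (X : cx_plus A) :
  @hom (der_plus B) (der_shift B (loc_plus B (cx_plus_map X)))
    (loc_plus B (cx_plus_map (cx_shift A X))) :=
  fmap (loc_functor (@qis B)) (cx_map_shift (sval X) : @hom (complexes B) _ _).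

(** [rder_shift] is the isomorphism (Rf X)[1] -> Rf(X[1]) that is part of the
    structure of a triangulated functor; by [rder_univ] there is exactly one
    natural transformation satisfying [rder_shift_eta]. *)

Record right_derived := RightDerived {
  rder :> functor (der_plus A) (der_plus B);
  rder_eta : nat_trans (loc_plus B ⊚ cx_plus_map) (rder ⊚ loc_plus A);
  rder_univ : absolute_lan rder_eta;
  rder_shift : nat_trans (der_shift B ⊚ rder) (rder ⊚ der_shift A);
  rder_shift_iso : forall X, is_iso (rder_shift X);
  rder_shift_eta : forall X : cx_plus A,
    rder_shift (loc_plus A X) ∘ fmap (der_shift B) (rder_eta X)
    = fmap rder (loc_plus_shift X) ∘ rder_eta (cx_shift A X)
      ∘ cx_plus_map_shift X }.

Variable Rf : right_derived.

Definition rderived (r : nat) : functor A B :=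
  der_coh B r ⊚ Rf ⊚ loc_plus A ⊚ single A.

Lemma rderived0_subproof (X : A) :
  dif (cx_map (single_cx X)) 0 (1 + 0) ∘ (idm (f X) : hom (f X) (cx_map (single_cx X) 0)) = 0.
Proof. by rewrite /= afun0; exact: comp0m. Qed.

(** The canonical morphism f -> R^0 f (an isomorphism, as f is left exact). *)

Definition rderived0 (X : A) : hom (f X) (rderived 0 X) :=
  fmap (der_coh B 0) (rder_eta Rf (single A X))
    ∘ (cls 0 (cx_map (single_cx X)) ∘ cocyc_lift (rderived0_subproof X)).

(** H^r(Rf Z) -> H^r(Rf(X[1])) = H^r((Rf X)[1]) = H^{r+1}(Rf X) *)

Definition connecting (X Y Z : A) (i : hom X Y) (p : hom Y Z)
    (ip : short_exact i p) (r : nat) : hom (rderived r Z) (rderived r.+1 X) :=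
  coh_shift r (sval (Rf (loc_plus A (single A X))))
    ∘ fmap (der_coh B r)
        (inv_iso (rder_shift_iso Rf (loc_plus A (single A X)))
          ∘ fmap Rf (der_connecting ip)).

End RightDerived.

Definition tmap (C : category) (T : functor (C × C) C) (X X' Y Y' : C)
    (u : hom X X') (v : hom Y Y') : hom (T (X, Y)) (T (X', Y')) :=
  @fmap _ _ T (X, Y) (X', Y') (u, v).

Record symmetric_monoidal (C : category) := SymmetricMonoidal {
  tensor :> functor (C × C) C;
  tunit : C;
  tassoc : forall X Y Z : C,
    hom (tensor (tensor (X, Y), Z)) (tensor (X, tensor (Y, Z)));
  tlunit : forall X : C, hom (tensor (tunit, X)) X;
  trunit : forall X : C, hom (tensor (X, tunit)) X;
  tbraid : forall X Y : C, hom (tensor (X, Y)) (tensor (Y, X));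
  tassoc_iso : forall X Y Z, is_iso (tassoc X Y Z);
  tlunit_iso : forall X, is_iso (tlunit X);
  trunit_iso : forall X, is_iso (trunit X);
  tassoc_nat : forall (X X' Y Y' Z Z' : C)
      (u : hom X X') (v : hom Y Y') (w : hom Z Z'),
    tassoc X' Y' Z' ∘ tmap tensor (tmap tensor u v) w
    = tmap tensor u (tmap tensor v w) ∘ tassoc X Y Z;
  tlunit_nat : forall (X Y : C) (u : hom X Y),
    tlunit Y ∘ tmap tensor (idm tunit) u = u ∘ tlunit X;
  trunit_nat : forall (X Y : C) (u : hom X Y),
    trunit Y ∘ tmap tensor u (idm tunit) = u ∘ trunit X;
  tbraid_nat : forall (X X' Y Y' : C) (u : hom X X') (v : hom Y Y'),
    tbraid X' Y' ∘ tmap tensor u v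
    = tmap tensor v u ∘ tbraid X Y;
  tpentagon : forall W X Y Z : C,
    tmap tensor (idm W) (tassoc X Y Z)
      ∘ tassoc W (tensor (X, Y)) Z
      ∘ tmap tensor (tassoc W X Y) (idm Z)
    = tassoc W X (tensor (Y, Z)) ∘ tassoc (tensor (W, X)) Y Z;
  ttriangle : forall X Y : C,
    tmap tensor (idm X) (tlunit Y) ∘ tassoc X tunit Y
    = tmap tensor (trunit X) (idm Y);
  tsymmetry : forall X Y : C, tbraid Y X ∘ tbraid X Y = idm _;
  thexagon : forall X Y Z : C,
    tassoc Y Z X ∘ tbraid X (tensor (Y, Z)) ∘ tassoc X Y Z
    = tmap tensor (idm Y) (tbraid X Z) ∘ tassoc Y X Z
      ∘ tmap tensor (tbraid X Y) (idm Z) }.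

Record tensor_abelian := TensorAbelian {
  tab :> abelian;
  tmon : symmetric_monoidal tab;
  tmapDl : forall (X X' Y Y' : tab) (u u' : hom X X') (v : hom Y Y'),
    tmap tmon (u + u' : hom X X') v = tmap tmon u v + tmap tmon u' v;
  tmapDr : forall (X X' Y Y' : tab) (u : hom X X') (v v' : hom Y Y'),
    tmap tmon u (v + v' : hom Y Y') = tmap tmon u v + tmap tmon u v';
  tensor_rexactl : forall (X Y Z P : tab) (i : hom X Y) (p : hom Y Z),
    is_cokernel i p ->
    is_cokernel (tmap tmon i (idm P)) (tmap tmon p (idm P));
  tensor_rexactr : forall (X Y Z P : tab) (i : hom X Y) (p : hom Y Z),
    is_cokernel i p ->
    is_cokernel (tmap tmon (idm P) i) (tmap tmon (idm P) p) }.

Definition tens (A : tensor_abelian) : functor (A × A) A := tensor (tmon A).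

Notation "X ⊗ Y" := (fob (tens _) (X, Y)) (at level 40, left associativity) :
  cat_scope.
Notation "u ⊗ₘ v" := (tmap (tens _) u v) (at level 40, left associativity) :
  cat_scope.

Section TensorTheory.
Variable A : tensor_abelian.

(** Acyclicity for the tensor product; as the latter is symmetric, it does not
    matter on which side [P] is put. *)

Definition flat (P : A) :=
  forall (X Y Z : A) (i : hom X Y) (p : hom Y Z),
    short_exact i p -> short_exact (idm P ⊗ₘ i) (idm P ⊗ₘ p).

(** A flat resolution of length at most [n] is a quasi-isomorphism to [X] from
    a complex of flat objects concentrated in degrees -n, ..., 0. *)

Definition finite_tor_dim :=
  exists n : nat, forall X : A,
  exists (P : complex A) (q : chain_map P (single_cx X)),
    [/\ @qis A P (single_cx X) q, forall i, flat (P i)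
      & forall i : int, ~~ (- n%:Z <= i <= 0) -> is_zero (P i)].

Lemma tmapM (X X' X'' Y Y' Y'' : A) (u' : hom X' X'') (u : hom X X')
    (v' : hom Y' Y'') (v : hom Y Y') :
  (u' ⊗ₘ v') ∘ (u ⊗ₘ v) = (u' ∘ u) ⊗ₘ (v' ∘ v).
Proof. by rewrite /tmap -fmapM. Qed.

Lemma tmap1 (X Y : A) : idm X ⊗ₘ idm Y = idm (X ⊗ Y).
Proof. exact: (fmap1 (tens A) (X, Y)). Qed.

Lemma tmap0m (X X' Y Y' : A) (v : hom Y Y') : (0 : hom X X') ⊗ₘ v = 0.
Proof. by apply: (@addIr _ ((0 : hom X X') ⊗ₘ v)); rewrite -tmapDl !add0r. Qed.

Lemma tmapm0 (X X' Y Y' : A) (u : hom X X') : u ⊗ₘ (0 : hom Y Y') = 0.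
Proof. by apply: (@addIr _ (u ⊗ₘ (0 : hom Y Y'))); rewrite -tmapDr !add0r. Qed.

Lemma tens_zerol (X Y : A) : is_zero X -> is_zero (X ⊗ Y).
Proof. by rewrite /is_zero -tmap1 => ->; rewrite tmap0m. Qed.

Lemma tens_zeror (X Y : A) : is_zero Y -> is_zero (X ⊗ Y).
Proof. by rewrite /is_zero -tmap1 => ->; rewrite tmapm0. Qed.

End TensorTheory.

Section Coproducts.
Variable A : abelian.

Definition is_coproduct (I : Type) (F : I -> A) (S : A)
    (j : forall i, hom (F i) S) :=
  forall Z (g : forall i, hom (F i) Z),
    exists! u : hom S Z, forall i, u ∘ j i = g i.

Lemma finite_coproduct (I : eqType) (F : I -> A) (s : seq I) :
  (forall i, i \notin s -> is_zero (F i)) ->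
  exists (S : A) (j : forall i, hom (F i) S), is_coproduct j.
Proof.
move=> s0.
suff [S [j jP]] : exists (S : A) (j : forall i, hom (F i) S),
    forall Z (g : forall i, hom (F i) Z), exists! u : hom S Z,
      forall i, i \in s -> u ∘ j i = g i.
  exists S, j => Z g; have [u [uE u_uniq]] := jP Z g; exists u; split.
    by move=> i; have [/uE//|/s0 h] := boolP (i \in s); apply: zero_obE.
  by move=> v vE; apply: u_uniq.
elim: s {s0} => [|a s [S [j jP]]].
  exists zero_ob, (fun=> 0) => Z g; exists 0; split=> // v _.
  by apply: zero_obE; exact: zero_obP.
have [sa|sa] := boolP (a \in s).
  exists S, j => Z g; have [u [uE u_uniq]] := jP Z g; exists u; split.
    by move=> i; rewrite inE => /orP[/eqP->|]; exact: uE.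
  by move=> v vE; apply: u_uniq => i si; apply: vE; rewrite inE si orbT.
pose j' i : hom (F i) (bisum (F a) S) :=
  match pselect (a = i) with
  | left e => in1 (F a) S ∘ ecast x (hom (F x) (F a)) e (idm (F a))
  | right _ => in2 (F a) S ∘ j i
  end.
have j'a : j' a = in1 (F a) S.
  rewrite /j'; case: pselect => // e.
  by rewrite (Prop_irrelevance e erefl) compm1.
have j's i : i \in s -> j' i = in2 (F a) S ∘ j i.
  by move=> si; rewrite /j'; case: pselect => // e; rewrite -e (negPf sa) in si.
exists (bisum (F a) S), j' => Z g; have [u [uE u_uniq]] := jP Z g.
exists (g a ∘ pr1 _ _ + u ∘ pr2 _ _ : hom (bisum (F a) S) Z); split.
  move=> i; rewrite inE compDl => /orP[/eqP->|si].
    by rewrite j'a -!compA pr1in1 pr2in1 compm1 compm0 addr0.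
  rewrite j's // !compA -[g a ∘ _ ∘ _]compA -[u ∘ _ ∘ _]compA.
  by rewrite pr1in2 pr2in2 compm1 compm0 comp0m add0r uE.
move=> v vE; have va : v ∘ in1 (F a) S = g a by rewrite -j'a vE ?mem_head.
have vu : u = v ∘ in2 (F a) S.
  by apply: u_uniq => i si; rewrite -compA -j's // vE // inE si orbT.
by rewrite vu -va -!compA -compDr bisumE compm1.
Qed.

End Coproducts.

Lemma sgn1D (p : int) : (-1 : int) ^+ `|(1 + p)%R|%N = - (-1) ^+ `|p|%N.
Proof.
case: p => [p|[|p]]; first by rewrite /= exprS mulN1r.
  by rewrite expr0 expr1 opprK.
have -> : 1 + Negz p.+1 = Negz p.
  by rewrite !NegzE -[p.+2]addn1 PoszD opprD addrC subrK.
by rewrite -[`|Negz p.+1|%N]/(p.+2) [in RHS]exprS mulN1r opprK.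
Qed.

Definition bidegree (n : int) := {pq : int * int | pq.1 + pq.2 == n}.

Section TotalComplex.
Variable A : tensor_abelian.

Section Objects.
Variables X Y : cx_plus A.

Definition tot_summand n (pq : bidegree n) : A :=
  sval X (val pq).1 ⊗ sval Y (val pq).2.

Lemma tot_exists n : exists (S : A) (j : forall pq, hom (@tot_summand n pq) S),
  is_coproduct j.
Proof.
have [[a Xa] [b Yb]] := (svalP X, svalP Y).
pose s : seq (bidegree n) := pmap insub
  [seq (a + k%:Z, n - (a + k%:Z)) | k <- iota 0 `|(n - b - a)%R|%N.+1].
apply: (@finite_coproduct A _ _ s) => -[[p q] /= pq].
have [pa _|ap] := ltP p a; first exact/tens_zerol/Xa.
have [qb _|bq] := ltP q b; first exact/tens_zeror/Yb.
case/negP; rewrite mem_pmap_sub; apply/mapP; exists `|p - a|%N.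
  rewrite mem_iota /= add0n ltnS -lez_nat !gez0_abs ?subr_ge0 //.
    by rewrite lerD2r -(eqP pq) lerBrDr lerD2l.
  by rewrite lerBrDr -(eqP pq) lerD.
have -> : a + `|(p - a)%R|%N%:Z = p by rewrite gez0_abs ?subr_ge0 // addrC subrK.
by rewrite /= -(eqP pq) addrAC subrr add0r.
Qed.

(** The direct sum of the X^p ⊗ Y^q with p + q = n, which is finite as X and Y
    are bounded from below. *)

Definition tot_ob n : A := projT1 (cid (tot_exists n)).

Definition tot_inj_ n : forall pq, hom (@tot_summand n pq) (tot_ob n) :=
  projT1 (cid (projT2 (cid (tot_exists n)))).

Lemma tot_injP n : is_coproduct (@tot_inj_ n).
Proof. exact: projT2 (cid (projT2 (cid (tot_exists n)))). Qed.

(** Zero unless p + q = n. *)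

Definition tot_inj p q n : hom (sval X p ⊗ sval Y q) (tot_ob n) :=
  match pselect (p + q == n) with
  | left e => tot_inj_ (exist _ (p, q) e : bidegree n)
  | right _ => 0
  end.

Lemma tot_inj0 p q n : p + q != n -> tot_inj p q n = 0.
Proof. by rewrite /tot_inj; case: pselect => // e /negP. Qed.

Lemma tot_injE n (pq : bidegree n) :
  tot_inj_ pq = tot_inj (val pq).1 (val pq).2 n.
Proof.
case: pq => -[p q] /= e; rewrite /tot_inj; case: pselect => // e'.
by rewrite (bool_irrelevance e e').
Qed.

Definition tot_desc n Z (g : forall p q, hom (sval X p ⊗ sval Y q) Z) :
  hom (tot_ob n) Z :=
  projT1 (cid (tot_injP (fun pq : bidegree n => g (val pq).1 (val pq).2))).

Lemma tot_descE n Z g p q :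
  p + q = n -> @tot_desc n Z g ∘ tot_inj p q n = g p q.
Proof.
move=> e; rewrite /tot_desc; case: cid => u [uE _] /=.
have := uE (exist _ (p, q) (introT eqP e) : bidegree n).
by rewrite tot_injE.
Qed.

Lemma tot_eq n Z (u v : hom (tot_ob n) Z) :
  (forall p q, p + q = n -> u ∘ tot_inj p q n = v ∘ tot_inj p q n) -> u = v.
Proof.
move=> uv; have [w [_ w_uniq]] := tot_injP (fun pq : bidegree n => v ∘ tot_inj_ pq).
rewrite -(w_uniq u); last by move=> [[p q] e]; rewrite tot_injE uv //; apply/eqP.
by rewrite -(w_uniq v).
Qed.

(** d(x ⊗ y) = dx ⊗ y + (-1)^p x ⊗ dy for x of degree p. *)

Definition tot_dif_summand j p q : hom (sval X p ⊗ sval Y q) (tot_ob j) :=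
  tot_inj (1 + p) q j ∘ (dif (sval X) p (1 + p) ⊗ₘ idm (sval Y q))
  + (tot_inj p (1 + q) j ∘ (idm (sval X p) ⊗ₘ dif (sval Y) q (1 + q)))
      *~ (-1) ^+ `|p|%N.

Definition tot_dif i j : hom (tot_ob i) (tot_ob j) :=
  tot_desc i (tot_dif_summand j).

Lemma tot_dif_shape i j : j != 1 + i -> tot_dif i j = 0.
Proof.
move=> ji; apply: tot_eq => p q pq.
rewrite tot_descE // comp0m /tot_dif_summand !tot_inj0 ?comp0m ?mul0rz ?addr0 //.
  by rewrite addrCA pq eq_sym.
by rewrite -addrA pq eq_sym.
Qed.

Lemma tot_dif_dif i j k : tot_dif j k ∘ tot_dif i j = 0.
Proof.
have [jE|/tot_dif_shape ->] := eqVneq j (1 + i); last by rewrite compm0.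
apply: tot_eq => p q pq; rewrite -compA tot_descE // comp0m compDr comp_mulrz.
have e1 : 1 + p + q = j by rewrite jE -pq addrA.
have e2 : p + (1 + q) = j by rewrite jE -pq addrCA.
rewrite !compA (tot_descE _ e1) (tot_descE _ e2).
rewrite /tot_dif_summand !compDl !mulrz_comp -!compA !tmapM !dif_dif.
rewrite !comp1m !compm1 tmap0m tmapm0 !compm0 mul0rz add0r addr0.
by rewrite sgn1D mulrNz addNr.
Qed.

Definition tot : complex A :=
  @Complex A tot_ob tot_dif tot_dif_shape tot_dif_dif.

Lemma tot_bounded : bounded tot.
Proof.
have [[a Xa] [b Yb]] := (svalP X, svalP Y).
exists (a + b) => n nab; apply: tot_eq => p q pq; apply: zero_obE.
have [pa|ap] := ltP p a; first exact/tens_zerol/Xa.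
apply/tens_zeror/Yb; move: nab; rewrite -pq => nab.
by rewrite -(ltrD2l a); apply: le_lt_trans nab; rewrite lerD2r.
Qed.

End Objects.
End TotalComplex.

Section TotalFunctor.
Variable A : tensor_abelian.

Section Map.
Variables (X X' Y Y' : cx_plus A) (u : chain_map (sval X) (sval X'))
  (v : chain_map (sval Y) (sval Y')).

Definition tot_map_def n : hom (tot_ob X Y n) (tot_ob X' Y' n) :=
  tot_desc n (fun p q => tot_inj X' Y' p q n ∘ (u p ⊗ₘ v q)).

Lemma tot_map_inj p q n :
  tot_map_def n ∘ tot_inj X Y p q n = tot_inj X' Y' p q n ∘ (u p ⊗ₘ v q).
Proof.
have [pq|pq] := eqVneq (p + q) n; first by rewrite tot_descE.
by rewrite !tot_inj0 // comp0m compm0.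
Qed.

Lemma tot_map_dif i j :
  tot_map_def j ∘ tot_dif X Y i j = tot_dif X' Y' i j ∘ tot_map_def i.
Proof.
apply: tot_eq => p q pq; rewrite -!compA tot_map_inj tot_descE //.
rewrite [RHS]compA tot_descE // /tot_dif_summand compDr compDl.
rewrite comp_mulrz mulrz_comp !compA !tot_map_inj -!compA !tmapM !cmE.
by rewrite !comp1m !compm1.
Qed.

Definition tot_map : chain_map (tot X Y) (tot X' Y') :=
  @ChainMap A (tot X Y) (tot X' Y') tot_map_def tot_map_dif.
End Map.

Lemma tot_map1 (X Y : cx_plus A) n :
  tot_map_def (idm (sval X) : @hom (complexes A) _ _)
    (idm (sval Y) : @hom (complexes A) _ _) n = idm (tot_ob X Y n).
Proof.
apply: tot_eq => p q pq; rewrite tot_map_inj comp1m -[RHS]compm1.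
by congr (_ ∘ _); exact: tmap1.
Qed.

Lemma tot_mapM (X X' X'' Y Y' Y'' : cx_plus A)
    (u' : chain_map (sval X') (sval X'')) (u : chain_map (sval X) (sval X'))
    (v' : chain_map (sval Y') (sval Y'')) (v : chain_map (sval Y) (sval Y')) n :
  tot_map_def ((u' : @hom (complexes A) _ _) ∘ u)
    ((v' : @hom (complexes A) _ _) ∘ v) n
  = tot_map_def u' v' n ∘ tot_map_def u v n.
Proof.
apply: tot_eq => p q pq; rewrite tot_map_inj -compA tot_map_inj compA.
by rewrite tot_map_inj -compA; congr (_ ∘ _); rewrite tmapM.
Qed.

Definition tot_functor : functor (cx_plus A × cx_plus A) (cx_plus A).
Proof.
refine (@Functor (cx_plus A × cx_plus A) (cx_plus A)
  (fun XY => exist _ (tot XY.1 XY.2) (tot_bounded XY.1 XY.2))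
  (fun XY XY' uv => tot_map uv.1 uv.2) _ _).
- by move=> XY; apply: chain_mapP => n; exact: tot_map1.
- by move=> XY XY' XY'' v u; apply: chain_mapP => n; exact: tot_mapM.
Defined.

Section CocycleProduct.
Variables (X Y : cx_plus A) (p q n : int).

Lemma cocyc_tensor_subproof :
  dif (tot X Y) n (1 + n)
    ∘ (tot_inj X Y p q n ∘ (cocycm p (sval X) ⊗ₘ cocycm q (sval Y))) = 0.
Proof.
have [pq|pq] := eqVneq (p + q) n; last by rewrite tot_inj0 // comp0m compm0.
rewrite compA tot_descE // compDl mulrz_comp -!compA !tmapM !dif_cocyc.
by rewrite tmap0m tmapm0 !compm0 mul0rz addr0.
Qed.

(** The morphism Z^p(X) ⊗ Z^q(Y) -> Z^n(X ⊗ Y), for p + q = n, given by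
    x ⊗ y on cocycles. *)

Definition cocyc_tensor :
  hom (cocyc p (sval X) ⊗ cocyc q (sval Y)) (cocyc n (tot X Y)) :=
  cocyc_lift cocyc_tensor_subproof.

End CocycleProduct.

(** The isomorphism from the total complex of two complexes concentrated in
    degree 0. *)

Section TotSingle.
Variables X Y : A.

Definition tot_single_summand n p q :
    hom (single_cx_ob X p ⊗ single_cx_ob Y q) (single_cx_ob (X ⊗ Y) n) :=
  match p as p0, q as q0, n as n0 return
    hom (single_cx_ob X p0 ⊗ single_cx_ob Y q0) (single_cx_ob (X ⊗ Y) n0) with
  | Posz 0, Posz 0, Posz 0 => idm (X ⊗ Y)
  | _, _, _ => 0
  end.

Definition tot_single_def n :
    hom (tot_ob (single A X) (single A Y) n) (single_cx_ob (X ⊗ Y) n) :=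
  @tot_desc A (single A X) (single A Y) n _ (tot_single_summand n).

Lemma tot_single_dif i j :
  tot_single_def j ∘ tot_dif (single A X) (single A Y) i j
  = (0 : hom (single_cx_ob (X ⊗ Y) i) (single_cx_ob (X ⊗ Y) j))
      ∘ tot_single_def i.
Proof.
rewrite [RHS]comp0m; apply: tot_eq => p q pq.
rewrite -compA tot_descE // comp0m /tot_dif_summand /= tmap0m tmapm0.
by rewrite !compm0 mul0rz addr0 compm0.
Qed.

Definition tot_single :
    @hom (cx_plus A) (tot_functor (single A X, single A Y)) (single A (X ⊗ Y)) :=
  @ChainMap A (tot (single A X) (single A Y)) (single_cx (X ⊗ Y))
    tot_single_def tot_single_dif.
End TotSingle.

(** The derived tensor product is the bifunctor on D^+ that is computed by
    flat resolutions: [dtens_eps] : X ⊗^L Y -> X ⊗ Y is an isomorphism if X and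
    Y are complexes of flat objects.  If the Tor-dimension is finite, every
    object of D^+ is isomorphic to such a complex, so that these data are
    unique up to unique isomorphism. *)

Record derived_tensor := DerivedTensor {
  dtens :> functor (der_plus A × der_plus A) (der_plus A);
  dtens_eps : nat_trans (dtens ⊚ prod_functor (loc_plus A) (loc_plus A))
                        (loc_plus A ⊚ tot_functor);
  dtens_flat : forall P Q : cx_plus A,
    (forall n, flat (sval P n)) -> (forall n, flat (sval Q n)) ->
    is_iso (dtens_eps (P, Q)) }.

(** The external products H^p(X) ⊗ H^q(Y) -> H^n(X ⊗^L Y), for p + q = n:
    the natural transformations given on cohomology classes of cocycles of
    complexes by [x] ⊗ [y] |-> [x ⊗ y]. *)

Definition external_product (T : derived_tensor) (p q n : int)
    (k : nat_trans (tens A ⊚ prod_functor (der_coh A p) (der_coh A q))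
                   (der_coh A n ⊚ T)) :=
  forall X Y : cx_plus A,
    fmap (der_coh A n) (dtens_eps T (X, Y)) ∘ k (loc_plus A X, loc_plus A Y)
      ∘ (cls p (sval X) ⊗ₘ cls q (sval Y))
    = cls n (tot X Y) ∘ cocyc_tensor X Y p q n.

End TotalFunctor.

Definition cup_pairing (C D : category) (TC : functor (C × C) C)
    (TD : functor (D × D) D) (F G H : functor C D) :=
  nat_trans (TD ⊚ prod_functor F G) (H ⊚ TC).

Section CupProducts.
Variables A B : tensor_abelian.

(** [f' : B -> A] is the left adjoint f^* of [f]. *)

Definition pre_cup_functor (f : additive_functor A B) :=
  exists (f' : additive_functor B A) (_ : adjunction f' f),
    exact_functor f' /\ forall P : B, flat P -> flat (f' P).

Variables (f g h : additive_functor A B).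
Variables (Rf : right_derived f) (Rg : right_derived g) (Rh : right_derived h).

(** A family of cup products R^r f X ⊗ R^s g Y -> R^{r+s} h (X ⊗ Y); the
    degree of the target is a variable to avoid transports along equalities
    such as r + s.+1 = (r + s).+1. *)

Definition cup_products :=
  forall r s n : nat, (r + s)%N = n ->
    cup_pairing (tens A) (tens B)
      (rderived Rf r) (rderived Rg s) (rderived Rh n).

(** The cup products induced by a derived cup product: the composition of
    the external product, the derived cup product and the morphism
    X ⊗^L Y -> X ⊗ Y in D^+. *)

Definition induced_by (TA : derived_tensor A) (TB : derived_tensor B)
    (Phi : cup_pairing TA TB Rf Rg Rh) (cup : cup_products) :=
  forall (r s n : nat) (e : (r + s)%N = n),
  exists2 k : nat_trans (tens B ⊚ prod_functor (der_coh B r) (der_coh B s))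
                        (der_coh B n ⊚ TB),
    external_product k &
    forall X Y : A,
      cup r s n e (X, Y)
      = fmap (der_coh B n)
          (fmap Rh (fmap (loc_plus A) (tot_single X Y)
                      ∘ dtens_eps TA (single A X, single A Y))
            ∘ Phi (loc_plus A (single A X), loc_plus A (single A Y)))
        ∘ k (Rf (loc_plus A (single A X)), Rg (loc_plus A (single A Y))).

Variable mu : cup_pairing (tens A) (tens B) f g h.

Definition extends_pairing (cup : cup_products) :=
  forall X Y : A,
    cup 0 0 0 erefl (X, Y) ∘ (rderived0 Rf X ⊗ₘ rderived0 Rg Y)
    = rderived0 Rh (X ⊗ Y) ∘ mu (X, Y).

(** The connecting morphism R^n h(X'' ⊗ Y) -> R^{n+1} h(X' ⊗ Y) is that of the
    tensored sequence, which therefore has to be exact. *)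

Definition connecting_left (cup : cup_products) :=
  forall (X' X X'' Y : A) (i : hom X' X) (p : hom X X'')
    (ip : short_exact i p) (ipY : short_exact (i ⊗ₘ idm Y) (p ⊗ₘ idm Y))
    (r s n : nat) (e : (r + s)%N = n),
  cup r.+1 s n.+1 (congr1 S e) (X', Y)
    ∘ (connecting Rf ip r ⊗ₘ idm (rderived Rg s Y))
  = connecting Rh ipY n ∘ cup r s n e (X'', Y).

(** The sign depends on the convention d(x ⊗ y) = dx ⊗ y + (-1)^p x ⊗ dy. *)

Definition connecting_right (cup : cup_products) :=
  forall (X Y' Y Y'' : A) (i : hom Y' Y) (p : hom Y Y'')
    (ip : short_exact i p) (Xip : short_exact (idm X ⊗ₘ i) (idm X ⊗ₘ p))
    (r s n : nat) (e : (r + s)%N = n),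
  cup r s.+1 n.+1 (etrans (addnS r s) (congr1 S e)) (X, Y')
    ∘ (idm (rderived Rf r X) ⊗ₘ connecting Rg ip s)
  = (connecting Rh Xip n ∘ cup r s n e (X, Y'')) *~ (-1) ^+ r.

End CupProducts.

(* Main.v *)
(** The left adjoints f' of f and g' of g are exact, so that they pass to the
    derived categories termwise, and the universal property of Rf provides a
    counit f' Rf Y -> Y and a unit M -> Rf f' M.  For flat complexes M and N, the
    pairing gives M ⊗ N -> f f' M ⊗ g g' N -> h (f' M ⊗ g' N); since f' and g'
    preserve flatness, this extends to M ⊗^L N -> Rh (f' M ⊗^L g' N).  With
    M = Rf X and N = Rg Y, the counits yield the derived cup product.  It commutes
    with shifts, which is the compatibility with connecting morphisms.

    For the uniqueness no injective objects are available.  Instead, a class of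
    R^{r+1} f X' is, up to an epimorphism, a morphism S[-r] -> (Rf X')[1] with S
    flat, or by adjunction f' S[-r] -> X'[1].  Representing it on a flat
    resolution of f' S[-r] and pushing out along the differential of this
    resolution gives an exact sequence 0 -> X' -> X -> X'' -> 0 with X'' flat,
    whose connecting morphism hits the class.  This sequence remains exact after
    tensoring, so that dimension shifting reduces the claim to r = s = 0, where
    f -> R^0 f is an epimorphism by the same argument. *)

From HB Require Import structures.
From mathcomp Require Import all_boot all_order all_algebra.
From mathcomp Require Import boolp.
Require Import Defs.
Set Implicit Arguments.
Unset Strict Implicit.
Unset Printing Implicit Defensive.
Import Order.TTheory GRing.Theory Num.Theory.
Local Open Scope ring_scope.
Local Open Scope cat_scope.

(** * Diagram chasing in abelian categories *)

(** Elements are replaced by morphisms from a test object [T], taken up to epimorphic covers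
    [T' -> T]: preimages and primitives exist only after such a cover. Derived categories are made
    of zigzags, without homotopies or a calculus of fractions; roofs are obtained instead from
    degreewise epimorphic quasi-isomorphisms, which are stable under pullback.

    Two objects are known only indirectly. [Rf] is known through its universal property: natural
    morphisms out of [Rf] agree once they agree after composition with [reta], and since this
    persists after applying any functor, it can be used together with the derived f' and with
    shifts. The derived tensor product is known on flat complexes; naturality carries constructions
    and identities from there to D^+. Flat resolutions of complexes that are unbounded above exist
    because the flat dimensions of their terms are uniformly bounded.

    The sign (-1)^r stems from the isomorphism of X ⊗ Y[1] with (X ⊗ Y)[1], which requires (-1)^p on
    the summands with X^p, whereas X[1] ⊗ Y requires no sign. *)

Section Isomorphisms.
Variable C : category.
Implicit Types X Y Z : C.

Lemma is_iso_epi X Y (u : hom X Y) : is_iso u -> epi u.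
Proof.
by move=> [v [_ uv]] Z a b ab; rewrite -[a]compm1 -[b]compm1 -uv !compA ab.
Qed.

Lemma is_iso_mono X Y (u : hom X Y) : is_iso u -> mono u.
Proof.
by move=> [v [vu _]] Z a b ab; rewrite -[a]comp1m -[b]comp1m -vu -!compA ab.
Qed.

Lemma is_iso_inv X Y (u : hom X Y) (h : is_iso u) : is_iso (inv_iso h).
Proof. by exists u; rewrite inv_isoK inv_isoKV. Qed.

Lemma epiM X Y Z (v : hom Y Z) (u : hom X Y) : epi v -> epi u -> epi (v ∘ u).
Proof. by move=> ev eu T a b; rewrite !compA => /eu/ev. Qed.

Lemma epi_factor X Y Z (v : hom Y Z) (u : hom X Y) : epi (v ∘ u) -> epi v.
Proof. by move=> e T a b ab; apply: e; rewrite !compA ab. Qed.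

Lemma monoM X Y Z (v : hom Y Z) (u : hom X Y) : mono v -> mono u -> mono (v ∘ u).
Proof. by move=> mv mu T a b; rewrite -!compA => /mv/mu. Qed.

Lemma mono_factor X Y Z (v : hom Y Z) (u : hom X Y) : mono (v ∘ u) -> mono u.
Proof. by move=> e T a b ab; apply: e; rewrite -!compA ab. Qed.

Lemma epi1 X : epi (idm X).
Proof. by move=> T a b; rewrite !compm1. Qed.

Lemma is_iso_cancelr X Y Z (v : hom Y Z) (u : hom X Y) :
  is_iso u -> is_iso (v ∘ u) -> is_iso v.
Proof.
move=> [u' [u'u uu']] h.
have -> : v = (v ∘ u) ∘ u' by rewrite -compA uu' compm1.
by apply: is_isoM => //; exists u.
Qed.

End Isomorphisms.

Section Chase.
Variable A : abelian.
Implicit Types X Y Z T U V : A.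

Lemma mono0P X Y (u : hom X Y) :
  (forall T (t : hom T X), u ∘ t = 0 -> t = 0) -> mono u.
Proof.
move=> h T a b ab; apply/eqP; rewrite -subr_eq0; apply/eqP/h.
by rewrite compDr compmN ab subrr.
Qed.

Lemma mono0 X Y T (u : hom X Y) (t : hom T X) : mono u -> u ∘ t = 0 -> t = 0.
Proof. by move=> mu h; apply: mu; rewrite compm0. Qed.

Lemma epi0P X Y (u : hom X Y) :
  (forall T (t : hom Y T), t ∘ u = 0 -> t = 0) -> epi u.
Proof.
move=> h T a b ab; apply/eqP; rewrite -subr_eq0; apply/eqP/h.
by rewrite compDl compNm ab subrr.
Qed.

Lemma epi0 X Y T (u : hom X Y) (t : hom Y T) : epi u -> t ∘ u = 0 -> t = 0.
Proof. by move=> mu h; apply: mu; rewrite comp0m. Qed.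

(** An epimorphism is the cokernel of its kernel, and that kernel is zero here; hence the identity
    of [X] factors through [u]. *)
Lemma mono_epi_iso X Y (u : hom X Y) : mono u -> epi u -> is_iso u.
Proof.
move=> mu eu; have k0 : kerm u = 0 by apply: mu; rewrite kerm0 compm0.
have [_ /(_ _ (idm X))] := epi_normal eu.
rewrite k0 compm0 => /(_ erefl)[v [vu _]]; exists v; split=> //.
by apply: eu; rewrite -compA vu compm1 comp1m.
Qed.

Definition copair X Y Z (u : hom X Z) (v : hom Y Z) : hom (bisum X Y) Z :=
  u ∘ pr1 X Y + v ∘ pr2 X Y.

Definition pair X Y T (u : hom T X) (v : hom T Y) : hom T (bisum X Y) :=
  in1 X Y ∘ u + in2 X Y ∘ v.

Lemma copair1 X Y Z (u : hom X Z) (v : hom Y Z) : copair u v ∘ in1 X Y = u.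
Proof. by rewrite compDl -!compA pr1in1 pr2in1 compm1 compm0 addr0. Qed.

Lemma copair2 X Y Z (u : hom X Z) (v : hom Y Z) : copair u v ∘ in2 X Y = v.
Proof. by rewrite compDl -!compA pr1in2 pr2in2 compm1 compm0 add0r. Qed.

Lemma pair1 X Y T (u : hom T X) (v : hom T Y) : pr1 X Y ∘ pair u v = u.
Proof. by rewrite compDr !compA pr1in1 pr1in2 comp1m comp0m addr0. Qed.

Lemma pair2 X Y T (u : hom T X) (v : hom T Y) : pr2 X Y ∘ pair u v = v.
Proof. by rewrite compDr !compA pr2in1 pr2in2 comp1m comp0m add0r. Qed.

Lemma copair_pair X Y Z T (u : hom X Z) (v : hom Y Z) (a : hom T X) (b : hom T Y) :
  copair u v ∘ pair a b = u ∘ a + v ∘ b.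
Proof. by rewrite compDl -!compA pair1 pair2. Qed.

Lemma pair_eta X Y T (u : hom T (bisum X Y)) : u = pair (pr1 X Y ∘ u) (pr2 X Y ∘ u).
Proof. by rewrite /pair !compA -compDl bisumE comp1m. Qed.

Lemma pair_eq X Y T (u v : hom T (bisum X Y)) :
  pr1 X Y ∘ u = pr1 X Y ∘ v -> pr2 X Y ∘ u = pr2 X Y ∘ v -> u = v.
Proof. by move=> e1 e2; rewrite (pair_eta u) (pair_eta v) e1 e2. Qed.

Lemma copair_eq X Y T (u v : hom (bisum X Y) T) :
  u ∘ in1 X Y = v ∘ in1 X Y -> u ∘ in2 X Y = v ∘ in2 X Y -> u = v.
Proof.
by move=> e1 e2; rewrite -[u]compm1 -[v]compm1 -bisumE !compDr !compA e1 e2.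
Qed.

Lemma epi_copairl X Y Z (u : hom X Z) (v : hom Y Z) : epi u -> epi (copair u v).
Proof.
by move=> eu; apply: (@epi_factor _ _ _ _ _ (in1 X Y)); rewrite copair1.
Qed.

Lemma epi_copairr X Y Z (u : hom X Z) (v : hom Y Z) : epi v -> epi (copair u v).
Proof.
by move=> eu; apply: (@epi_factor _ _ _ _ _ (in2 X Y)); rewrite copair2.
Qed.

Lemma is_zero_bisum X Y : is_zero X -> is_zero Y -> is_zero (bisum X Y).
Proof.
move=> hX hY; apply: copair_eq; apply: zero_obE => //.
Qed.

(** The kernel of [copair p (- t)] is the fibre product. A morphism [v] that kills its projection to
    [T] satisfies [v ∘ pr2 X T = w ∘ phi] for some [w]; then [w ∘ p = 0], so [w = 0] and [v = 0].
    All element chases rest on this: [t] acquires a preimage under [p] after a cover of [T]. *)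
Lemma epi_pullback X Z T (p : hom X Z) (t : hom T Z) : epi p ->
  exists (T' : A) (e : hom T' T) (x : hom T' X), epi e /\ p ∘ x = t ∘ e.
Proof.
move=> ep; pose phi := copair p (- t : hom T Z).
exists (ker phi), (pr2 X T ∘ kerm phi), (pr1 X T ∘ kerm phi); split; last first.
  apply/eqP; rewrite -subr_eq0 -compNm !compA.
  by rewrite -(copair1 p (- t)) in ep *; rewrite copair1 compNm -compNm -compDl kerm0.
have ephi : epi phi by exact: epi_copairl.
apply: epi0P => V v; rewrite compA => vk.
have [_ /(_ _ _ vk)[w [wE _]]] := epi_normal ephi.
have w0 : w = 0.
  apply: ep; rewrite comp0m -(copair1 p (- t)) compA wE -compA pr2in1 compm0 //.
by rewrite -[v]compm1 -(pr2in2 X T) compA -wE w0 !comp0m.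
Qed.

(** Exactness in the middle may be tested on covers: as [i] is a monomorphism, the lift [s] kills
    the kernel of [e] and therefore descends to [T]. *)
Lemma short_exactP X Y Z (i : hom X Y) (p : hom Y Z) :
  mono i -> epi p -> p ∘ i = 0 ->
  (forall T (t : hom T Y), p ∘ t = 0 ->
    exists (T' : A) (e : hom T' T) (s : hom T' X), epi e /\ i ∘ s = t ∘ e) ->
  short_exact i p.
Proof.
move=> mi ep pi0 ex; split; split=> //.
  move=> T t /ex[T' [e [s [ee es]]]].
  have sk : s ∘ kerm e = 0 by apply: mi; rewrite compA es -compA kerm0 !compm0.
  have [_ /(_ _ _ sk)[w [wE _]]] := epi_normal ee.
  exists w; split; first by apply: ee; rewrite -compA wE.
  by move=> w' w'E; apply: mi; rewrite w'E; apply: ee; rewrite -es -compA wE.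
move=> V v vi; have vk : v ∘ kerm p = 0.
  have [T' [e [s [ee es]]]] := ex _ _ (kerm0 p).
  by apply: ee; rewrite -compA -es compA vi !comp0m.
have [_ /(_ _ _ vk)[w [wE _]]] := epi_normal ep; exists w; split=> //.
by move=> w' w'E; apply: ep; rewrite wE w'E.
Qed.

Lemma kernel_lift X Y K T (u : hom X Y) (k : hom K X) (t : hom T X) :
  is_kernel u k -> u ∘ t = 0 -> exists s, k ∘ s = t.
Proof. by move=> [_ h] /h[s [sE _]]; exists s. Qed.

Lemma cokernel_desc X Y Q T (u : hom X Y) (q : hom Y Q) (t : hom Y T) :
  is_cokernel u q -> t ∘ u = 0 -> exists s, s ∘ q = t.
Proof. by move=> [_ h] /h[s [sE _]]; exists s. Qed.

Lemma short_exact_mono X Y Z (i : hom X Y) (p : hom Y Z) : short_exact i p -> mono i.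
Proof. by move=> h; exact: kernel_mono h.1. Qed.

Lemma short_exact_epi X Y Z (i : hom X Y) (p : hom Y Z) : short_exact i p -> epi p.
Proof. by move=> h; exact: cokernel_epi h.2. Qed.

Lemma short_exact_kerm X Y (p : hom X Y) : epi p -> short_exact (kerm p) p.
Proof. by move=> ep; split; [exact: kermP | exact: epi_normal]. Qed.

Lemma short_exact_cokm X Y (i : hom X Y) : mono i -> short_exact i (cokm i).
Proof. by move=> mi; split; [exact: mono_normal | exact: cokmP]. Qed.

(** The kernel of [cokm u] is the image of [u]. Thus [t] factors through the image, and [X] maps
    epimorphically onto the image, so a cover of [T] lifts to [X]. *)
Lemma cokernel_exact X Y Z (u : hom X Y) (q : hom Y Z) T (t : hom T Y) :
  is_cokernel u q -> q ∘ t = 0 ->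
  exists (T' : A) (e : hom T' T) (s : hom T' X), epi e /\ u ∘ s = t ∘ e.
Proof.
move=> qc qt0; pose m := kerm (cokm u).
have [w wE] : exists w : hom Z (coker u), w ∘ q = cokm u.
  by apply: cokernel_desc qc _; exact: cokm0.
have [t' t'E] : exists t', m ∘ t' = t.
  apply: kernel_lift (kermP (cokm u)) _.
  by rewrite -wE -compA qt0 compm0.
have [u' u'E] : exists u', m ∘ u' = u.
  by apply: kernel_lift (kermP (cokm u)) _; exact: cokm0.
suff eu' : epi u'.
  have [T' [e [s [ee es]]]] := epi_pullback t' eu'; exists T', e, s; split=> //.
  by rewrite -u'E -compA es compA t'E.
(* if [v ∘ u' = 0], then [u] factors through the subobject [ker v] of its image *)
apply: epi0P => V v vu'; have [s sE] := kernel_lift (kermP v) vu'.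
pose m' := m ∘ kerm v.
have mm' : mono m' by apply: monoM; exact: mono_kerm.
have [_ m'k] := mono_normal mm'.
have : cokm m' ∘ u = 0.
  have m's : m' ∘ s = u by rewrite -compA sE.
  apply: etrans (congr1 (fun z => cokm m' ∘ z) (esym m's)) _.
  by rewrite compA cokm0 comp0m.
move=> /(cokernel_desc (cokmP u))[r rE].
have /m'k[x [xE _]] : cokm m' ∘ m = 0 by rewrite -rE -compA kerm0 compm0.
have kx : kerm v ∘ x = idm _.
  by apply: (@mono_kerm _ _ _ (cokm u)); rewrite compA compm1.
by rewrite -[v]compm1 -kx compA kerm0 comp0m.
Qed.

Lemma mono_cokernel_short_exact X Y Z (i : hom X Y) (p : hom Y Z) :
  mono i -> is_cokernel i p -> short_exact i p.
Proof.
move=> mi ip; apply: short_exactP => //; first exact: cokernel_epi ip.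
  by case: ip.
by move=> T t; exact: cokernel_exact ip.
Qed.

Lemma image_factor X Y (u : hom X Y) :
  exists (I : A) (m : hom I Y) (e : hom X I), [/\ mono m, epi e & m ∘ e = u].
Proof.
have [u' u'E] : exists u', kerm (cokm u) ∘ u' = u.
  by apply: kernel_lift (kermP (cokm u)) _; exact: cokm0.
exists (ker (cokm u)), (kerm (cokm u)), u'; split=> //; first exact: mono_kerm.
apply: epi0P => V v vu'.
have [T' [e [s [ee es]]]] := cokernel_exact (cokmP u) (kerm0 (cokm u)).
apply: ee; rewrite comp0m.
suff -> : e = u' ∘ s by rewrite compA vu' comp0m.
by apply: (@mono_kerm _ _ _ (cokm u)); rewrite compA u'E es.
Qed.

Lemma is_zero_mono X Y (u : hom X Y) : mono u -> is_zero Y -> is_zero X.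
Proof. by move=> mu h; apply: mu; rewrite compm0 (zero_out (_ ∘ _) h). Qed.

End Chase.

(** * Generalized elements of cohomology *)

Section CohomologyElements.
Variable A : abelian.
Implicit Types (X Y : complex A) (T : A) (n : int).

Definition cyc n X T (z : hom T (X n)) := dif X n (1 + n) ∘ z = 0.

(** A primitive is asked for only after a cover, which makes the condition equivalent to the
    vanishing of the class. The degree [i] is left free to avoid transports: if [n != 1 + i], the
    differential is 0 and the condition says [z = 0]. *)
Definition bdy n X T (z : hom T (X n)) :=
  exists (T' : A) (e : hom T' T) i (y : hom T' (X i)),
    epi e /\ z ∘ e = dif X i n ∘ y.

Lemma cycE n X T (z : hom T (X n)) j : cyc z -> dif X n j ∘ z = 0.
Proof.
move=> zc; have [->//|h] := eqVneq j (1 + n).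
by rewrite dif_shape // comp0m.
Qed.

Lemma cyc_dif n X T i (y : hom T (X i)) : cyc (dif X i n ∘ y).
Proof. by rewrite /cyc compA dif_dif comp0m. Qed.

Lemma cyc_comp n X T T' (z : hom T (X n)) (e : hom T' T) : cyc z -> cyc (z ∘ e).
Proof. by rewrite /cyc compA => ->; rewrite comp0m. Qed.

Lemma cyc_map n X Y (u : chain_map X Y) T (z : hom T (X n)) : cyc z -> cyc (u n ∘ z).
Proof. by rewrite /cyc compA -cmE -compA => ->; rewrite compm0. Qed.

Lemma cycB n X T (z z' : hom T (X n)) : cyc z -> cyc z' -> cyc (z - z').
Proof. by rewrite /cyc compDr compmN => -> ->; rewrite subrr. Qed.

Lemma bdy_dif n X T i (y : hom T (X i)) : bdy (dif X i n ∘ y).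
Proof. by exists T, (idm T), i, y; split; [exact: epi1 | rewrite compm1]. Qed.

Lemma bdy_cover n X T T' (z : hom T (X n)) (e : hom T' T) :
  epi e -> bdy (z ∘ e) -> bdy z.
Proof.
move=> ee [S [f [i [y [ef fE]]]]]; exists S, (e ∘ f), i, y; split.
  exact: epiM.
by rewrite compA.
Qed.

Lemma bdy_src n X T (z : hom T (X n)) : bdy z ->
  exists (T' : A) (e : hom T' T) (y : hom T' (X (n - 1))),
    epi e /\ z ∘ e = dif X (n - 1) n ∘ y.
Proof.
move=> [T' [e [i [y [ee ye]]]]]; exists T', e.
have [ni|ni] := eqVneq n (1 + i).
  have {ni} e1 : i = n - 1 by rewrite ni addrAC subrr add0r.
  by subst i; exists y.
by exists 0; split=> //; rewrite ye dif_shape // comp0m compm0.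
Qed.

Lemma bdy0 n X T : bdy (0 : hom T (X n)).
Proof. by rewrite -(compm0 T (dif X n n)); exact: bdy_dif. Qed.

Lemma bdy_comp n X T T' (z : hom T (X n)) (t : hom T' T) : bdy z -> bdy (z ∘ t).
Proof.
move=> [S [e [i [y [ee yE]]]]]; have [S' [e' [t' [ee' t'E]]]] := epi_pullback t ee.
by exists S', e', i, (y ∘ t'); split=> //; rewrite compA -yE -!compA t'E.
Qed.

Lemma bdy_map n X Y (u : chain_map X Y) T (z : hom T (X n)) : bdy z -> bdy (u n ∘ z).
Proof.
move=> [S [e [i [y [ee yE]]]]]; exists S, e, i, (u i ∘ y); split=> //.
by rewrite -compA yE !compA cmE.
Qed.

Lemma bdyD n X T (z z' : hom T (X n)) : bdy z -> bdy z' -> bdy (z + z').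
Proof.
move=> /bdy_src[S [e [y [ee yE]]]] b'.
have [S' [e' [y' [ee' y'E]]]] := bdy_src (bdy_comp e b').
apply: (bdy_cover (epiM ee ee')); rewrite compDl !compA yE y'E -compA -compDr.
exact: bdy_dif.
Qed.

Lemma bdy_sub n X T (z z' : hom T (X n)) : bdy (z - z') -> bdy z' -> bdy z.
Proof. by move=> b b'; rewrite -[z](subrK z'); exact: bdyD. Qed.

Lemma cls_bdy n X T (z : hom T (X n)) (h : cyc z) :
  cls n X ∘ cocyc_lift h = 0 <-> bdy z.
Proof.
split.
  move=> /(cokernel_exact (cokmP _))[T' [e [y [ee yE]]]].
  exists T', e, (n - 1), y; split=> //.
  by rewrite -cocycm_cobound -compA yE compA cocyc_liftK.
move=> [T' [e [i [y [ee yE]]]]]; apply: ee; rewrite comp0m -compA.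
by apply: (@cls_dif _ _ _ _ _ _ y); rewrite compA cocyc_liftK.
Qed.

Lemma coh_elt n X T (t : hom T (coh n X)) :
  exists (T' : A) (e : hom T' T) (z : hom T' (X n)) (h : cyc z),
    epi e /\ t ∘ e = cls n X ∘ cocyc_lift h.
Proof.
have [T' [e [z [ee zE]]]] := epi_pullback t (@cls_epi _ n X).
have h : cyc (cocycm n X ∘ z) by rewrite /cyc compA dif_cocyc comp0m.
exists T', e, (cocycm n X ∘ z), h; split=> //.
rewrite -zE; congr (_ ∘ _); apply: cocycm_mono; by rewrite cocyc_liftK.
Qed.

Lemma coh_map_lift n X Y (u : chain_map X Y) T (z : hom T (X n)) (h : cyc z)
    (h' : cyc (u n ∘ z)) :
  coh_map n u ∘ (cls n X ∘ cocyc_lift h) = cls n Y ∘ cocyc_lift h'.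
Proof.
rewrite compA coh_mapE -compA; congr (_ ∘ _); apply: cocycm_mono.
by rewrite compA !cocyc_liftK -compA cocyc_liftK.
Qed.

Lemma cocyc_lift_comp n X T T' (z : hom T (X n)) (h : cyc z) (e : hom T' T)
    (h' : cyc (z ∘ e)) : cocyc_lift h ∘ e = cocyc_lift h'.
Proof. by apply: cocycm_mono; rewrite compA !cocyc_liftK. Qed.

Lemma cocyc_liftB n X T (z z' : hom T (X n)) (h : cyc z) (h' : cyc z')
    (h'' : cyc (z - z')) : cocyc_lift h'' = cocyc_lift h - cocyc_lift h'.
Proof.
by apply: cocycm_mono; rewrite compDr compmN !cocyc_liftK.
Qed.

Lemma is_zero_coh n X T (z : hom T (X n)) : is_zero (coh n X) -> cyc z -> bdy z.
Proof. by move=> h zc; apply/(cls_bdy zc); exact: zero_out. Qed.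

Lemma qisP X Y (u : chain_map X Y) :
  (forall n T (z : hom T (X n)), cyc z -> bdy (u n ∘ z) -> bdy z) ->
  (forall n T (z : hom T (Y n)), cyc z ->
    exists (T' : A) (e : hom T' T) (x : hom T' (X n)),
      [/\ epi e, cyc x & bdy (z ∘ e - u n ∘ x)]) ->
  @qis A X Y u.
Proof.
move=> inj sur n; apply: mono_epi_iso => /=.
  apply: mono0P => T t ut0.
  have [T' [e [z [zc [ee zE]]]]] := coh_elt t.
  apply: ee; rewrite comp0m zE; apply/cls_bdy; apply: (inj) => //.
  apply/(cls_bdy (cyc_map u zc)).
  by rewrite -coh_map_lift -zE compA ut0 comp0m.
apply: epi0P => T t tu0.
have [T' [e [z [zc [ee zE]]]]] := coh_elt (idm (coh n Y)).
have [T'' [e' [x [ee' xc b]]]] := sur _ _ _ zc.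
have zc' := cyc_comp e' zc.
have /(cls_bdy (cycB zc' (cyc_map u xc))) := b.
rewrite (cocyc_liftB zc' (cyc_map u xc)) compDr compmN => /eqP.
rewrite subr_eq0 => /eqP.
rewrite -(cocyc_lift_comp zc) compA -zE comp1m -(coh_map_lift xc) => E.
by apply: (epiM ee ee'); rewrite E compA tu0 !comp0m.
Qed.

Lemma qis_inj X Y (u : chain_map X Y) n T (z : hom T (X n)) :
  @qis A X Y u -> cyc z -> bdy (u n ∘ z) -> bdy z.
Proof.
move=> /(_ n)/is_iso_mono mu zc /(cls_bdy (cyc_map u zc)).
by rewrite -(coh_map_lift zc) => /(mono0 mu)/cls_bdy.
Qed.

Lemma qis_surj X Y (u : chain_map X Y) n T (z : hom T (Y n)) :
  @qis A X Y u -> cyc z ->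
    exists (T' : A) (e : hom T' T) (x : hom T' (X n)),
      [/\ epi e, cyc x & bdy (z ∘ e - u n ∘ x)].
Proof.
move=> /(_ n)/is_iso_epi eu zc.
have [T' [e [t [ee tE]]]] := epi_pullback (cls n Y ∘ cocyc_lift zc) eu.
have [T'' [e' [x [xc [ee' xE]]]]] := coh_elt t.
exists T'', (e ∘ e'), x; split=> //; first exact: epiM.
apply/(cls_bdy (cycB (cyc_comp (e ∘ e') zc) (cyc_map u xc))).
rewrite (cocyc_liftB (cyc_comp (e ∘ e') zc) (cyc_map u xc)) compDr compmN.
rewrite -(coh_map_lift xc) -xE -(cocyc_lift_comp zc) !compA -tE.
exact: subrr.
Qed.

End CohomologyElements.

(** * Trivial fibrations of complexes *)

Section TrivialFibrations.
Variable A : abelian.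
Implicit Types (X Y Z : complex A) (T : A) (n : int).

(** Degreewise epimorphisms with acyclic kernel complex; by [tfib_qis] and [surj_qis_tfib] these are
    the degreewise epimorphic quasi-isomorphisms. Acyclicity of the kernel is the form that passes
    to pullbacks. *)
Definition tfib X Y (w : chain_map X Y) :=
  (forall n, epi (w n)) /\
  forall n T (z : hom T (X n)), cyc z -> w n ∘ z = 0 ->
    exists (T' : A) (e : hom T' T) i (y : hom T' (X i)),
      [/\ epi e, z ∘ e = dif X i n ∘ y & w i ∘ y = 0].

(** The differential of any lift [x] of [z] is a cocycle in the kernel of [w]; a primitive [y] of it
    in that kernel corrects [x]. *)
Lemma tfib_cycle X Y (w : chain_map X Y) n T (z : hom T (Y n)) : tfib w -> cyc z ->
  exists (T' : A) (e : hom T' T) (x : hom T' (X n)),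
    [/\ epi e, cyc x & w n ∘ x = z ∘ e].
Proof.
move=> [ew kw] zc; have [T1 [e1 [x [ee1 xE]]]] := epi_pullback z (ew n).
have [||T2 [e2 [i [y [ee2 yE wy]]]]] := kw _ _ (dif X n (1 + n) ∘ x).
- exact: cyc_dif.
- by rewrite compA cmE -compA xE compA zc comp0m.
have [ni|ni] := eqVneq (1 + n) (1 + i); last first.
  exists T2, (e1 ∘ e2), (x ∘ e2); split; first exact: epiM.
    by rewrite /cyc compA yE dif_shape // comp0m.
  by rewrite !compA xE.
have {ni} ni : i = n by apply: (addrI 1).
subst i; exists T2, (e1 ∘ e2), (x ∘ e2 - y); split; first exact: epiM.
  by rewrite /cyc compDr compmN compA yE subrr.
by rewrite compDr compmN wy subr0 !compA xE.
Qed.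

Lemma tfib_qis X Y (w : chain_map X Y) : tfib w -> @qis A X Y w.
Proof.
move=> tw; have [ew kw] := tw; apply: qisP; last first.
  move=> n T z zc; have [T' [e [x [ee xc xE]]]] := tfib_cycle tw zc.
  exists T', e, x; split=> //; rewrite xE subrr.
  by rewrite -(compm0 T' (dif Y n n)); exact: bdy_dif.
move=> n T z zc [T1 [e1 [i [y [ee1 yE]]]]].
have [T2 [e2 [x [ee2 xE]]]] := epi_pullback y (ew i).
have [||T3 [e3 [j [y' [ee3 y'E wy']]]]] := kw n _ (z ∘ e1 ∘ e2 - dif X i n ∘ x).
- by apply: cycB; [do 2!apply: cyc_comp | apply: cyc_dif].
- by rewrite compDr compmN !compA yE cmE -!compA xE subrr.
apply: (bdy_cover (epiM (epiM ee1 ee2) ee3)).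
have [ni|ni] := eqVneq n (1 + i); last first.
  move: y'E; rewrite dif_shape // comp0m subr0 => y'E.
  by rewrite !compA y'E; exact: bdy_dif.
have [nj|nj] := eqVneq n (1 + j); last first.
  move: y'E; rewrite [dif X j n]dif_shape // comp0m compDl compNm => /eqP.
  by rewrite subr_eq0 => /eqP y'E; rewrite !compA y'E -compA; exact: bdy_dif.
have ij : j = i by apply: (addrI 1); rewrite -ni -nj.
subst j; move: y'E; rewrite compDl compNm => /eqP; rewrite subr_eq => /eqP y'E.
by rewrite !compA y'E -compA -compDr; exact: bdy_dif.
Qed.

Lemma surj_qis_tfib X Y (w : chain_map X Y) :
  (forall n, epi (w n)) -> @qis A X Y w -> tfib w.
Proof.
move=> ew qw; split=> // n T z zc wz.
have [|T1 [e1 [y [ee1 yE]]]] := bdy_src (qis_inj (u := w) qw zc _).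
  rewrite wz -(compm0 T (dif Y n n)); exact: bdy_dif.
have wyc : cyc (w _ ∘ y).
  have e : 1 + (n - 1) = n by rewrite addrCA subrr addr0.
  by rewrite /cyc e compA -cmE -compA -yE compA wz comp0m.
have [T2 [e2 [x [ee2 xc b]]]] := qis_surj qw wyc.
have [T3 [e3 [i [y3 [ee3 y3E]]]]] := b.
have [T4 [e4 [x4 [ee4 x4E]]]] := epi_pullback y3 (ew i).
(* The differential of [y] is [z], but [w ∘ y] is only a cocycle. The cocycle [x] lifts it up to the
   coboundary of [y3], and [x4] lifts [y3]. Subtracting [x] and the differential of [x4] moves [y]
   into the kernel of [w] without changing its differential. *)
exists T4, (e1 ∘ e2 ∘ e3 ∘ e4), (n - 1), ((y ∘ e2 - x : hom T2 (X (n - 1))) ∘ e3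
  ∘ e4 - dif X i _ ∘ x4).
split.
- by do 3!apply: epiM => //.
- rewrite compDr compmN [dif X _ _ ∘ (dif _ _ _ ∘ _)]compA dif_dif comp0m subr0.
  rewrite !compDl !compDr !compNm !compmN !compA yE -!compA.
  by rewrite [dif _ _ _ ∘ (x ∘ _)]compA (cycE _ xc) comp0m subr0.
- apply/eqP; rewrite compDr compmN subr_eq0; apply/eqP.
  rewrite [RHS]compA cmE -[RHS]compA x4E [RHS]compA -y3E !compA.
  by rewrite compDr compmN compA.
Qed.

Lemma tfib1 X : @tfib X X (idm (X : complexes A)).
Proof.
split=> [n|n T z zc]; first exact: epi1.
rewrite /= comp1m => ->; exists T, (idm T), n, 0; split; first exact: epi1.
  by rewrite comp0m compm0.
exact: compm0.
Qed.

Lemma tfibM X Y Z (v : @hom (complexes A) Y Z) (u : @hom (complexes A) X Y) :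
  tfib v -> tfib u -> tfib (v ∘ u).
Proof.
move=> tv tu; apply: surj_qis_tfib.
  by move=> n; apply: epiM; [apply: tv.1 | apply: tu.1].
by move=> n; rewrite fmapM; apply: is_isoM; apply: tfib_qis.
Qed.

End TrivialFibrations.

Section Pullback.
Variable A : abelian.
Variables (X Y Z : complex A) (u : chain_map X Z) (w : chain_map Y Z).

Definition pb_ob n : A := ker (copair (u n) (- w n : hom (Y n) (Z n))).

Definition pb_in n : hom (pb_ob n) (bisum (X n) (Y n)) := kerm _.

Lemma pb_lift n T (x : hom T (X n)) (y : hom T (Y n)) : u n ∘ x = w n ∘ y ->
  exists t : hom T (pb_ob n), pb_in n ∘ t = pair x y.
Proof.
move=> xy; apply: kernel_lift (kermP _) _.
by rewrite copair_pair compNm xy subrr.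
Qed.

Lemma pb_comm n : u n ∘ (pr1 _ _ ∘ pb_in n) = w n ∘ (pr2 _ _ ∘ pb_in n).
Proof.
apply/eqP; rewrite -subr_eq0 -compNm !compA -compDl.
by apply/eqP; exact: (kerm0 (copair (u n) (- w n))).
Qed.

Lemma pb_dif_ex i j : exists d : hom (pb_ob i) (pb_ob j),
  pb_in j ∘ d = pair (dif X i j ∘ (pr1 _ _ ∘ pb_in i)) (dif Y i j ∘ (pr2 _ _ ∘ pb_in i)).
Proof.
by apply: pb_lift; rewrite [LHS]compA [RHS]compA !cmE -!compA pb_comm.
Qed.

Definition pb_dif i j : hom (pb_ob i) (pb_ob j) := projT1 (cid (pb_dif_ex i j)).

Lemma pb_difE i j : pb_in j ∘ pb_dif i j =
  pair (dif X i j ∘ (pr1 _ _ ∘ pb_in i)) (dif Y i j ∘ (pr2 _ _ ∘ pb_in i)).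
Proof. by rewrite /pb_dif; case: cid. Qed.

Lemma pb_in_mono n : mono (pb_in n).
Proof. exact: mono_kerm. Qed.

Lemma pb_shape i j : j != 1 + i -> pb_dif i j = 0.
Proof.
move=> h; apply: pb_in_mono; rewrite pb_difE compm0 !dif_shape // !comp0m.
by rewrite /pair !compm0 addr0.
Qed.

Lemma pb_dif_dif i j k : pb_dif j k ∘ pb_dif i j = 0.
Proof.
apply: pb_in_mono; rewrite compA pb_difE compm0; apply: pair_eq.
  rewrite compA pair1 compm0 -!compA pb_difE pair1 !compA dif_dif !comp0m //.
rewrite compA pair2 compm0 -!compA pb_difE pair2 !compA dif_dif !comp0m //.
Qed.

Definition pb : complex A := @Complex A pb_ob pb_dif pb_shape pb_dif_dif.

Definition pb_fst : chain_map pb X.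
Proof.
refine (@ChainMap A pb X (fun n => pr1 _ _ ∘ pb_in n) _).
by move=> i j; rewrite -compA pb_difE pair1.
Defined.

Definition pb_snd : chain_map pb Y.
Proof.
refine (@ChainMap A pb Y (fun n => pr2 _ _ ∘ pb_in n) _).
by move=> i j; rewrite -compA pb_difE pair2.
Defined.

Lemma pb_square :
  (u : @hom (complexes A) X Z) ∘ pb_fst = (w : @hom (complexes A) Y Z) ∘ pb_snd.
Proof. by apply: chain_mapP => n; exact: pb_comm. Qed.

Lemma pb_bounded : bounded X -> bounded Y -> bounded pb.
Proof.
move=> [a Xa] [b Yb]; exists (Num.min a b) => n; rewrite lt_min => /andP[na nb].
apply: is_zero_mono (@pb_in_mono n) _.
by apply: is_zero_bisum; [exact: Xa | exact: Yb].
Qed.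

(** The kernel of [pb_fst] is the kernel of [w], embedded with first component 0. *)
Lemma pb_tfib : tfib w -> tfib pb_fst.
Proof.
move=> [ew kw]; split=> [n|n T z zc z0].
  have [T [e [y [ee yE]]]] := epi_pullback (u n) (ew n).
  have [t tE] := pb_lift (esym yE).
  by apply: (@epi_factor _ _ _ _ _ t); rewrite /= -compA tE pair1.
have zE : w n ∘ (pr2 _ _ ∘ pb_in n ∘ z) = 0.
  by rewrite compA -pb_comm -compA [X in _ ∘ X]z0 compm0.
have zc' : cyc (pr2 _ _ ∘ pb_in n ∘ z).
  by move: (cyc_map pb_snd zc).
have [T' [e [i [y [ee yE wy]]]]] := kw _ _ _ zc' zE.
have [|t tE] := @pb_lift i _ 0 y; first by rewrite wy compm0.
exists T', e, i, t; split=> //; last by rewrite /= -compA tE pair1.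
apply: pb_in_mono; rewrite [RHS]compA pb_difE; apply: pair_eq.
  rewrite [RHS]compA pair1 -!compA tE pair1 compm0 !compA.
  by rewrite -[RHS](comp0m _ e) -z0.
by rewrite [RHS]compA pair2 -!compA tE pair2 !compA.
Qed.

End Pullback.

(** * Flat objects and flat resolutions *)

Section Flatness.
Variable A : tensor_abelian.
Implicit Types X Y Z K P Q T U V W : A.

Lemma tbraid_iso X Y : is_iso (tbraid (tmon A) X Y).
Proof. by exists (tbraid (tmon A) Y X); rewrite !tsymmetry. Qed.

Lemma mono_tmap_swap X Y P (i : hom X Y) :
  mono (i ⊗ₘ idm P) <-> mono (idm P ⊗ₘ i).
Proof.
split=> m.
  apply: (@mono_factor _ _ _ _ (tbraid (tmon A) P Y)); rewrite tbraid_nat.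
  by apply: monoM => //; apply: is_iso_mono; exact: tbraid_iso.
apply: (@mono_factor _ _ _ _ (tbraid (tmon A) Y P)); rewrite tbraid_nat.
by apply: monoM => //; apply: is_iso_mono; exact: tbraid_iso.
Qed.

Lemma tmapC X X' Y Y' (u : hom X X') (v : hom Y Y') :
  (u ⊗ₘ idm Y') ∘ (idm X ⊗ₘ v) = (idm X' ⊗ₘ v) ∘ (u ⊗ₘ idm Y).
Proof. by rewrite !tmapM !comp1m !compm1. Qed.

Lemma epi_tmapl X Y P (p : hom X Y) : epi p -> epi (p ⊗ₘ idm P).
Proof.
by move=> /epi_normal/(@tensor_rexactl A _ _ _ P)/cokernel_epi.
Qed.

Lemma epi_tmapr X Y P (p : hom X Y) : epi p -> epi (idm P ⊗ₘ p).
Proof.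
by move=> /epi_normal/(@tensor_rexactr A _ _ _ P)/cokernel_epi.
Qed.

Lemma epi_tmap X X' Y Y' (p : hom X X') (q : hom Y Y') :
  epi p -> epi q -> epi (p ⊗ₘ q).
Proof.
move=> ep eq; have -> : p ⊗ₘ q = (p ⊗ₘ idm Y') ∘ (idm X ⊗ₘ q).
  by rewrite tmapM comp1m compm1.
by apply: epiM; [exact: epi_tmapl | exact: epi_tmapr].
Qed.

Lemma flat_mono P X Y (i : hom X Y) : flat P -> mono i -> mono (idm P ⊗ₘ i).
Proof. by move=> fP /short_exact_cokm/fP/short_exact_mono. Qed.

Lemma flatP P :
  (forall X Y (i : hom X Y), mono i -> mono (idm P ⊗ₘ i)) -> flat P.
Proof.
move=> h X Y Z i p ip; apply: mono_cokernel_short_exact.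
  by apply: h; exact: short_exact_mono ip.
exact: tensor_rexactr ip.2.
Qed.

Lemma tensor_exactr X Y Z P (i : hom X Y) (p : hom Y Z) T (t : hom T (P ⊗ Y)) :
  is_cokernel i p -> (idm P ⊗ₘ p) ∘ t = 0 ->
  exists (T' : A) (e : hom T' T) (s : hom T' (P ⊗ X)),
    epi e /\ (idm P ⊗ₘ i) ∘ s = t ∘ e.
Proof. by move=> /(@tensor_rexactr A _ _ _ P)/cokernel_exact h /h. Qed.

Lemma tensor_exactl X Y Z P (i : hom X Y) (p : hom Y Z) T (t : hom T (Y ⊗ P)) :
  is_cokernel i p -> (p ⊗ₘ idm P) ∘ t = 0 ->
  exists (T' : A) (e : hom T' T) (s : hom T' (X ⊗ P)),
    epi e /\ (i ⊗ₘ idm P) ∘ s = t ∘ e.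
Proof. by move=> /(@tensor_rexactl A _ _ _ P)/cokernel_exact h /h. Qed.

Lemma flat_zero X : is_zero X -> flat X.
Proof.
move=> h; apply: flatP => U V i _; apply: mono0P => T t _.
by apply: zero_out; exact: tens_zerol.
Qed.

Lemma flat_iso P Q (u : hom P Q) : is_iso u -> flat P -> flat Q.
Proof.
move=> [v [vu uv]] fP; apply: flatP => X Y i mi.
apply: (@mono_factor _ _ _ _ (v ⊗ₘ idm Y)); rewrite tmapC.
apply: monoM; first exact: flat_mono.
apply: is_iso_mono; exists (u ⊗ₘ idm X).
by rewrite !tmapM uv vu !comp1m !tmap1.
Qed.

Lemma bisum_short_exact X Y : short_exact (in1 X Y) (pr2 X Y).
Proof.
apply: short_exactP.
- by apply: (@mono_factor _ _ _ _ (pr1 X Y)); rewrite pr1in1; apply: is_iso_mono; exact: is_iso1.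
- by apply: (@epi_factor _ _ _ _ _ (in2 X Y)); rewrite pr2in2; exact: epi1.
- exact: pr2in1.
- move=> T t t0; exists T, (idm T), (pr1 X Y ∘ t); split; first exact: epi1.
  rewrite compm1 [RHS]pair_eta; apply: pair_eq; rewrite ?pair1 ?pair2 compA.
    by rewrite pr1in1 comp1m.
  by rewrite pr2in1 comp0m t0.
Qed.

Hypothesis enough_flat : forall X, exists P (p : hom P X), flat P /\ epi p.

(** This is the vanishing of Tor_1(Y, X) for flat [X], proved without Tor. Cover [Y] by a flat [Q]
    with kernel [N] and chase in the diagram of [N], [Q], [Y] tensored with [K], [L], [X]. The chase
    needs N ⊗ X -> Q ⊗ X and Q ⊗ K -> Q ⊗ L to be monomorphisms, which flatness of [X] and of [Q]
    provides. *)
Lemma flat_quotient_mono K L X (i : hom K L) (p : hom L X) Y :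
  short_exact i p -> flat X -> mono (idm Y ⊗ₘ i).
Proof.
move=> ip fX; have [Q [q [fQ eq]]] := enough_flat Y.
have nq := short_exact_kerm eq; set n := kerm q in nq.
apply: mono0P => T t it0.
have [T1 [e1 [k [ee1 kE]]]] := epi_pullback t (@epi_tmapl _ _ K _ eq).
have [|T2 [e2 [m [ee2 mE]]]] := @tensor_exactl _ _ _ L n q _ ((idm Q ⊗ₘ i) ∘ k) nq.2.
  by rewrite compA tmapC -compA kE compA it0 comp0m.
have m0 : (idm _ ⊗ₘ p) ∘ m = 0.
  have mono_nX : mono (n ⊗ₘ idm X).
    by apply/mono_tmap_swap; apply: flat_mono => //; exact: mono_kerm.
  apply: (mono0 mono_nX).
  rewrite compA tmapC -compA mE !compA tmapM comp1m.
  by rewrite ip.1.1 tmapm0 !comp0m.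
have [T3 [e3 [k' [ee3 k'E]]]] := tensor_exactr ip.2 m0.
have kk' : (n ⊗ₘ idm K) ∘ k' = k ∘ e2 ∘ e3.
  apply: (flat_mono fQ (short_exact_mono ip)).
  by rewrite compA -tmapC -compA k'E compA mE -!compA.
apply: (epiM (epiM ee1 ee2) ee3).
rewrite comp0m !compA -kE -!compA [k ∘ _]compA -kk' compA tmapM nq.1.1.
by rewrite tmap0m comp0m.
Qed.

Lemma flat_quotient_exact K L X (i : hom K L) (p : hom L X) Y :
  short_exact i p -> flat X -> short_exact (idm Y ⊗ₘ i) (idm Y ⊗ₘ p).
Proof.
move=> ip fX; apply: mono_cokernel_short_exact.
  exact: flat_quotient_mono ip fX.
exact: tensor_rexactr ip.2.
Qed.

Lemma flat_quotient_exactl K L X (i : hom K L) (p : hom L X) Y :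
  short_exact i p -> flat X -> short_exact (i ⊗ₘ idm Y) (p ⊗ₘ idm Y).
Proof.
move=> ip fX; apply: mono_cokernel_short_exact.
  by apply/mono_tmap_swap; exact: flat_quotient_mono ip fX.
exact: tensor_rexactl ip.2.
Qed.

(** As [X] is flat, [i ⊗ₘ idm U] remains a monomorphism; then flatness of [P] suffices. *)
Lemma flat_ker K P X (i : hom K P) (p : hom P X) :
  short_exact i p -> flat P -> flat X -> flat K.
Proof.
move=> ip fP fX; apply: flatP => U V j mj.
apply: (@mono_factor _ _ _ _ (i ⊗ₘ idm V)); rewrite tmapC.
apply: monoM; first exact: flat_mono.
exact: short_exact_mono (flat_quotient_exactl U ip fX).
Qed.

Lemma flat_ext X E P (i : hom X E) (p : hom E P) :
  short_exact i p -> flat X -> flat P -> flat E.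
Proof.
move=> ip fX fP; apply: flatP => U V j mj; apply: mono0P => T t t0.
have pt0 : (p ⊗ₘ idm U) ∘ t = 0.
  by apply: (mono0 (flat_mono fP mj)); rewrite compA -tmapC -compA t0 compm0.
have [T1 [e1 [x [ee1 xE]]]] := tensor_exactl ip.2 pt0.
apply: ee1; rewrite -xE comp0m.
suff -> : x = 0 by rewrite compm0.
apply: (mono0 (flat_mono fX mj)).
apply: (mono0 (short_exact_mono (flat_quotient_exactl V ip fP))).
by rewrite compA tmapC -compA xE compA t0 comp0m.
Qed.

(** Flat dimension at most [d], expressed by syzygies: this form permits induction on [d] without
    handling resolutions as complexes. *)
Fixpoint fdim d X : Prop :=
  if d is d'.+1 then
    exists K P (i : hom K P) (p : hom P X),
      [/\ short_exact i p, flat P & fdim d' K]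
  else flat X.

Lemma short_exact_id X : short_exact (0 : hom zero_ob X) (idm X).
Proof.
apply: short_exactP; [| exact: epi1 | exact: compm0 |].
  by apply: mono0P => T t _; exact: (zero_out t (zero_obP A)).
move=> T t; rewrite comp1m => ->; exists T, (idm T), 0; split.
  exact: epi1.
by rewrite !comp0m.
Qed.

Lemma flat_fdim d X : flat X -> fdim d X.
Proof.
elim: d X => [//|d IH] X fX; exists zero_ob, X, 0, (idm X); split=> //.
  exact: short_exact_id.
by apply: IH; apply: flat_zero; exact: zero_obP.
Qed.

Lemma fdim_iso d X Y (u : hom X Y) : is_iso u -> fdim d X -> fdim d Y.
Proof.
case: d => [|d] iu; first exact: flat_iso iu.
move=> [K [P [i [p [ip fP fK]]]]]; exists K, P, i, (u ∘ p); split=> //.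
have mi := short_exact_mono ip; apply: short_exactP => //.
- by apply: epiM; [exact: is_iso_epi | exact: short_exact_epi ip].
- by rewrite -compA ip.1.1 compm0.
- move=> T t; rewrite -compA => /(mono0 (is_iso_mono iu)).
  exact: cokernel_exact ip.2.
Qed.

Lemma fdim_zero d X : is_zero X -> fdim d X.
Proof. by move=> h; apply: flat_fdim; exact: flat_zero. Qed.

(* The kernel of P ⊕ Q -> K is an extension of ker (Q -> F) by ker (P -> K'). *)
Lemma fdim_ext d K' K F (i : hom K' K) (p : hom K F) :
  short_exact i p -> fdim d K' -> flat F -> fdim d K.
Proof.
elim: d K' K F i p => [|d IH] K' K F i p ip; first exact: flat_ext ip.
move=> [L [P [j [q [jq fP fL]]]]] fF.
have [Q [r [fQ er]]] := enough_flat K.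
have eqq := short_exact_epi jq.
have epr : epi (p ∘ r) by apply: epiM => //; exact: short_exact_epi ip.
have sG := short_exact_kerm epr; have fG := flat_ker sG fQ fF.
set G := ker (p ∘ r) in sG fG; set g : hom G Q := kerm (p ∘ r) in sG.
pose phi : hom (bisum P Q) K := copair (i ∘ q) r.
have ephi : epi phi by exact: epi_copairr.
have sE := short_exact_kerm ephi.
exists (ker phi), (bisum P Q), (kerm phi), phi; split=> //.
  apply: (@flat_ext _ _ _ (in1 P Q) (pr2 P Q)) => //.
  exact: bisum_short_exact.
have [l lE] : exists l, kerm phi ∘ l = in1 P Q ∘ j.
  apply: kernel_lift (kermP _) _.
  by rewrite compA copair1 -compA jq.1.1 compm0.
have [s sE'] : exists s, g ∘ s = pr2 P Q ∘ kerm phi.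
  apply: kernel_lift (kermP _) _.
  have /(congr1 (fun z => p ∘ z)) := kerm0 phi.
  rewrite compm0 {1}/phi compDl compDr !compA ip.1.1 !comp0m add0r.
  by rewrite -!compA.
apply: (IH L _ G l s) => //; apply: short_exactP.
- apply: (@mono_factor _ _ _ _ (kerm phi)); rewrite lE; apply: monoM.
    by apply: (@mono_factor _ _ _ _ (pr1 P Q)); rewrite pr1in1; apply: is_iso_mono; exact: is_iso1.
  exact: short_exact_mono jq.
- have pg0 : p ∘ (r ∘ g) = 0 by rewrite compA kerm0.
  have [x xE] := kernel_lift ip.1 pg0.
  have [T [e [y [ee yE]]]] := epi_pullback x eqq.
  have [t tE] : exists t, kerm phi ∘ t = pair (- y : hom T P) (g ∘ e).
    apply: kernel_lift (kermP _) _.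
    by rewrite copair_pair compmN -compA yE compA xE compA addNr.
  apply: (@epi_factor _ _ _ _ _ t).
  suff -> : s ∘ t = e by [].
  by apply: (short_exact_mono sG); rewrite compA sE' -compA tE pair2.
- apply: (short_exact_mono sG); rewrite compA sE' -compA lE compA pr2in1.
  by rewrite comp0m compm0.
- move=> T t st0.
  have t2 : pr2 P Q ∘ (kerm phi ∘ t) = 0.
    by rewrite compA -sE' -compA st0 compm0.
  have : phi ∘ (kerm phi ∘ t) = 0 by rewrite compA kerm0 comp0m.
  rewrite (pair_eta (kerm phi ∘ t)) copair_pair t2 compm0 addr0 -compA.
  move=> /(mono0 (short_exact_mono ip)) /(cokernel_exact jq.2).
  move=> [T' [e [y [ee yE]]]]; exists T', e, y; split=> //.
  apply: (@mono_kerm _ _ _ phi); rewrite compA lE -compA yE.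
  apply: pair_eq; first by rewrite !compA pr1in1 comp1m.
  by rewrite !compA pr2in1 !comp0m -[pr2 P Q ∘ _ ∘ _]compA t2 comp0m.
Qed.

(** For a flat cover [P] of [E] with kernel [L], the kernel of P -> E -> F is again flat, and it
    covers [K] with the same kernel [L]. *)
Lemma fdim_ker d K E F (i : hom K E) (p : hom E F) :
  short_exact i p -> fdim d E -> flat F -> fdim d K.
Proof.
case: d => [|d] ip; first exact: flat_ker ip.
move=> [L [P [j [q [jq fP fL]]]]] fF.
have epq : epi (p ∘ q) by apply: epiM; [exact: short_exact_epi ip | exact: short_exact_epi jq].
have sG := short_exact_kerm epq; have fG := flat_ker sG fP fF.
have [s sE] : exists s, i ∘ s = q ∘ kerm (p ∘ q).
  by apply: kernel_lift ip.1 _; rewrite compA kerm0.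
have [l lE] : exists l, kerm (p ∘ q) ∘ l = j.
  by apply: kernel_lift (kermP _) _; rewrite -compA jq.1.1 compm0.
exists L, (ker (p ∘ q)), l, s; split=> //; apply: short_exactP.
- by apply: (@mono_factor _ _ _ _ (kerm (p ∘ q))); rewrite lE; exact: short_exact_mono jq.
- have [T [e [y [ee yE]]]] := epi_pullback i (short_exact_epi jq).
  have [t tE] : exists t, kerm (p ∘ q) ∘ t = y.
    by apply: kernel_lift (kermP _) _; rewrite -compA yE compA ip.1.1 comp0m.
  apply: (@epi_factor _ _ _ _ _ t).
  suff -> : s ∘ t = e by [].
  by apply: (short_exact_mono ip); rewrite compA sE -compA tE yE.
- by apply: (short_exact_mono ip); rewrite compA sE -compA lE jq.1.1 compm0.
- move=> T t st0; have : q ∘ (kerm (p ∘ q) ∘ t) = 0 by rewrite compA -sE -compA st0 compm0.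
  move=> /(cokernel_exact jq.2)[T' [e [y [ee yE]]]]; exists T', e, y; split=> //.
  by apply: (@mono_kerm _ _ _ (p ∘ q)); rewrite compA lE yE compA.
Qed.

(* The pullback E of P -> X <- P' is an extension of P by K', and K = ker (E -> P'). *)
Lemma fdim_syzygy d K P X (i : hom K P) (p : hom P X) :
  short_exact i p -> flat P -> fdim d.+1 X -> fdim d K.
Proof.
move=> ip fP [K' [P' [i' [p' [ip' fP' fK']]]]].
pose phi : hom (bisum P P') X := copair p (- p' : hom P' X).
have epp := short_exact_epi ip; have epp' := short_exact_epi ip'.
have lift T (a : hom T P) (b : hom T P') : p ∘ a = p' ∘ b ->
    exists t, kerm phi ∘ t = pair a b.
  by move=> ab; apply: kernel_lift (kermP _) _; rewrite copair_pair compNm ab subrr.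
have comm : p ∘ (pr1 P P' ∘ kerm phi) = p' ∘ (pr2 P P' ∘ kerm phi).
  apply/eqP; rewrite -subr_eq0 -compNm !compA -compDl.
  by apply/eqP; exact: (kerm0 phi).
have [k kE] : exists k, kerm phi ∘ k = pair i 0.
  by apply: lift; rewrite ip.1.1 compm0.
have [k' k'E] : exists k', kerm phi ∘ k' = pair 0 i'.
  by apply: lift; rewrite ip'.1.1 compm0.
suff fE : fdim d (ker phi).
  apply: (@fdim_ker d _ (ker phi) P' k (pr2 P P' ∘ kerm phi)) => //.
  apply: short_exactP.
  - apply: (@mono_factor _ _ _ _ (pr1 P P' ∘ kerm phi)); rewrite -compA kE pair1.
    exact: short_exact_mono ip.
  - have [T [e [y [ee yE]]]] := epi_pullback p' epp.
    have [t tE] := lift _ _ _ yE.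
    by apply: (@epi_factor _ _ _ _ _ t); rewrite -compA tE pair2.
  - by rewrite -compA kE pair2.
  - move=> T t t0; have : p ∘ (pr1 P P' ∘ kerm phi ∘ t) = 0.
      by rewrite compA comm -compA t0 compm0.
    move=> /(kernel_lift ip.1)[s sE]; exists T, (idm T), s; split; first exact: epi1.
    apply: (@mono_kerm _ _ _ phi); rewrite compA kE compm1.
    by apply: pair_eq; rewrite !compA ?pair1 ?pair2 ?sE // comp0m t0.
apply: (@fdim_ext d K' (ker phi) P k' (pr1 P P' ∘ kerm phi)) => //.
apply: short_exactP.
- apply: (@mono_factor _ _ _ _ (pr2 P P' ∘ kerm phi)); rewrite -compA k'E pair2.
  exact: short_exact_mono ip'.
- have [T [e [y [ee yE]]]] := epi_pullback p epp'.
  have [t tE] := lift _ _ _ (esym yE).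
  by apply: (@epi_factor _ _ _ _ _ t); rewrite -compA tE pair1.
- by rewrite -compA k'E pair1.
- move=> T t t0; have : p' ∘ (pr2 P P' ∘ kerm phi ∘ t) = 0.
    by rewrite compA -comm -compA t0 compm0.
  move=> /(kernel_lift ip'.1)[s sE]; exists T, (idm T), s; split; first exact: epi1.
  apply: (@mono_kerm _ _ _ phi); rewrite compA k'E compm1.
  by apply: pair_eq; rewrite !compA ?pair1 ?pair2 ?sE // comp0m t0.
Qed.

End Flatness.

(** * Contractible complexes, sums, kernels and mapping cones *)

Section Constructions.
Variable A : abelian.

(** A total substitute for the transport along [i = j], with default value 0. Differentials between
    degrees that are only provably equal can thus be written down for all pairs of degrees. *)
Definition eqmap (F : int -> A) i j : hom (F i) (F j) :=
  match pselect (i = j) with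
  | left e => ecast x (hom (F i) (F x)) e (idm (F i))
  | right _ => 0
  end.

Lemma eqmap_id F i : eqmap F i i = idm (F i).
Proof. by rewrite /eqmap; case: pselect => // e; rewrite (Prop_irrelevance e erefl). Qed.

Lemma eqmap0 F i j : i != j -> eqmap F i j = 0.
Proof. by rewrite /eqmap; case: pselect => // e /eqP. Qed.

Lemma eqmap0r F i j : j != i -> eqmap F i j = 0.
Proof. by rewrite eq_sym; exact: eqmap0. Qed.

Lemma int_succ (n : int) : exists i, n = 1 + i.
Proof. by exists (n - 1); rewrite addrCA subrr addr0. Qed.

(** The total space of the identity of the graded object [F]: a contractible
    complex which maps to [X] as soon as [F] maps to [X] degreewise. *)

Section Contractible.
Variable F : int -> A.

Definition cov_dif i j : hom (bisum (F i) (F (i - 1))) (bisum (F j) (F (j - 1))) :=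
  in2 _ _ ∘ eqmap F i (j - 1) ∘ pr1 _ _.

Lemma cov_shape i j : j != 1 + i -> cov_dif i j = 0.
Proof.
move=> h; rewrite /cov_dif eqmap0 ?compm0 ?comp0m //.
by apply: contraNneq h => ->; rewrite addrCA subrr addr0.
Qed.

Lemma cov_dif_dif i j k : cov_dif j k ∘ cov_dif i j = 0.
Proof. by rewrite /cov_dif !compA -[_ ∘ pr1 _ _ ∘ in2 _ _]compA pr1in2 compm0 !comp0m. Qed.

Definition cov : complex A :=
  @Complex A (fun n => bisum (F n) (F (n - 1))) cov_dif cov_shape cov_dif_dif.

Lemma cov_acyclic n T (z : hom T (cov n)) : cyc z ->
  exists i (y : hom T (cov i)), z = dif cov i n ∘ y.
Proof.
rewrite /cyc /= /cov_dif -!compA => /(congr1 (comp (pr2 _ _))).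
rewrite compA pr2in2 comp1m compm0.
have -> : 1 + n - 1 = n by rewrite addrAC subrr add0r.
rewrite eqmap_id comp1m => z1.
exists (n - 1), (in1 _ _ ∘ (pr2 _ _ ∘ z)); apply: pair_eq.
  by rewrite z1 !compA pr1in2 !comp0m.
rewrite !compA pr2in2 comp1m -[_ ∘ pr1 _ _ ∘ in1 _ _]compA pr1in1 compm1.
by rewrite eqmap_id comp1m.
Qed.

Lemma cov_bounded : (exists m, forall n, n < m -> is_zero (F n)) -> bounded cov.
Proof.
move=> [m h]; exists m => n nm; apply: is_zero_bisum; apply: h => //.
by rewrite ltrBlDr ltr_wpDr.
Qed.

Variables (X : complex A) (eps : forall n, hom (F n) (X n)).

Definition cov_map : chain_map cov X.
Proof.
refine (@ChainMap A cov X
  (fun n => copair (eps n) (dif X (n - 1) n ∘ eps (n - 1))) _).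
move=> i j; rewrite /= /cov_dif !compA copair2.
rewrite [RHS]compDr !compA dif_dif !comp0m addr0.
have [-> | h] := eqVneq j (1 + i); last first.
  rewrite eqmap0 ?compm0 ?comp0m ?dif_shape ?comp0m //.
  by apply: contraNneq h => ->; rewrite addrCA subrr addr0.
have -> : 1 + i - 1 = i by rewrite addrAC subrr add0r.
by rewrite eqmap_id compm1.
Defined.

Lemma cov_map_epi : (forall n, epi (eps n)) -> forall n, epi (cov_map n).
Proof. by move=> h n; exact: epi_copairl. Qed.

End Contractible.

Section Sum.
Variables X Y : complex A.

Definition csum_dif i j : hom (bisum (X i) (Y i)) (bisum (X j) (Y j)) :=
  pair (dif X i j ∘ pr1 _ _) (dif Y i j ∘ pr2 _ _).

Lemma csum_shape i j : j != 1 + i -> csum_dif i j = 0.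
Proof.
by move=> h; rewrite /csum_dif !dif_shape // /pair !comp0m !compm0 addr0.
Qed.

Lemma csum_dif_dif i j k : csum_dif j k ∘ csum_dif i j = 0.
Proof.
apply: pair_eq; rewrite compm0 !compA ?pair1 ?pair2 -compA ?pair1 ?pair2.
  by rewrite compA dif_dif comp0m.
by rewrite compA dif_dif comp0m.
Qed.

Definition csum : complex A :=
  @Complex A (fun n => bisum (X n) (Y n)) csum_dif csum_shape csum_dif_dif.

Lemma csum_bounded : bounded X -> bounded Y -> bounded csum.
Proof.
move=> [a Xa] [b Yb]; exists (Num.min a b) => n; rewrite lt_min => /andP[na nb].
by apply: is_zero_bisum; [exact: Xa | exact: Yb].
Qed.

Definition csum_fst : chain_map csum X.
Proof.
refine (@ChainMap A csum X (fun n => pr1 _ _) _) => i j.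
by rewrite /= pair1.
Defined.

Definition csum_in : chain_map X csum.
Proof.
refine (@ChainMap A X csum (fun n => in1 _ _) _) => i j.
apply: pair_eq; rewrite /= !compA ?pair1 ?pair2 -!compA ?pr1in1 ?pr2in1.
  by rewrite compA pr1in1 comp1m compm1.
by rewrite compA pr2in1 comp0m compm0.
Defined.

Lemma csum_fst_in : (csum_fst : @hom (complexes A) _ _) ∘ csum_in = idm (X : complexes A).
Proof. by apply: chain_mapP => n; exact: pr1in1. Qed.

Definition csum_desc (Z : complex A) (u : chain_map X Z) (v : chain_map Y Z) :
  chain_map csum Z.
Proof.
refine (@ChainMap A csum Z (fun n => copair (u n) (v n)) _) => i j.
by rewrite /= /csum_dif copair_pair !compA !cmE -!compA -compDr.
Defined.

Lemma csum_fst_tfib :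
  (forall n T (z : hom T (Y n)), cyc z -> exists i (y : hom T (Y i)), z = dif Y i n ∘ y) ->
  tfib csum_fst.
Proof.
move=> Yac; split=> [n|n T z zc z1].
  by apply: (@epi_factor _ _ _ _ _ (in1 _ _)); rewrite pr1in1; exact: epi1.
have zc2 : cyc (pr2 _ _ ∘ z : hom T (Y n)).
  by move: zc => /(congr1 (comp (pr2 _ _))); rewrite compm0 compA pair2 -compA.
have [i [y yE]] := Yac _ _ _ zc2.
exists T, (idm T), i, (in2 _ _ ∘ y); split; first exact: epi1.
  apply: pair_eq; rewrite compm1 !compA ?pair1 ?pair2.
    rewrite [LHS]z1 -[_ ∘ pr1 _ _ ∘ _]compA pr1in2 compm0 comp0m //.
  by rewrite -[_ ∘ pr2 _ _ ∘ _]compA pr2in2 compm1.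
by rewrite /= compA pr1in2 comp0m.
Qed.

End Sum.

Section KernelComplex.
Variables (X Y : complex A) (u : chain_map X Y).

Lemma kcx_subproof i j : u j ∘ (dif X i j ∘ kerm (u i)) = 0.
Proof. by rewrite compA cmE -compA kerm0 compm0. Qed.

Definition kcx_dif i j : hom (ker (u i)) (ker (u j)) := klift (kcx_subproof i j).

Lemma kcx_difE i j : kerm (u j) ∘ kcx_dif i j = dif X i j ∘ kerm (u i).
Proof. exact: kliftK. Qed.

Lemma kcx_shape i j : j != 1 + i -> kcx_dif i j = 0.
Proof.
move=> h; apply: (@mono_kerm _ _ _ (u j)).
by rewrite kcx_difE dif_shape // comp0m compm0.
Qed.

Lemma kcx_dif_dif i j k : kcx_dif j k ∘ kcx_dif i j = 0.
Proof.
apply: (@mono_kerm _ _ _ (u k)).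
by rewrite compA kcx_difE -compA kcx_difE compA dif_dif comp0m compm0.
Qed.

Definition kcx : complex A :=
  @Complex A (fun n => ker (u n)) kcx_dif kcx_shape kcx_dif_dif.

Definition kcx_in : chain_map kcx X :=
  @ChainMap A kcx X (fun n => kerm (u n)) kcx_difE.

Lemma kcx_bounded : bounded X -> bounded kcx.
Proof.
move=> [m h]; exists m => n /h; apply: is_zero_mono; exact: (@mono_kerm _ _ _ (u n)).
Qed.

End KernelComplex.

Section MappingCone.
Variables (K P : complex A) (k : chain_map K P).

Definition mcone_dif (i j : int) :
    hom (bisum (K (1 + i)) (P i)) (bisum (K (1 + j)) (P j)) :=
  pair ((- dif K (1 + i) (1 + j) : hom (K (1 + i)) (K (1 + j))) ∘ pr1 _ _)
    (copair (eqmap P (1 + i) j ∘ k (1 + i)) (dif P i j)).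

Lemma mcone_shape i j : j != 1 + i -> mcone_dif i j = 0.
Proof.
move=> h; rewrite /mcone_dif !dif_shape ?eqz_add1 // eqmap0r //.
by rewrite oppr0 /copair /pair !comp0m addr0 !compm0 addr0.
Qed.

Lemma mcone_dif_dif i j l : mcone_dif j l ∘ mcone_dif i j = 0.
Proof.
apply: pair_eq; rewrite compm0 !compA ?pair1 ?pair2.
  by rewrite -compA pair1 !compA compNm compmN dif_dif !oppr0 comp0m.
rewrite copair_pair; apply: copair_eq.
  rewrite compDl comp0m -!compA pr1in1 compm1 copair1 compmN compA.
  have [-> | h] := eqVneq l (1 + j); last first.
    by rewrite [dif P j l]dif_shape // eqmap0r // !comp0m addr0.
  rewrite eqmap_id comp1m cmE.
  have [-> | h] := eqVneq j (1 + i); first by rewrite eqmap_id compm1 addNr.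
  rewrite [dif P _ _]dif_shape ?eqz_add1 // eqmap0r //.
  by rewrite comp0m compm0 comp0m oppr0 addr0.
rewrite compDl comp0m -!compA pr1in2 !compm0 add0r copair2.
exact: dif_dif.
Qed.

Definition mcone : complex A :=
  @Complex A (fun n => bisum (K (1 + n)) (P n)) mcone_dif mcone_shape mcone_dif_dif.

Lemma mcone_bounded : bounded K -> bounded P -> bounded mcone.
Proof.
move=> [a Ka] [b Pb]; exists (Num.min (a - 1) b) => n; rewrite lt_min => /andP[na nb].
by apply: is_zero_bisum; [apply: Ka; rewrite addrC -ltrBrDr | exact: Pb].
Qed.

Variables (X : complex A) (p : chain_map P X).
Hypothesis kp : forall n, short_exact (k n) (p n).

Definition mcone_map : chain_map mcone X.
Proof.
refine (@ChainMap A mcone X (fun n => p n ∘ pr2 _ _) _) => i j.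
rewrite /= -compA pair2; apply: copair_eq; rewrite -!compA ?copair1 ?copair2.
  rewrite pr2in1 !compm0; have [-> | h] := eqVneq j (1 + i).
    by rewrite eqmap_id comp1m (kp _).1.1.
  by rewrite eqmap0r // comp0m compm0.
by rewrite pr2in2 compm1 cmE.
Defined.

(** An element of the kernel has the form (a, k b). If it is a cocycle, injectivity of [k] gives a =
    - d b, so it is the differential of (b, 0). *)
Lemma mcone_map_tfib : tfib mcone_map.
Proof.
split=> [n|n].
  apply: epiM; first exact: short_exact_epi (kp n).
  by apply: (@epi_factor _ _ _ _ _ (in2 _ _)); rewrite pr2in2; exact: epi1.
have [i ->] := int_succ n => {n} T z zc; rewrite /= -compA => pz.
have [b bE] := kernel_lift (kp _).1 pz.
move: zc; rewrite /cyc /= /mcone_dif => /(congr1 (comp (pr2 _ _))).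
rewrite compA pair2 compm0 [X in _ ∘ X](pair_eta z) copair_pair eqmap_id comp1m -bE.
rewrite [dif P _ _ ∘ _]compA -cmE -[k _ ∘ dif _ _ _
  ∘ b]compA -compDr => /(mono0 (short_exact_mono (kp _))) aE.
exists T, (idm T), i, (in1 _ _ ∘ b); split; first exact: epi1.
  rewrite compm1 /= /mcone_dif; apply: pair_eq; rewrite !compA ?pair1 ?pair2.
    rewrite -[_ ∘ pr1 _ _ ∘ _]compA pr1in1 compm1 compNm.
    by apply/eqP; rewrite -addr_eq0; apply/eqP.
  by rewrite copair1 eqmap_id comp1m -bE.
by rewrite /= compA -[p i ∘ _ ∘ _]compA pr2in1 compm0 comp0m.
Qed.

End MappingCone.
End Constructions.

(** * Flat resolutions of complexes *)

Section FlatResolutions.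
Variable A : tensor_abelian.

Section Existence.
Hypothesis enough_flat : forall X : A, exists P (p : hom P X), flat P /\ epi p.

Lemma fdim_bisum d (X P : A) : fdim d X -> flat P -> fdim d (bisum X P).
Proof.
move=> dX fP; apply: (@fdim_ext _ enough_flat d X _ P (in1 _ _) (pr2 _ _)) => //.
exact: bisum_short_exact.
Qed.

(** Since [u] is an epimorphism, the kernel of [copair u v] is an extension of [Q] by [ker u]. *)
Lemma fdim_ker_copair d (X P Q : A) (u : hom P X) (v : hom Q X) :
  epi u -> fdim d (ker u) -> flat Q -> fdim d (ker (copair u v)).
Proof.
move=> eu du fQ; set phi := copair u v.
have [l lE] : exists l, kerm phi ∘ l = in1 P Q ∘ kerm u.
  by apply: kernel_lift (kermP _) _; rewrite compA copair1 kerm0.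
apply: (@fdim_ext _ enough_flat d _ _ Q l (pr2 _ _ ∘ kerm phi)) => //.
apply: short_exactP.
- apply: (@mono_factor _ _ _ _ (pr1 _ _ ∘ kerm phi)).
  by rewrite -compA lE compA pr1in1 comp1m; exact: mono_kerm.
- have [T [e [y [ee yE]]]] := epi_pullback v eu.
  have [t tE] : exists t, kerm phi ∘ t = pair (- y : hom T P) e.
    by apply: kernel_lift (kermP _) _; rewrite copair_pair compmN yE addNr.
  by apply: (@epi_factor _ _ _ _ _ t); rewrite -compA tE pair2.
- by rewrite -compA lE compA pr2in1 comp0m.
- move=> T t t0; have : phi ∘ (kerm phi ∘ t) = 0 by rewrite compA kerm0 comp0m.
  rewrite (pair_eta (kerm phi ∘ t)) copair_pair [pr2 _ _ ∘ (_ ∘ _)]compA t0.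
  rewrite compm0 addr0 => /(kernel_lift (kermP _))[s sE].
  exists T, (idm T), s; split; first exact: epi1.
  apply: (@mono_kerm _ _ _ phi); rewrite compA lE compm1.
  apply: pair_eq; first by rewrite !compA pr1in1 comp1m sE compA.
  by rewrite !compA pr2in1 !comp0m t0.
Qed.

(** Flat covers [eps] of the single terms need not commute with the differentials, so [X] is covered
    by the contractible complex [cov] built on them. The mapping cone of the kernel of this cover is
    a resolution of [X] whose terms have a flat dimension smaller by one; after [d] such steps all
    terms are flat. *)
Lemma flat_resolution d (X : complex A) : bounded X -> (forall n, fdim d (X n)) ->
  exists (P : complex A) (w : chain_map P X),
    [/\ bounded P, forall n, flat (P n) & tfib w].
Proof.
elim: d X => [|d IH] X bX dX.
  by exists X, (idm (X : complexes A)); split=> //; exact: tfib1.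
have [m Xm] := bX.
have exF : forall n, exists Fp : {F : A & hom F (X n)},
    [/\ flat (projT1 Fp), epi (projT2 Fp), fdim d (ker (projT2 Fp))
      & is_zero (X n) -> is_zero (projT1 Fp)].
  (* Zero terms are covered by [zero_ob], which keeps the cover bounded from below. *)
  move=> n; have [z|nz] := pselect (is_zero (X n)).
    have z0 := zero_obP A.
    exists (existT _ zero_ob (0 : hom zero_ob (X n))); split=> //=; first exact: flat_zero.
      by move=> T a b _; apply: zero_obE.
    apply: fdim_zero; apply: is_zero_mono z0; exact: mono_kerm.
  have [K [P [i [p [ip fP fK]]]]] := dX n.
  exists (existT _ P p); split=> //=; first exact: short_exact_epi ip.
  have [k kE] := kernel_lift (kermP p) ip.1.1.
  apply: fdim_iso fK; apply: (@mono_epi_iso _ _ _ k).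
    by apply: (@mono_factor _ _ _ _ (kerm p)); rewrite kE; exact: short_exact_mono ip.
  have [s sE] := kernel_lift ip.1 (kerm0 p).
  apply: (@epi_factor _ _ _ _ _ s); suff -> : k ∘ s = idm _ by exact: epi1.
  by apply: (@mono_kerm _ _ _ p); rewrite compA kE compm1.
pose F n := projT1 (cid (exF n)); have FP n := projT2 (cid (exF n)).
rewrite -/(F _) in FP.
pose F0 n := projT1 (F n); pose eps n : hom (F0 n) (X n) := projT2 (F n).
pose p := cov_map eps; have bF : bounded (cov F0).
  by apply: cov_bounded; exists m => n /Xm; case: (FP n).
have kp n : short_exact (kcx_in p n) (p n).
  by apply: short_exact_kerm; apply: cov_map_epi => k; case: (FP k).
have [|n|P [w [bP fP tw]]] := IH (mcone (kcx_in p)).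
- by apply: mcone_bounded => //; exact: kcx_bounded.
- apply: fdim_bisum; last first.
    apply: (@flat_ext _ enough_flat _ _ _ (in1 _ _) (pr2 _ _)); last 2 first.
    + by case: (FP n).
    + by case: (FP (n - 1)).
    exact: bisum_short_exact.
  by apply: fdim_ker_copair; case: (FP (1 + n)) => // *; case: (FP (1 + n - 1)).
exists P, ((mcone_map kp : @hom (complexes A) _ _) ∘ w); split=> //.
by apply: tfibM => //; exact: mcone_map_tfib.
Qed.

End Existence.

Section Cokernels.
Variable P : complex A.

Definition cok n : A := coker (dif P (n - 1) n).

Lemma cokm_dif i n : cokm (dif P (n - 1) n) ∘ dif P i n = 0.
Proof.
have [e|h] := eqVneq n (1 + i); last by rewrite [dif P i n]dif_shape ?compm0.
have {e} -> : i = n - 1 by rewrite e addrAC subrr add0r.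
exact: cokm0.
Qed.

Lemma cok_exact n T (t : hom T (P n)) : cokm (dif P (n - 1) n) ∘ t = 0 -> bdy t.
Proof.
move=> /(cokernel_exact (cokmP _))[T' [e [s [ee sE]]]].
by exists T', e, (n - 1), s.
Qed.

Lemma bdy_cok n T (t : hom T (P n)) : bdy t -> cokm (dif P (n - 1) n) ∘ t = 0.
Proof.
move=> [T' [e [i [y [ee yE]]]]]; apply: ee.
by rewrite -compA yE compA cokm_dif !comp0m.
Qed.

Definition cok_dif n : hom (cok n) (P (1 + n)) := cdesc (dif_dif P (n - 1) n (1 + n)).

Lemma cok_difK n : cok_dif n ∘ cokm (dif P (n - 1) n) = dif P n (1 + n).
Proof. exact: cdescK. Qed.

Lemma cok_dif_exact n T (t : hom T (P (1 + n))) :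
  cokm (dif P (1 + n - 1) (1 + n)) ∘ t = 0 ->
  exists (T' : A) (e : hom T' T) (s : hom T' (cok n)),
    epi e /\ cok_dif n ∘ s = t ∘ e.
Proof.
move=> /(cokernel_exact (cokmP _))[T' [e [s [ee sE]]]].
exists T', e; move: s sE; rewrite (_ : 1 + n - 1 = n); last by rewrite addrAC subrr add0r.
move=> s sE; exists (cokm (dif P (n - 1) n) ∘ s); split=> //.
by rewrite compA cok_difK.
Qed.

Lemma cok_short_exact n : is_zero (coh n P) ->
  short_exact (cok_dif n) (cokm (dif P (1 + n - 1) (1 + n))).
Proof.
move=> z; apply: short_exactP; [|exact: epi_cokm| |exact: cok_dif_exact].
  apply: mono0P => T t t0.
  have [T' [e [s [ee sE]]]] := epi_pullback t (@epi_cokm _ _ _ (dif P (n - 1) n)).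
  apply: ee; rewrite comp0m -sE; apply: bdy_cok; apply: is_zero_coh => //.
  by rewrite /cyc -cok_difK -compA sE compA t0 comp0m.
apply: (@epi_cokm _ _ _ (dif P (n - 1) n)).
by rewrite comp0m -compA cok_difK; exact: cokm_dif.
Qed.

Hypothesis enough_flat : forall X : A, exists P (p : hom P X), flat P /\ epi p.

(* 0 -> H^n -> coker d^(n-1) -> B^(n+1) -> 0 and 0 -> B^(n+1) -> P^(n+1) -> coker d^n -> 0 *)
Lemma cok_flat n :
  flat (P (1 + n)) -> flat (cok (1 + n)) -> flat (coh n P) -> flat (cok n).
Proof.
move=> fP fC fH; set q := cokm (dif P (1 + n - 1) (1 + n)).
have sB := short_exact_kerm (@epi_cokm _ _ _ (dif P (1 + n - 1) (1 + n))).
have fB := flat_ker enough_flat sB fP fC.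
have [b bE] : exists b, kerm q ∘ b = cok_dif n.
  apply: kernel_lift (kermP _) _; apply: (@epi_cokm _ _ _ (dif P (n - 1) n)).
  by rewrite comp0m -compA cok_difK; exact: cokm_dif.
have [i iE] : exists i : hom (coh n P) (cok n),
    i ∘ cls n P = cokm (dif P (n - 1) n) ∘ cocycm n P.
  apply: cokernel_desc (cokmP _) _.
  by rewrite -compA cocycm_cobound cokm0.
apply: (flat_ext enough_flat _ fH fB (i := i) (p := b)); apply: short_exactP.
- apply: mono0P => T t t0; have [T' [e [z [zc [ee zE]]]]] := coh_elt t.
  apply: ee; rewrite comp0m zE; apply/cls_bdy; apply: cok_exact.
  by rewrite -(cocyc_liftK zc) compA -iE -compA -zE compA t0 comp0m.
- have [T [e [s [ee sE]]]] := cok_dif_exact (kerm0 q).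
  apply: (@epi_factor _ _ _ _ _ s); suff -> : b ∘ s = e by [].
  by apply: (@mono_kerm _ _ _ q); rewrite compA bE sE.
- apply: (@mono_kerm _ _ _ q); rewrite compA bE compm0.
  apply: cls_epi; rewrite comp0m -compA iE compA cok_difK; exact: dif_cocyc.
- move=> T t t0.
  have [T' [e [s [ee sE]]]] := epi_pullback t (@epi_cokm _ _ _ (dif P (n - 1) n)).
  have sc : cyc s.
    by rewrite /cyc -cok_difK -compA sE compA -bE -[kerm q ∘ b ∘ t]compA t0 compm0 comp0m.
  exists T', e, (cls n P ∘ cocyc_lift sc); split=> //.
  by rewrite compA iE -compA cocyc_liftK.
Qed.

(** Above degree [r] the complex is exact, so [cok n] is a [d]-th syzygy of [cok (n + d)] and hence
    flat. From there [cok_flat] descends one degree at a time. *)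
Lemma flat_cok d (r : int) :
  (forall X : A, fdim d X) -> (forall n, flat (P n)) ->
  (forall n, flat (coh n P)) -> (forall n, r < n -> is_zero (coh n P)) ->
  forall n, flat (cok n).
Proof.
move=> dA fP fH zH.
have high n : r < n -> flat (cok n).
  have : forall n, r < n -> fdim d (cok n) by move=> *; exact: dA.
  elim: d {dA} n => [|d IH] n dC rn; first exact: dC.
  apply: IH => // k rk; apply: fdim_syzygy (cok_short_exact (zH _ rk)) _ _ => //.
  by apply: dC; apply: lt_trans rk _; rewrite ltrDr.
have low (k : nat) : forall n, r < n + k%:Z -> flat (cok n).
  elim: k => [|k IH] n; first by rewrite addr0; exact: high.
  move=> rn; apply: cok_flat => //; apply: IH.
  by rewrite [1 + n]addrC -addrA -intS.
move=> n; have [rn|nr] := ltP r n; first exact: high.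
apply: (low `|(1 + (r - n))%R|%N); rewrite gez0_abs; last by rewrite addr_ge0 // subr_ge0.
by rewrite addrCA [n + _]addrC subrK ltrDr.
Qed.

End Cokernels.

(** In a flat resolution [P] in degrees -d, ..., 0, the object [cok P (k - d)] has flat dimension at
    most [k]: for [k = 0] it is isomorphic to [P (- d)], and exactness in negative degrees yields
    the induction step. For [k = d] it is isomorphic to [X]. *)
Lemma finite_tor_dim_fdim : finite_tor_dim A -> exists d, forall X : A, fdim d X.
Proof.
move=> [d res]; exists d => X; have [P [q [qq fP zP]]] := res X.
have zH n : n != 0 -> is_zero (coh n P).
  move=> n0; have [v [vu _]] := qq n.
  rewrite /is_zero -vu; have z : is_zero (coh n (single_cx X)).
    by apply: coh_zero; exact: single_zero.
  by rewrite [fmap _ _](zero_out _ z) compm0.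
have step (k : nat) : (k <= d)%N -> fdim k (cok P (k%:Z - d%:Z)).
  elim: k => [|k IH] kd.
    apply: (flat_iso (u := cokm (dif P (0 - d%:Z - 1) (0 - d%:Z)))); last exact: fP.
    apply: mono_epi_iso; last exact: epi_cokm.
    apply: mono0P => T t /cok_exact[T' [e [i [y [ee yE]]]]].
    apply: ee; rewrite yE comp0m; have [iE|h] := eqVneq (0 - d%:Z) (1 + i).
      rewrite (zero_out y) ?compm0 //; apply: zP; rewrite negb_and -ltNge.
      by rewrite -[- d%:Z]add0r iE ltrDr.
    by rewrite dif_shape ?comp0m.
  have -> : k.+1%:Z - d%:Z = 1 + (k%:Z - d%:Z) by rewrite intS addrA.
  exists (cok P (k%:Z - d%:Z)), (P (1 + (k%:Z - d%:Z))), (cok_dif P _), (cokm _); split=> //.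
    apply: cok_short_exact; apply: zH; apply: ltr0_neq0.
    by rewrite subr_lt0 ltz_nat.
  by apply: IH; exact: ltnW.
have := step d (leqnn d); rewrite subrr.
have q0 : q 0 ∘ dif P (0 - 1) 0 = 0 by rewrite cmE comp0m.
apply: (@fdim_iso _ _ _ _ (cdesc q0)); apply: mono_epi_iso.
  apply: mono0P => T t t0.
  have [T' [e [s [ee sE]]]] := epi_pullback t (@epi_cokm _ _ _ (dif P (0 - 1) 0)).
  apply: ee; rewrite comp0m -sE; apply: bdy_cok; apply: (qis_inj qq).
    by apply: zero_out; apply: zP; rewrite negb_and; apply/orP; right.
  rewrite -(cdescK q0) -compA sE compA t0 comp0m -(compm0 _ (dif (single_cx X) 0 0)).
  exact: bdy_dif.
have zc : cyc (idm X : hom X (single_cx X 0)) by exact: comp0m.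
have [T [e [x [ee xc [T' [e' [i [y [ee' yE]]]]]]]]] := qis_surj qq zc.
have : epi (e ∘ e') by exact: epiM.
move: yE; rewrite [RHS](_ : _ = 0); last exact: comp0m.
rewrite comp1m compDl compNm => /eqP; rewrite subr_eq0 => /eqP ->.
move=> ex; have : epi (cdesc q0 ∘ (cokm (dif P (0 - 1) 0) ∘ x ∘ e')).
  by rewrite !compA cdescK.
exact: epi_factor.
Qed.

Lemma fdim_enough_flat d : (forall X : A, fdim d X) ->
  forall X : A, exists P (p : hom P X), flat P /\ epi p.
Proof.
case: d => [|d] dA X; first by exists X, (idm X); split; [exact: dA | exact: epi1].
have [K [P [i [p [ip fP _]]]]] := dA X.
by exists P, p; split=> //; exact: short_exact_epi ip.
Qed.

End FlatResolutions.

(** * Truncation from below *)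

Section Truncation.
Variable A : abelian.
Variable m : int.

Section Objects.
Variable X : complex A.

(* The subobject which is divided out in degree [n]: everything below [m], the
   coboundaries in degree [m], and 0 above. *)
Definition tge_rel n : hom (bisum (X n) (X (n - 1))) (X n) :=
  if n < m then copair (idm _) 0
  else if n == m then copair 0 (dif X (n - 1) n) else 0.

Lemma tge_low n : n < m -> is_zero (coker (tge_rel n)).
Proof.
move=> nm; apply: epi_cokm; rewrite comp0m -[LHS]compm1 -(copair1 (idm (X n)) (0
  : hom (X (n - 1)) (X n))).
rewrite compA (_ : copair _ _ = tge_rel n); last by rewrite /tge_rel nm.
by rewrite -[_ ∘ tge_rel n]compA cokm0 compm0 comp0m.
Qed.

Lemma tge_high n : m < n -> tge_rel n = 0.
Proof. by move=> mn; rewrite /tge_rel ltNge (ltW mn) /= gt_eqF. Qed.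

Lemma tge_dif_subproof i j : cokm (tge_rel j) ∘ dif X i j ∘ tge_rel i = 0.
Proof.
have [jm|mj] := ltP j m; first exact: zero_out (tge_low jm).
have [h|h] := eqVneq j (1 + i); last by rewrite dif_shape // compm0 comp0m.
rewrite [X in _ ∘ X]/tge_rel; case: ifP => im.
  have jE : j = m.
    by apply/eqP; rewrite eq_le mj andbT h addrC lezD1.
  have e : cokm (tge_rel j) ∘ dif X (j - 1) j = 0.
    rewrite -(copair2 (0 : hom (X j) (X j)) (dif X (j - 1) j)) compA (_ : copair _ _ = tge_rel j).
      by rewrite cokm0 comp0m.
    by rewrite /tge_rel jE ltxx eqxx.
  have {}e : cokm (tge_rel j) ∘ dif X i j = 0.
    by rewrite (_ : i = j - 1) // h addrAC subrr add0r.
  by rewrite e comp0m.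
case: ifP => _; last by rewrite compm0.
rewrite -compA (_ : dif X i j ∘ copair _ _ = 0) ?compm0 //.
by apply: copair_eq; rewrite -compA comp0m ?copair1 ?copair2 ?compm0 ?dif_dif.
Qed.

Definition tge_dif i j : hom (coker (tge_rel i)) (coker (tge_rel j)) :=
  cdesc (tge_dif_subproof i j).

Lemma tge_difE i j : tge_dif i j ∘ cokm (tge_rel i) = cokm (tge_rel j) ∘ dif X i j.
Proof. exact: cdescK. Qed.

Lemma tge_shape i j : j != 1 + i -> tge_dif i j = 0.
Proof. by move=> h; apply: epi_cokm; rewrite tge_difE comp0m dif_shape // compm0. Qed.

Lemma tge_dif_dif i j k : tge_dif j k ∘ tge_dif i j = 0.
Proof.
by apply: epi_cokm; rewrite -compA tge_difE compA tge_difE -compA dif_dif comp0m compm0.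
Qed.

Definition tge_ob : complex A :=
  @Complex A (fun n => coker (tge_rel n)) tge_dif tge_shape tge_dif_dif.

Lemma tge_bounded : bounded tge_ob.
Proof. by exists m; exact: tge_low. Qed.

Definition to_tge : chain_map X tge_ob.
Proof.
by refine (@ChainMap A X tge_ob (fun n => cokm (tge_rel n)) _) => i j; rewrite tge_difE.
Defined.

Lemma tge_cyc n T (z : hom T (tge_ob n)) : m <= n -> cyc z ->
  exists (T' : A) (e : hom T' T) (x : hom T' (X n)),
    [/\ epi e, cyc x & to_tge n ∘ x = z ∘ e].
Proof.
move=> mn zc; have [T' [e [x [ee xE]]]] := epi_pullback z (@epi_cokm _ _ _ (tge_rel n)).
exists T', e, x; split=> //.
have : cokm (tge_rel (1 + n)) ∘ (dif X n (1 + n) ∘ x) = 0.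
  by rewrite compA -tge_difE -compA xE compA (zc : tge_dif _ _ ∘ _ = 0) comp0m.
have mn1 : m < 1 + n by rewrite addrC ltzD1.
move=> /(cokernel_exact (cokmP _))[T'' [e' [s [ee' sE]]]].
by apply: ee'; rewrite -sE tge_high // !comp0m.
Qed.

Lemma tge_bdy n T (x : hom T (X n)) : m <= n -> bdy (to_tge n ∘ x) -> bdy x.
Proof.
move=> mn [T1 [e1 [i [y [ee1 yE]]]]].
have [T2 [e2 [w [ee2 wE]]]] := epi_pullback y (@epi_cokm _ _ _ (tge_rel i)).
have : cokm (tge_rel n) ∘ (x ∘ e1 ∘ e2 - dif X i n ∘ w : hom T2 (X n)) = 0.
  rewrite compDr compmN !compA -[_ ∘ x ∘ e1]/(to_tge n ∘ x ∘ e1) yE -tge_difE.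
  by rewrite -!compA wE subrr.
move=> /(cokernel_exact (cokmP _))[T3 [e3 [s [ee3 sE]]]].
apply: (bdy_cover (epiM ee1 ee2)); rewrite compA.
apply: bdy_sub (bdy_dif n w); apply: (bdy_cover ee3).
rewrite -sE /tge_rel ltNge mn /=; case: ifP => _; last by rewrite comp0m; exact: bdy0.
by rewrite /copair comp0m add0r -compA; exact: bdy_dif.
Qed.

Lemma to_tge_qis : (forall n, n < m -> is_zero (coh n X)) -> @qis A X tge_ob to_tge.
Proof.
move=> zX; apply: qisP => n T z zc; have [nm|mn] := ltP n m.
- by move=> _; apply: is_zero_coh zc; exact: zX.
- exact: tge_bdy.
- exists T, (idm T), 0; split; [exact: epi1 | exact: compm0 |].
  by rewrite [_ - _](zero_out _ (tge_low nm)); exact: bdy0.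
- have [T' [e [x [ee xc xE]]]] := tge_cyc mn zc.
  by exists T', e, x; split=> //; rewrite xE subrr; exact: bdy0.
Qed.

End Objects.

Section Morphisms.
Variables (X Y : complex A) (u : chain_map X Y).

Lemma tge_map_subproof n : cokm (tge_rel Y n) ∘ u n ∘ tge_rel X n = 0.
Proof.
have -> : cokm (tge_rel Y n) ∘ u n ∘ tge_rel X n =
    cokm (tge_rel Y n) ∘ tge_rel Y n ∘ pair (u n ∘ pr1 _ _) (u (n - 1) ∘ pr2 _ _).
  rewrite -!compA; congr (_ ∘ _); rewrite /tge_rel.
  case: ifP => _; [|case: ifP => _]; rewrite ?copair_pair ?comp0m ?compm0 ?add0r ?addr0 //.
    by rewrite /copair comp0m addr0 !comp1m.
  by rewrite /copair comp0m add0r !compA cmE.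
by rewrite cokm0 comp0m.
Qed.

Definition tge_map : chain_map (tge_ob X) (tge_ob Y).
Proof.
refine (@ChainMap A (tge_ob X) (tge_ob Y) (fun n => cdesc (tge_map_subproof n)) _) => i j.
apply: epi_cokm; rewrite -!compA [in LHS]tge_difE cdescK !compA cdescK.
by rewrite [in RHS]tge_difE -!compA cmE.
Defined.

Lemma tge_mapE n : tge_map n ∘ to_tge X n = to_tge Y n ∘ u n.
Proof. exact: cdescK. Qed.

End Morphisms.

Definition tge : functor (complexes A) (complexes A).
Proof.
refine (@Functor (complexes A) (complexes A) tge_ob tge_map _ _).
- move=> X; apply: chain_mapP => n; apply: (@epi_cokm _ _ _ (tge_rel X n)).
  by rewrite [LHS]tge_mapE; rewrite /= compm1 comp1m.
- move=> X Y Z v u; apply: chain_mapP => n; apply: (@epi_cokm _ _ _ (tge_rel X n)).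
  rewrite [LHS]tge_mapE; apply: etrans (_ : tge_map v n ∘ (tge_map u n ∘ to_tge X n) = _).
    by rewrite tge_mapE compA tge_mapE -compA.
  by rewrite compA.
Defined.

Lemma tge_qis (X Y : complexes A) (u : hom X Y) : qis u -> qis (fmap tge u).
Proof.
move=> qu; apply: qisP => n T z zc; have [nm|mn] := ltP n m.
- by move=> _; apply: is_zero_coh zc; apply: coh_zero; exact: tge_low.
- have [T' [e [x [ee xc xE]]]] := tge_cyc mn zc.
  move=> b; apply: (bdy_cover ee); rewrite -xE; apply: bdy_map.
  apply: (qis_inj qu xc); apply: (tge_bdy mn).
  by rewrite compA -tge_mapE -compA xE compA; exact: bdy_comp.
- exists T, (idm T), 0; split; [exact: epi1 | exact: compm0 |].
  by rewrite [_ - _](zero_out _ (tge_low Y nm)); exact: bdy0.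
- have [T1 [e1 [x [ee1 xc xE]]]] := tge_cyc mn zc.
  have [T2 [e2 [w [ee2 wc b]]]] := qis_surj qu xc.
  exists T2, (e1 ∘ e2), (to_tge X n ∘ w); split; [exact: epiM | exact: cyc_map |].
  rewrite compA -xE compA -[fmap tge u n]/(tge_map u n) tge_mapE -!compA -compmN -compDr.
  exact: bdy_map.
Qed.

End Truncation.

(** * Natural transformations out of localizations *)

Section Generation.
Variables (C D : category) (Q : functor C D).

(** An induction principle for the morphisms of a localization. It admits inverses of all
    isomorphisms in [S], so that the zigzags themselves need not be mentioned. *)
Definition closed_class (S : forall X Y : C, hom (Q X) (Q Y) -> Prop) :=
  [/\ forall (X Y : C) (u : hom X Y), S X Y (fmap Q u),
      forall (X Y Z : C) (v : hom (Q Y) (Q Z)) (u : hom (Q X) (Q Y)),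
        S Y Z v -> S X Y u -> S X Z (v ∘ u)
    & forall (X Y : C) (w : hom (Q X) (Q Y)) (v : hom (Q Y) (Q X)),
        v ∘ w = idm (Q X) -> w ∘ v = idm (Q Y) -> S X Y w -> S Y X v].

(** A property of localization functors that suffices to extend natural
    transformations along [Q]. *)

Definition loc_like :=
  (forall Y : D, exists (X : C) (i : hom Y (Q X)), is_iso i) /\
  forall S, closed_class S -> forall (X Y : C) (w : hom (Q X) (Q Y)), S X Y w.

(** The morphisms that commute with [a] form a closed class, so [a] is natural for all morphisms
    between objects [Q X]. Chosen isomorphisms [Y -> Q X] then define [b] on the remaining
    objects. *)
Lemma nat_trans_extend (E : category) (G H : functor D E)
    (a : forall X : C, hom (G (Q X)) (H (Q X))) :
  (forall (X Y : C) (u : hom X Y), a Y ∘ fmap G (fmap Q u) = fmap H (fmap Q u) ∘ a X) ->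
  loc_like -> exists b : nat_trans G H, forall X : C, b (Q X) = a X.
Proof.
move=> aN0 [ess gen].
have aN (X Y : C) (w : hom (Q X) (Q Y)) : a Y ∘ fmap G w = fmap H w ∘ a X.
  apply: (gen (fun X Y w => a Y ∘ fmap G w = fmap H w ∘ a X)); split=> //.
  - by move=> X0 Y0 Z v u hv hu; rewrite !fmapM compA hv -compA hu compA.
  - move=> X0 Y0 w0 v vw wv h.
    rewrite -[a X0]comp1m -[idm _]fmap1 -vw fmapM -[_ ∘ a X0]compA -h.
    by rewrite -!compA -fmapM wv fmap1 compm1.
pose X_ Y := projT1 (cid (ess Y)); pose i_ Y := projT1 (cid (projT2 (cid (ess Y)))).
have ii Y : is_iso (i_ Y) := projT2 (cid (projT2 (cid (ess Y)))).
pose b Y : hom (G Y) (H Y) := fmap H (inv_iso (ii Y)) ∘ a (X_ Y) ∘ fmap G (i_ Y).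
have bE (X : C) (Y : D) (j : hom Y (Q X)) : fmap H j ∘ b Y = a X ∘ fmap G j.
  rewrite /b !compA -fmapM -aN -compA -fmapM; congr (_ ∘ fmap _ _).
  by rewrite -compA inv_isoK compm1.
have bN (Y Y' : D) (w : hom Y Y') : b Y' ∘ fmap G w = fmap H w ∘ b Y.
  apply: (is_iso_mono (is_iso_fmap H (ii Y'))).
  by rewrite compA bE -compA -fmapM -bE fmapM compA.
exists (NatTrans bN) => X /=.
by have := bE X (Q X) (idm _); rewrite !fmap1 comp1m compm1.
Qed.

End Generation.

Section ProductMorphisms.
Variables C D : category.

Definition hpair (X Y : C) (X' Y' : D) (u : hom X Y) (v : hom X' Y') :
  @hom (C × D) (X, X') (Y, Y') := (u, v).

Lemma hpairM (X Y Z : C) (X' Y' Z' : D) (v : hom Y Z) (v' : hom Y' Z')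
    (u : hom X Y) (u' : hom X' Y') : hpair v v' ∘ hpair u u' = hpair (v ∘ u) (v' ∘ u').
Proof. by []. Qed.

Lemma hpair1 (X : C) (X' : D) : hpair (idm X) (idm X') = idm ((X, X') : C × D).
Proof. by []. Qed.

Lemma is_iso_hpair (X Y : C) (X' Y' : D) (u : hom X Y) (v : hom X' Y') :
  is_iso u -> is_iso v -> is_iso (hpair u v).
Proof.
move=> [u' [u'u uu']] [v' [v'v vv']]; exists (hpair u' v').
by rewrite !hpairM u'u uu' v'v vv' !hpair1.
Qed.

End ProductMorphisms.

(** Every morphism is a composite of two, each of which is the identity in one variable, so the
    generation property is applied to one variable at a time. *)
Lemma loc_like_prod (C D C' D' : category) (Q : functor C D) (Q' : functor C' D') :
  loc_like Q -> loc_like Q' -> loc_like (prod_functor Q Q').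
Proof.
move=> [ess gen] [ess' gen']; split.
  move=> [Y Y']; have [X [i ii]] := ess Y; have [X' [i' ii']] := ess' Y'.
  by exists (X, X'), (hpair i i'); exact: is_iso_hpair.
move=> S [S1 SM SV] [X X'] [Y Y'] [u u'].
have -> : (u, u') = hpair u (idm (Q' Y')) ∘ hpair (idm (Q X)) u'.
  by rewrite hpairM compm1 comp1m.
apply: (SM (X, X') (X, Y') (Y, Y')).
  apply: (gen (fun X Y u => S (X, Y') (Y, Y') (hpair u (idm (Q' Y'))))); split.
  - move=> X0 Y0 u0; have := S1 (X0, Y') (Y0, Y') (hpair u0 (idm Y')).
    by rewrite /= fmap1.
  - move=> X0 Y0 Z0 v0 u0 hv hu; have := SM _ _ _ _ _ hv hu.
    by rewrite hpairM comp1m.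
  - move=> X0 Y0 w0 v0 vw wv; apply: SV.
      by rewrite hpairM vw comp1m.
    by rewrite hpairM wv comp1m.
apply: (gen' (fun X' Y' u' => S (X, X') (X, Y') (hpair (idm (Q X)) u'))); split.
- move=> X0 Y0 u0; have := S1 (X, X0) (X, Y0) (hpair (idm X) u0).
  by rewrite /= fmap1.
- move=> X0 Y0 Z0 v0 u0 hv hu; have := SM _ _ _ _ _ hv hu.
  by rewrite hpairM comp1m.
- move=> X0 Y0 w0 v0 vw wv; apply: SV.
    by rewrite hpairM vw comp1m.
  by rewrite hpairM wv comp1m.
Qed.

(** * Generation of D^+ by bounded complexes *)

Section Derived.
Variable A : abelian.

Lemma loc_piE (X Y Z : complexes A) (p : zigzag (@qis A) X Y) (u : hom Y Z) :
  loc_pi (zfwd u p) = (fmap (loc_functor (@qis A)) u : @hom (der A) Y Z)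
    ∘ (loc_pi p : @hom (der A) X Y).
Proof. by rewrite [RHS]loc_compE. Qed.

Lemma loc_pi_bwd (X Y Z : complexes A) (p : zigzag (@qis A) X Y) (w : hom Z Y) (h : qis w) :
  loc_pi (zbwd h p) = (loc_inv h : @hom (der A) Y Z) ∘ (loc_pi p : @hom (der A) X Y).
Proof. by rewrite [RHS]loc_compE. Qed.

Section TruncationFunctor.
Variable m : int.

Let F : functor (complexes A) (der A) := loc_functor (@qis A) ⊚ tge A m.

Let nu (X : complex A) : @hom (der A) X (tge A m X) :=
  fmap (loc_functor (@qis A)) (to_tge m X : @hom (complexes A) X (tge A m X)).

(** A zigzag between bounded complexes may run through unbounded ones. Truncating all of its
    complexes gives a zigzag of bounded ones, related to the original by the natural morphisms to
    the truncations. *)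
Lemma zeval_tge (hF : forall (X Y : complexes A) (w : hom X Y), qis w -> is_iso (fmap F w))
    (X Y : complexes A) (p : zigzag (@qis A) X Y) :
  nu Y ∘ (loc_pi p : @hom (der A) X Y) = zeval hF p ∘ nu X.
Proof.
have nuN (U V : complexes A) (u : hom U V) :
    nu V ∘ fmap (loc_functor (@qis A)) u = fmap F u ∘ nu U.
  rewrite -[LHS]fmapM -[RHS](fmapM (loc_functor (@qis A))); congr (fmap _ _).
  by apply: chain_mapP => n; rewrite /= -[LHS]tge_mapE.
elim: p => /= [|Y0 Z u p IH|Y0 Z w h p IH].
- exact: etrans (@compm1 (der A) _ _ (nu X)) (esym (comp1m _)).
- rewrite loc_piE; apply: etrans (@compA (der A) _ _ _ _ _ _ _) _; rewrite nuN.
  apply: etrans (esym (@compA (der A) _ _ _ _ _ _ _)) _.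
  apply: etrans (congr1 (@comp (der A) _ _ _ (fmap F u)) IH) _.
  exact: (@compA (der A)).
- apply: (is_iso_mono (hF _ _ w h)).
  apply: etrans (@compA (der A) _ _ _ _ _ _ _) _; rewrite -nuN.
  apply: etrans (esym (@compA (der A) _ _ _ _ _ _ _)) _.
  rewrite loc_pi_bwd [X in nu Y0 ∘ X](@compA (der A)) loc_invKV comp1m.
  apply: etrans IH _; apply: esym; apply: etrans (@compA (der A) _ _ _ _ _ _ _) _.
  by congr (_ ∘ _); rewrite compA inv_isoKV comp1m.
Qed.

End TruncationFunctor.

Lemma loc_like_loc_plus : loc_like (loc_plus A).
Proof.
split.
  move=> [X [m hX]]; exists (exist _ (tge A m X) (tge_bounded m X)).
  exists (fmap (loc_functor (@qis A)) (to_tge m X : @hom (complexes A) X (tge A m X))).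
  have qX : qis (to_tge m X : @hom (complexes A) X (tge A m X)) by exact: to_tge_qis.
  by exists (loc_inv qX); split; [exact: loc_invK | exact: loc_invKV].
move=> S [S1 SM SV] X Y w; have [[a Xa] [b Yb]] := (svalP X, svalP Y).
(* Below [m] both [X] and [Y] vanish, so they are quasi-isomorphic to their truncations at [m]. *)
pose m := Num.min a b.
pose tg (Z : complex A) : cx_plus A := exist _ (tge A m Z) (tge_bounded m Z).
pose hF (U V : complexes A) (w : hom U V) (h : qis w) :=
  loc_functor_inv (tge_qis m h).
have Sp Z (p : zigzag (@qis A) (sval X) Z) :
    S (tg (sval X)) (tg Z) (@zeval _ _ _ (loc_functor (@qis A) ⊚ tge A m) hF _ _ p).
  elim: p => [|Y0 Z0 u p IH|Y0 Z0 v h p IH].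
  - by have := S1 (tg (sval X)) (tg (sval X)) (idm _); rewrite fmap1.
  - by apply: SM IH; exact: (S1 (tg Y0) (tg Z0) (fmap (tge A m) u)).
  - apply: SM IH; apply: (SV (tg Z0) (tg Y0) (fmap (loc_functor (@qis A)) (fmap (tge A m) v))).
    + exact: (inv_isoK (hF _ _ _ h)).
    + exact: (inv_isoKV (hF _ _ _ h)).
    + exact: (S1 (tg Z0) (tg Y0) (fmap (tge A m) v)).
have [p pE] := loc_ind w.
have qm (Z : cx_plus A) : (forall n, n < m -> is_zero (sval Z n)) ->
    qis (to_tge m (sval Z) : @hom (complexes A) _ (tge A m (sval Z))).
  by move=> zZ; apply: to_tge_qis => n nm; apply: coh_zero; exact: zZ.
have qY : qis (to_tge m (sval Y) : @hom (complexes A) _ (tge A m (sval Y))).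
  by apply: qm => n; rewrite lt_min => /andP[_ /Yb].
have wE : w = (loc_inv qY : @hom (der_plus A) (loc_plus A (tg (sval Y))) (loc_plus A Y))
    ∘ ((@zeval _ _ _ (loc_functor (@qis A) ⊚ tge A m) hF _ _ p
         : @hom (der_plus A) (loc_plus A (tg (sval X))) (loc_plus A (tg (sval Y))))
    ∘ fmap (loc_plus A) (to_tge m (sval X) : @hom (cx_plus A) X (tg (sval X)))).
  have e := zeval_tge hF p.
  apply: etrans _ (congr1 (@comp (der A) _ _ _ (loc_inv qY)) e).
  by rewrite (@compA (der A)) loc_invK comp1m pE.
rewrite wE; apply: (SM X (tg (sval Y)) Y); last first.
  by apply: (SM X (tg (sval X)) (tg (sval Y))); [exact: Sp | exact: S1].
apply: (SV Y (tg (sval Y)) (fmap (loc_plus A) (to_tge m (sval Y)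
  : @hom (cx_plus A) Y (tg (sval Y))))).
- exact: (loc_invK qY).
- exact: (loc_invKV qY).
- exact: S1.
Qed.

End Derived.

Section ResolutionExtend.
Variables (C E : category) (good : C -> Prop).
Variable (we : forall X Y : C, hom X Y -> Prop).
Hypothesis res : forall X : C, exists (P : C) (r : hom P X), good P /\ we r.
Hypothesis lift : forall (X Y : C) (u : hom X Y) (P : C) (r : hom P X) (R : C) (s : hom R Y),
  good P -> good R -> we r -> we s ->
  exists (S : C) (s1 : hom S P) (s2 : hom S R),
    [/\ good S, we (r ∘ s1) & u ∘ r ∘ s1 = s ∘ s2].
Variables (G H : functor C E).
Hypothesis weG : forall (X Y : C) (w : hom X Y), we w -> is_iso (fmap G w).

(** [b X] is defined on a chosen resolution of [X]. For naturality with respect to [u], the chosen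
    resolutions of source and target are compared on a third one, which maps to both by [lift]. *)
Lemma resolution_extend (a : forall P : C, good P -> hom (G P) (H P)) :
  (forall (P R : C) (gP : good P) (gR : good R) (u : hom P R),
     a R gR ∘ fmap G u = fmap H u ∘ a P gP) ->
  exists b : nat_trans G H, forall (P : C) (gP : good P), b P = a P gP.
Proof.
move=> aN.
pose P_ X := projT1 (cid (res X)); pose r_ X := projT1 (cid (projT2 (cid (res X)))).
have [gP wr] : (forall X, good (P_ X)) /\ (forall X, we (r_ X)).
  by split=> X; case: (projT2 (cid (projT2 (cid (res X))))).
pose b X : hom (G X) (H X) := fmap H (r_ X) ∘ a _ (gP X) ∘ inv_iso (weG (wr X)).
have bE X : b X ∘ fmap G (r_ X) = fmap H (r_ X) ∘ a _ (gP X).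
  by rewrite -compA inv_isoK compm1.
clearbody b; have bN X Y (u : hom X Y) : b Y ∘ fmap G u = fmap H u ∘ b X.
  have [S [s1 [s2 [gS ws1 e]]]] := lift u (gP X) (gP Y) (wr X) (wr Y).
  apply: (is_iso_epi (weG ws1)).
  rewrite -!compA -fmapM [u ∘ _]compA e [fmap G (_ ∘ s2)]fmapM [b Y ∘ _]compA bE -compA.
  rewrite (aN _ _ gS (gP Y) s2) [fmap H (r_ Y) ∘ _]compA -fmapM -e [fmap G (_
    ∘ s1)]fmapM [b X ∘ _]compA bE.
  by rewrite -[_ ∘ _ ∘ fmap G s1]compA (aN _ _ gS (gP X) s1) !fmapM !compA.
exists (NatTrans bN) => P g /=; apply: (is_iso_epi (weG (wr P))).
by rewrite bE -(aN _ _ (gP P) g (r_ _)).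
Qed.

End ResolutionExtend.

(** * Reduction to flat complexes *)

Section FlatExtension.
Variables (A : tensor_abelian) (torA : finite_tor_dim A).

Definition tfib_plus (X Y : cx_plus A) (w : hom X Y) : Prop :=
  @tfib A (sval X) (sval Y) w.

Definition flat_plus (X : cx_plus A) : Prop := forall n, flat (sval X n).

Lemma tfib_plusM (X Y Z : cx_plus A) (v : hom Y Z) (u : hom X Y) :
  tfib_plus v -> tfib_plus u -> tfib_plus (v ∘ u).
Proof. exact: (@tfibM A (sval X) (sval Y) (sval Z)). Qed.

Lemma flat_cover (X : cx_plus A) : exists (P : cx_plus A) (w : hom P X),
  flat_plus P /\ tfib_plus w.
Proof.
have [d dA] := finite_tor_dim_fdim torA.
have [P [w [bP fP tw]]] := flat_resolution (fdim_enough_flat dA) (svalP X) (fun n => dA _).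
by exists (exist _ P bP), w.
Qed.

Lemma tfib_loc_plus_iso (X Y : cx_plus A) (w : hom X Y) :
  tfib_plus w -> is_iso (fmap (loc_plus A) w).
Proof. by move=> tw; exact: (loc_functor_inv (tfib_qis tw)). Qed.

Definition flat2 (XY : cx_plus A × cx_plus A) := flat_plus XY.1 /\ flat_plus XY.2.

Definition tfib2 (X Y : cx_plus A × cx_plus A) (w : hom X Y) :=
  tfib_plus w.1 /\ tfib_plus w.2.

Definition loc2 := prod_functor (loc_plus A) (loc_plus A).

Lemma plus_pullback (X Y Z : cx_plus A) (u : hom X Z) (w : hom Y Z) : tfib_plus w ->
  exists (B : cx_plus A) (p : hom B X) (q : hom B Y), tfib_plus p /\ u ∘ p = w ∘ q.
Proof.
move=> tw; have bB : bounded (@pb A (sval X) (sval Y) (sval Z) u w).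
  by apply: pb_bounded; [exact: (svalP X) | exact: (svalP Y)].
exists (exist _ _ bB), (pb_fst _ _), (pb_snd _ _); split; first exact: pb_tfib.
exact: pb_square.
Qed.

Lemma flat_lift (X Y : cx_plus A) (u : hom X Y) (P : cx_plus A) (r : hom P X)
    (R : cx_plus A) (s : hom R Y) : tfib_plus r -> tfib_plus s ->
  exists (S : cx_plus A) (s1 : hom S P) (s2 : hom S R),
    [/\ flat_plus S, tfib_plus (r ∘ s1) & u ∘ r ∘ s1 = s ∘ s2].
Proof.
move=> tr ts; have [B [p1 [p2 [t1 e]]]] := plus_pullback (u ∘ r) ts.
have [S [w [fS tw]]] := flat_cover B.
exists S, (p1 ∘ w), (p2 ∘ w); split; [exact: fS | | by rewrite !compA e].
by apply: tfib_plusM tr _; exact: tfib_plusM t1 tw.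
Qed.

(** The extension takes two steps: flat resolutions lead from flat to bounded complexes, and
    [loc_like] leads from bounded complexes to all of D^+. *)
Lemma flat_nat_trans_extend (E : category) (G H : functor (der_plus A × der_plus A) E)
    (a : forall P, flat2 P -> hom (G (loc2 P)) (H (loc2 P))) :
  (forall (P R : cx_plus A × cx_plus A) (fP : flat2 P) (fR : flat2 R) (u : hom P R),
     a R fR ∘ fmap G (fmap loc2 u) = fmap H (fmap loc2 u) ∘ a P fP) ->
  exists b : nat_trans G H, forall P (fP : flat2 P), b (loc2 P) = a P fP.
Proof.
move=> aN.
have inv (F : functor (der_plus A × der_plus A) E) (X Y : cx_plus A × cx_plus A)
    (w : hom X Y) : tfib2 w -> is_iso (fmap (F ⊚ loc2) w).
  move=> [t1 t2]; apply: (is_iso_fmap F).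
  exact: (is_iso_hpair (tfib_loc_plus_iso t1) (tfib_loc_plus_iso t2)).
have [||b bE] := @resolution_extend _ _ flat2 tfib2 _ _ (G ⊚ loc2) (H ⊚ loc2)
  (inv G) a (fun P R fP fR u => aN P R fP fR u).
- move=> [X Y]; have [P [p [fP tp]]] := flat_cover X; have [R [r [fR tr]]] := flat_cover Y.
  by exists (P, R), (hpair p r); split; split.
- move=> [X X'] [Y Y'] [u u'] [P P'] [r r'] [R R'] [s s'] [fP fP'] [fR fR'] [tr tr'] [ts ts'].
  have [S [s1 [s2 [fS ws e]]]] := flat_lift u tr ts.
  have [S' [s1' [s2' [fS' ws' e']]]] := flat_lift u' tr' ts'.
  exists (S, S'), (hpair s1 s1'), (hpair s2 s2'); split; [by split | by split |].
  by apply: (f_equal2 (@Datatypes.pair _ _) e e').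
have [b' b'E] := nat_trans_extend (ntcE b)
  (loc_like_prod (@loc_like_loc_plus A) (@loc_like_loc_plus A)).
by exists b' => P fP; rewrite b'E (bE _ fP).
Qed.

Lemma flat_replace (X : der_plus A) : exists (P : cx_plus A) (i : hom (loc_plus A P) X),
  flat_plus P /\ is_iso i.
Proof.
have [Y [i [j [ji ij]]]] := (@loc_like_loc_plus A).1 X.
have [P [w [fP tw]]] := flat_cover Y; exists P, (j ∘ fmap (loc_plus A) w); split=> //.
by apply: is_isoM; [exists i | exact: tfib_loc_plus_iso].
Qed.

Lemma nat_trans_iso_eq (C D : category) (G H : functor C D) (a b : nat_trans G H)
    (X Y : C) (i : hom X Y) : is_iso i -> a X = b X -> a Y = b Y.
Proof.
move=> ii e; apply: (is_iso_epi (is_iso_fmap G ii)).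
by rewrite !ntcE e.
Qed.

Lemma flat_nat_trans_eq (E : category) (G H : functor (der_plus A × der_plus A) E)
    (a b : nat_trans G H) :
  (forall P, flat2 P -> a (loc2 P) = b (loc2 P)) -> forall X, a X = b X.
Proof.
move=> ab [X Y]; have [P [i [fP ii]]] := flat_replace X.
have [R [j [fR ij]]] := flat_replace Y.
apply: (nat_trans_iso_eq (is_iso_hpair ii ij)).
by apply: (ab (P, R)).
Qed.

End FlatExtension.

(** * Roofs with trivial fibrations *)

Section Roofs.
Variable A : tensor_abelian.

Lemma der_coh_loc (X Y : cx_plus A) (u : hom X Y) n :
  fmap (der_coh A n) (fmap (loc_plus A) u) = coh_map n (u : chain_map (sval X) (sval Y)).
Proof. exact: (loc_lift_functor (fun U V w hw => hw n)). Qed.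

Lemma loc_plus_iso_qis (X Y : cx_plus A) (u : hom X Y) :
  is_iso (fmap (loc_plus A) u) -> @qis A (sval X) (sval Y) u.
Proof. by move=> iu n; have := is_iso_fmap (der_coh A n) iu; rewrite der_coh_loc. Qed.

(** Adding to [X] a contractible complex that covers [Y] makes [v] degreewise epimorphic. The
    projection [p] back to [X] is a trivial fibration, inverse in D^+ to the inclusion [j]; hence
    [w] equals [v ∘ p] in D^+, although not as a chain map. *)
Lemma surjective_replace (X Y : cx_plus A) (v : hom X Y) : is_iso (fmap (loc_plus A) v) ->
  exists (Z : cx_plus A) (p : hom Z X) (w : hom Z Y),
    [/\ tfib_plus p, tfib_plus w & fmap (loc_plus A) w = fmap (loc_plus A) (v ∘ p)].
Proof.
move=> /loc_plus_iso_qis qv; pose eps n := idm (sval Y n).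
have bZ : bounded (csum (sval X) (cov (sval Y))).
  by apply: csum_bounded; [exact: (svalP X) | apply: cov_bounded; exact: (svalP Y)].
pose Z : cx_plus A := exist _ _ bZ.
pose p : hom Z X := csum_fst (sval X) (cov (sval Y)).
pose j : hom X Z := csum_in (sval X) (cov (sval Y)).
pose w : hom Z Y := csum_desc (v : chain_map (sval X) (sval Y)) (cov_map eps).
have tp : tfib_plus p by apply: csum_fst_tfib => n T z; exact: cov_acyclic.
have pj : p ∘ j = idm X by exact: csum_fst_in.
have wj : w ∘ j = v by apply: chain_mapP => n; exact: copair1.
have ip := tfib_loc_plus_iso tp.
have jp : fmap (loc_plus A) j ∘ fmap (loc_plus A) p = idm (loc_plus A Z).
  apply: (is_iso_mono ip).
  by rewrite compA -fmapM pj fmap1 comp1m compm1.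
exists Z, p, w; split=> //; last first.
  by rewrite -wj -[LHS]compm1 -jp compA -!fmapM.
apply: surj_qis_tfib => [n|].
  apply: epi_copairr; apply: cov_map_epi => k; exact: epi1.
apply: loc_plus_iso_qis; apply: (is_iso_cancelr (u := fmap (loc_plus A) j)).
  by exists (fmap (loc_plus A) p); rewrite jp -fmapM pj fmap1.
by rewrite -fmapM wj; exact: loc_functor_inv.
Qed.

(** The morphisms that admit such a roof form a closed class. Composites use the pullback of a
    trivial fibration. For an inverse the roof is read backwards, after its right leg has been
    turned into a trivial fibration by [surjective_replace]. *)
Lemma roof (X Y : cx_plus A) (w : hom (loc_plus A X) (loc_plus A Y)) :
  exists (Q : cx_plus A) (q : hom Q X) (v : hom Q Y),
    tfib_plus q /\ w ∘ fmap (loc_plus A) q = fmap (loc_plus A) v.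
Proof.
move: X Y w; apply: (@loc_like_loc_plus A).2; split.
- move=> X Y u; exists X, (idm X), u; split; first exact: (@tfib1 A (sval X)).
  by rewrite fmap1 compm1.
- move=> X Y Z v u [Q [q [w [tq e]]]] [Q' [q' [w' [tq' e']]]].
  have [B [b [b' [tb bE]]]] := plus_pullback w' tq.
  exists B, (q' ∘ b), (w ∘ b'); split; first exact: tfib_plusM tq' tb.
  by rewrite !fmapM -e -[_ ∘ fmap _ q ∘ _]compA -[fmap _ q ∘ _]fmapM -bE fmapM -!compA [u
    ∘ (_ ∘ _)]compA e'.
- move=> X Y w v vw wv [Q [q [u [tq e]]]].
  have iu : is_iso (fmap (loc_plus A) u).
    by rewrite -e; apply: is_isoM; [exists v | exact: tfib_loc_plus_iso].
  have [Z [p [u' [tp tu' u'E]]]] := surjective_replace iu.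
  exists Z, u', (q ∘ p); split=> //.
  by rewrite u'E !fmapM -e !compA vw comp1m.
Qed.

Lemma flat_roof (torA : finite_tor_dim A) (X Y : cx_plus A)
    (w : hom (loc_plus A X) (loc_plus A Y)) :
  exists (Q : cx_plus A) (q : hom Q X) (v : hom Q Y),
    [/\ flat_plus Q, tfib_plus q & w ∘ fmap (loc_plus A) q = fmap (loc_plus A) v].
Proof.
have [Q [q [v [tq e]]]] := roof w; have [P [p [fP tp]]] := flat_cover torA Q.
exists P, (q ∘ p), (v ∘ p); split=> //; first exact: tfib_plusM tq tp.
by rewrite !fmapM compA e.
Qed.

End Roofs.

(** * Truncation from above in degree 0 *)

Section LowerTruncation.
Variable A : abelian.
Variable X : complex A.

(* The relations defining the subcomplex [... -> X^-1 -> Z^0 -> 0 -> ...]. *)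
Definition tle0_rel (n : int) : hom (X n) (bisum (X n) (X (1 + n))) :=
  if 0 < n then pair (idm _) 0
  else if n == 0 then pair 0 (dif X n (1 + n)) else 0.

Lemma tle0_rel_pos n : 0 < n -> pr1 _ _ ∘ tle0_rel n = idm _.
Proof. by rewrite /tle0_rel => ->; rewrite pair1. Qed.

Lemma tle0_rel_zero : pr2 _ _ ∘ tle0_rel 0 = dif X 0 (1 + 0).
Proof. by rewrite /tle0_rel ltxx eqxx pair2. Qed.

Lemma tle0_high n : 0 < n -> is_zero (ker (tle0_rel n)).
Proof.
move=> n0; apply: (@mono_kerm _ _ _ (tle0_rel n)); rewrite compm0 compm1.
have /(congr1 (comp (pr1 _ _))) := kerm0 (tle0_rel n).
by rewrite compm0 compA tle0_rel_pos // comp1m.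
Qed.

Lemma tle0_dif_ex i j : exists d, kerm (tle0_rel j) ∘ d = dif X i j ∘ kerm (tle0_rel i).
Proof.
have [jE|h] := eqVneq j (1 + i); last first.
  by exists 0; rewrite dif_shape // comp0m compm0.
apply: kernel_lift (kermP _) _; rewrite [tle0_rel j]/tle0_rel.
case: ifP => [j0|_].
  suff -> : dif X i j ∘ kerm (tle0_rel i) = 0 by rewrite compm0.
  have [i0|] := ltP 0 i; first by apply: zero_in; exact: tle0_high.
  rewrite le_eqVlt => /orP[/eqP i0|i0].
    subst i; subst j; have /(congr1 (comp (pr2 _ _))) := kerm0 (tle0_rel 0).
    by rewrite compm0 compA tle0_rel_zero.
  have h : 0 < 1 + i by rewrite -jE.
  by exfalso; move: h; rewrite addrC ltzD1 leNgt i0.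
case: ifP => _; last by rewrite comp0m.
rewrite compA (_ : pair _ _ ∘ dif X i j = 0) ?comp0m //.
by apply: pair_eq; rewrite compm0 compA ?pair1 ?pair2 ?comp0m ?dif_dif.
Qed.

Definition tle0_dif i j := projT1 (cid (tle0_dif_ex i j)).

Lemma tle0_difE i j :
  kerm (tle0_rel j) ∘ tle0_dif i j = dif X i j ∘ kerm (tle0_rel i).
Proof. by rewrite /tle0_dif; case: cid. Qed.

Lemma tle0_shape i j : j != 1 + i -> tle0_dif i j = 0.
Proof.
by move=> h; apply: mono_kerm; rewrite tle0_difE compm0 dif_shape // comp0m.
Qed.

Lemma tle0_dif_dif i j k : tle0_dif j k ∘ tle0_dif i j = 0.
Proof.
by apply: mono_kerm; rewrite compA tle0_difE -compA tle0_difE compA dif_dif comp0m compm0.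
Qed.

Definition tle0 : complex A :=
  @Complex A (fun n => ker (tle0_rel n)) tle0_dif tle0_shape tle0_dif_dif.

Definition tle0_in : chain_map tle0 X :=
  @ChainMap A tle0 X (fun n => kerm (tle0_rel n)) tle0_difE.

Lemma tle0_bounded : bounded X -> bounded tle0.
Proof.
by move=> [m h]; exists m => n /h; apply: is_zero_mono; exact: (@mono_kerm _ _ _ (tle0_rel n)).
Qed.

Lemma tle0_qis : (forall n, 0 < n -> is_zero (coh n X)) -> @qis A tle0 X tle0_in.
Proof.
move=> zX; apply: qisP => n T z zc; have [n0|] := ltP 0 n.
- by rewrite (zero_out z (tle0_high n0)) => _; exact: bdy0.
- move=> n0 /bdy_src[T' [e [y [ee yE]]]].
  have [y' y'E] : exists y', tle0_in (n - 1) ∘ y' = y.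
    apply: kernel_lift (kermP _) _; rewrite /tle0_rel.
    have n1 : n - 1 < 0 by apply: lt_le_trans n0; rewrite ltrBlDr ltrDl.
    by rewrite ltNge (ltW n1) /= lt_eqF // comp0m.
  exists T', e, (n - 1), y'; split=> //; apply: (@mono_kerm _ _ _ (tle0_rel n)).
  by rewrite compA [LHS]yE -y'E !compA (cmE tle0_in).
- exists T, (idm T), 0; split; [exact: epi1 | exact: compm0 |].
  by rewrite compm1 compm0 subr0; apply: is_zero_coh zc; exact: zX.
- move=> n0; have [x xE] : exists x, tle0_in n ∘ x = z.
    apply: kernel_lift (kermP _) _; rewrite /tle0_rel ltNge n0 /=.
    by case: ifP => _; [rewrite /pair compm0 add0r -compA zc compm0 | exact: comp0m].
  exists T, (idm T), x; split; first exact: epi1.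
    by apply: (@mono_kerm _ _ _ (tle0_rel (1 + n))); rewrite compm0 compA (cmE tle0_in) -compA xE.
  by rewrite compm1 xE subrr; exact: bdy0.
Qed.

End LowerTruncation.

(** * Spheres, exact functors and effacement *)

Section Spheres.
Variables (A : abelian) (r : int) (M : A).

Definition sph_rel (n : int) : hom M M := if n == r then 0 else idm M.

(** [M] in degree [r]; taking kernels of endomorphisms of [M] spares a transport
    along [n = r]. *)

Definition sph : complex A.
Proof.
refine (@Complex A (fun n => ker (sph_rel n)) (fun _ _ => 0) _ _) => // i j k.
exact: compm0.
Defined.

Lemma sph_zero n : n != r -> is_zero (sph n).
Proof.
move=> nr; apply: (@mono_kerm _ _ _ (sph_rel n)); rewrite compm0 compm1.
have e : sph_rel n = idm M by rewrite /sph_rel (negPf nr).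
have m : mono (sph_rel n) by rewrite e; apply: is_iso_mono; exact: is_iso1.
exact: mono0 m (kerm0 _).
Qed.

Lemma sph_bounded : bounded sph.
Proof. by exists r => n nr; apply: sph_zero; rewrite lt_eqF. Qed.

Lemma sph_in_ex : exists s : hom M (sph r), kerm (sph_rel r) ∘ s = idm M.
Proof. by apply: kernel_lift (kermP _) _; rewrite /sph_rel eqxx comp0m. Qed.

Definition sph_in : hom M (sph r) := projT1 (cid sph_in_ex).

Lemma sph_inK : kerm (sph_rel r) ∘ sph_in = idm M.
Proof. by rewrite /sph_in; case: cid. Qed.

Lemma sph_cyc : cyc sph_in.
Proof. exact: comp0m. Qed.

Definition sph_cls : hom M (coh r sph) := cls r sph ∘ cocyc_lift sph_cyc.

Lemma sph_cls_iso : is_iso sph_cls.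
Proof.
have kin : sph_in ∘ kerm (sph_rel r) = idm _.
  by apply: (@mono_kerm _ _ _ (sph_rel r)); rewrite compA sph_inK comp1m compm1.
apply: mono_epi_iso.
  apply: mono0P => T t; rewrite /sph_cls -compA (cocyc_lift_comp _ (cyc_comp t sph_cyc)).
  move=> /cls_bdy[T' [e [i [y [ee yE]]]]]; apply: ee.
  apply: (is_iso_mono (u := sph_in)); first by exists (kerm (sph_rel r)); rewrite sph_inK kin.
  by rewrite comp0m compm0 compA yE; exact: comp0m.
have [T [e [z [zc [ee zE]]]]] := coh_elt (idm (coh r sph)).
have : epi (sph_cls ∘ (kerm (sph_rel r) ∘ z)); last exact: epi_factor.
suff -> : sph_cls ∘ (kerm (sph_rel r) ∘ z) = e by [].
rewrite -[e]comp1m zE /sph_cls -compA; congr (_ ∘ _); apply: cocycm_mono.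
by rewrite compA !cocyc_liftK compA kin comp1m.
Qed.

Lemma sph_coh_zero n : n != r -> is_zero (coh n sph).
Proof. by move=> nr; apply: coh_zero; exact: sph_zero. Qed.

Variables (X : complex A) (z : hom M (X r)) (zc : cyc z).

(** Spheres represent cocycles: the tautological class [sph_cls] is carried to the class of [z], see
    [sph_map_cls]. *)
Definition sph_map : chain_map sph X.
Proof.
refine (@ChainMap A sph X (fun n => eqmap X r n ∘ z ∘ kerm (sph_rel n)) _) => i j.
rewrite [LHS]compm0; have [e|h] := eqVneq i r.
  by rewrite e eqmap_id comp1m compA cycE // comp0m.
by rewrite eqmap0r // !comp0m compm0.
Defined.

Lemma sph_map_cls : coh_map r sph_map ∘ sph_cls = cls r X ∘ cocyc_lift zc.
Proof.
rewrite (coh_map_lift _ (cyc_map sph_map sph_cyc)); congr (_ ∘ _).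
apply: cocycm_mono; rewrite !cocyc_liftK /= eqmap_id comp1m -compA sph_inK.
by rewrite compm1.
Qed.

End Spheres.

Section ExactFunctors.
Variables (A B : abelian) (f : additive_functor A B) (fx : exact_functor f).

Lemma exact_mono (X Y : A) (i : hom X Y) : mono i -> mono (fmap f i).
Proof. by move=> /short_exact_cokm/fx/short_exact_mono. Qed.

Lemma exact_epi (X Y : A) (p : hom X Y) : epi p -> epi (fmap f p).
Proof. by move=> /short_exact_kerm/fx/short_exact_epi. Qed.

(** Exactness is given for short exact sequences only. Factoring [u] through its image [I] produces
    one, namely K -> X -> I. *)
Lemma exact_kernel (X Y K : A) (u : hom X Y) (k : hom K X) :
  is_kernel u k -> is_kernel (fmap f u) (fmap f k).
Proof.
move=> uk; have [I [m [e [mm ee me]]]] := image_factor u.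
have ek : e ∘ k = 0 by apply: mm; rewrite compA me uk.1 compm0.
have ke : short_exact k e.
  apply: short_exactP => //; first exact: kernel_mono uk.
  move=> T t et; exists T, (idm T).
  have [|s sE] := @kernel_lift _ _ _ _ _ _ _ t uk.
    by rewrite -me -compA et compm0.
  by exists s; split; [exact: epi1 | rewrite compm1].
split; first by rewrite -fmapM uk.1 afun0.
move=> Z v; rewrite -me fmapM -compA => /(mono0 (exact_mono mm)).
exact: (fx ke).1.2.
Qed.

Lemma exact_cokernel (X Y Q : A) (u : hom X Y) (q : hom Y Q) :
  is_cokernel u q -> is_cokernel (fmap f u) (fmap f q).
Proof.
move=> uq; have [I [m [e [mm ee me]]]] := image_factor u.
have qm : q ∘ m = 0 by apply: ee; rewrite -compA me uq.1 comp0m.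
have mq : short_exact m q.
  apply: mono_cokernel_short_exact => //; split=> // Z v vm.
  by apply: uq.2; rewrite -me compA vm comp0m.
split; first by rewrite -fmapM uq.1 afun0.
move=> Z v; rewrite -me fmapM compA => /(epi0 (exact_epi ee)).
exact: (fx mq).2.2.
Qed.

(** An exact functor preserves the kernel and the cokernel that define cohomology. The formula for
    [b] on cocycles is what shows its naturality in [exact_qis]. *)
Lemma coh_exact_ex (X : complex A) n : exists b : hom (f (coh n X)) (coh n (cx_map f X)),
  is_iso b /\ forall T (z : hom T (X n)) (zc : cyc z) (fzc : cyc (X := cx_map f X) (fmap f z)),
    b ∘ fmap f (cls n X ∘ cocyc_lift zc) = cls n (cx_map f X) ∘ cocyc_lift fzc.
Proof.
set Y := cx_map f X.
have kZ := exact_kernel (kermP (dif X n (1 + n))).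
have qH := exact_cokernel (cokmP (cobound n X)).
have ac : cyc (X := Y) (n := n) (fmap f (cocycm n X)).
  by rewrite /cyc /= -fmapM dif_cocyc afun0.
pose a := cocyc_lift ac.
have aE : cocycm n Y ∘ a = fmap f (cocycm n X) by exact: cocyc_liftK.
have [a' a'E] := kernel_lift kZ (dif_cocyc n Y (1 + n)).
have aa' : a ∘ a' = idm _.
  by apply: cocycm_mono; rewrite compA aE a'E compm1.
have a'a : a' ∘ a = idm _.
  by apply: (kernel_mono kZ); rewrite compA a'E [LHS]aE compm1.
have aB : a ∘ fmap f (cobound n X) = cobound n Y.
  apply: cocycm_mono; apply: (@etrans _ _ (fmap f (dif X (n - 1) n))).
    by rewrite compA aE -fmapM cocycm_cobound.
  exact: (esym (cocycm_cobound n Y)).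
have [b bE] : exists b, b ∘ fmap f (cls n X) = cls n Y ∘ a.
  by apply: cokernel_desc qH _; rewrite -compA aB cokm0.
have [b' b'E] : exists b', b' ∘ cls n Y = fmap f (cls n X) ∘ a'.
  apply: cokernel_desc (cokmP _) _.
  by rewrite -aB -compA [a' ∘ _]compA a'a comp1m -fmapM cokm0 afun0.
exists b; split.
  exists b'; split.
    apply: (cokernel_epi qH).
    by rewrite -compA [b ∘ _]bE compA b'E -compA a'a compm1 comp1m.
  by apply: cls_epi; rewrite -compA b'E compA bE -compA aa' compm1 comp1m.
move=> T z zc fzc; rewrite fmapM compA bE -compA; congr (_ ∘ _).
by apply: cocycm_mono; rewrite compA aE -fmapM !cocyc_liftK.
Qed.

Lemma exact_coh_iso (X : complex A) n : exists b : hom (f (coh n X)) (coh n (cx_map f X)), is_iso b.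
Proof. by have [b [ib _]] := coh_exact_ex X n; exists b. Qed.

Lemma exact_qis (X Y : complexes A) (u : hom X Y) : qis u -> qis (fmap (cx_map f) u).
Proof.
move=> qu n; have [b [ib bE]] := coh_exact_ex X n; have [c [ic cE]] := coh_exact_ex Y n.
apply: (is_iso_cancelr (u := b)) => //=.
suff -> : coh_map n (cx_map_hom f u) ∘ b = c ∘ fmap f (coh_map n u).
  by apply: is_isoM => //; apply: is_iso_fmap; exact: qu.
have zc : cyc (cocycm n X) by exact: dif_cocyc.
have fzc : cyc (X := cx_map f X) (n := n) (fmap f (cocycm n X)).
  by rewrite /cyc /= -fmapM dif_cocyc afun0.
have e : cls n X ∘ cocyc_lift zc = cls n X.
  by rewrite -[RHS]compm1; congr (_ ∘ _); apply: cocycm_mono; rewrite cocyc_liftK compm1.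
have ef : epi (fmap f (cls n X)) by apply: exact_epi; exact: cls_epi.
apply: ef; rewrite -[in LHS]e -compA (bE _ _ zc fzc).
rewrite (coh_map_lift _ (cyc_map (cx_map_hom f u) fzc)).
have uzc := cyc_map u zc.
have fuzc : cyc (X := cx_map f Y) (n := n) (fmap f (u n ∘ cocycm n X)).
  by rewrite /cyc /= -fmapM uzc afun0.
rewrite -compA -fmapM -[in RHS]e (coh_map_lift zc uzc) (cE _ _ _ fuzc); congr (_ ∘ _).
by apply: cocycm_mono; rewrite !cocyc_liftK /= fmapM.
Qed.

Lemma exact_coh_bounded (X : complex A) : coh_bounded X -> coh_bounded (cx_map f X).
Proof.
move=> [m h]; exists m => n /h z; have [b [b' [b'b bb']]] := exact_coh_iso X n.
by rewrite /is_zero -bb' (zero_out b' (afun_zero f z)) compm0.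
Qed.

Definition der_exact : functor (der_plus A) (der_plus B) :=
  @full_sub_functor (der A) (der B) (@coh_bounded A) (@coh_bounded B)
    (@loc_lift (complexes A) (@qis A) (der B) (loc_functor (@qis B) ⊚ cx_map f)
       (fun X Y w hw => loc_functor_inv (exact_qis hw)))
    exact_coh_bounded.

End ExactFunctors.

Section Effacement.
Variables (A : tensor_abelian) (torA : finite_tor_dim A).

(** Represent [x] by a roof and truncate its apex to [R], in degrees at most 0. Then [R] maps onto
    [W] in degree 0, and the kernel there consists of coboundaries, which are killed because the
    target has zero differentials. The complex [W] is zero outside degree 0 only up to isomorphism,
    as is the image of a sphere under an additive functor. *)
Lemma full_degree0 (W : cx_plus A) (X : A) (x : hom (loc_plus A W) (loc_plus A (single A X))) :
  (forall n, n != 0 -> is_zero (sval W n)) ->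
  exists w : hom W (single A X), x = fmap (loc_plus A) w.
Proof.
move=> zW; have [Q [q [v [tq e]]]] := roof x.
have qq : @qis A (sval Q) (sval W) q := tfib_qis tq.
have zQ n : 0 < n -> is_zero (coh n (sval Q)).
  move=> n0; have [b [ba _]] := qq n.
  have z : is_zero (coh n (sval W)) by apply: coh_zero; apply: zW; rewrite gt_eqF.
  by rewrite /is_zero -ba; rewrite [fmap _ _](zero_out _ z) compm0.
pose R : cx_plus A := exist _ (tle0 (sval Q)) (tle0_bounded (svalP Q)).
pose j : hom R Q := tle0_in (sval Q).
have qj : @qis A (sval R) (sval Q) j by exact: tle0_qis.
pose qr : chain_map (sval R) (sval W) := q ∘ j.
pose vr : chain_map (sval R) (single_cx X) := v ∘ j.
have qqr : @qis A (sval R) (sval W) qr.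
  by move=> n; rewrite [fmap _ _](fmapM (coh_functor A n) (q : @hom (complexes A) _ _) j);
    exact: is_isoM.
have eqr : epi (qr 0).
  have zc : cyc (idm (sval W 0)) by apply: zero_out; exact: zW.
  have [T [c [y [ec yc yE]]]] := tfib_cycle (w := (q : chain_map _ _)) tq zc.
  have [s sE] : exists s, tle0_in (sval Q) 0 ∘ s = y.
    apply: kernel_lift (kermP _) _; apply: pair_eq; rewrite compm0 compA.
      by rewrite /tle0_rel ltxx eqxx pair1 comp0m.
    by rewrite tle0_rel_zero.
  by apply: (@epi_factor _ _ _ _ _ s); rewrite -compA sE yE comp1m.
have vk : vr 0 ∘ kerm (qr 0) = 0.
  have zc : cyc (kerm (qr 0)) by apply: zero_out; exact: tle0_high.
  have [|T [c [i [y [ec yE]]]]] := qis_inj qqr zc; first by rewrite kerm0; exact: bdy0.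
  apply: ec; rewrite -compA yE compA (cmE vr) comp0m -compA.
  exact: comp0m.
have [w0 w0E] := cokernel_desc (epi_normal eqr) vk.
pose w n : hom (sval W n) (single_cx_ob X n) :=
  match n as n0 return hom (sval W n0) (single_cx_ob X n0) with
  | Posz 0 => w0 | _ => 0 end.
have wE m n : w n ∘ dif (sval W) m n = dif (single_cx X) m n ∘ w m.
  rewrite [RHS]comp0m; have [->|m0] := eqVneq m 0; last by apply: zero_in; exact: zW.
  have [->|n0] := eqVneq n 0; first by rewrite dif_shape // compm0.
  by rewrite [dif _ _ _](zero_out _ (zW _ n0)) compm0.
pose ww : hom W (single A X) := @ChainMap A (sval W) (single_cx X) w wE.
exists ww; apply: (is_iso_epi (loc_functor_inv qqr
  : @is_iso (der_plus A) (loc_plus A R) (loc_plus A W) _)).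
apply: etrans (_ : fmap (loc_plus A) (v ∘ j) = _).
  by rewrite fmapM -e -compA -fmapM.
rewrite -[RHS](fmapM (loc_plus A) ww (q ∘ j)); congr (fmap _ _); apply: chain_mapP => n.
have [->|n0] := eqVneq n 0; first by rewrite [RHS]w0E.
exact: etrans (zero_out _ (single_zero _ n0)) (esym (zero_out _ (single_zero _ n0))).
Qed.

(** Two facts about the flat resolution [Q] of [W] are decisive. Its cohomology vanishes in degree
    -1, since [r] is a natural number; so the kernel of [dQ] consists of coboundaries, on which [v1]
    vanishes, and [i] is a monomorphism. Its cohomology is flat and vanishes above [r], so that the
    quotient, the cokernel of [dQ], is flat by [flat_cok]. *)
Lemma effacement (W : cx_plus A) (r : nat) (X' : A)
    (x : hom (loc_plus A W) (der_shift A (loc_plus A (single A X')))) :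
  flat (coh r (sval W)) -> (forall n : int, n != r -> is_zero (coh n (sval W))) ->
  exists (X X'' : A) (i : hom X' X) (p : hom X X'') (ip : short_exact i p)
    (y : hom (loc_plus A W) (loc_plus A (single A X''))),
    flat X'' /\ der_connecting ip ∘ y = x.
Proof.
move=> fW zW; have [d dA] := finite_tor_dim_fdim torA.
have [Q [q [v [fQ tq e]]]] := flat_roof torA (Y := cx_shift A (single A X')) x.
have qq : @qis A (sval Q) (sval W) q := tfib_qis tq.
have zQ (n : int) : n != r -> is_zero (coh n (sval Q)).
  move=> n0; have [b [ba _]] := qq n.
  by rewrite /is_zero -ba; rewrite [fmap _ _](zero_out _ (zW _ n0)) compm0.
have fHQ n : flat (coh n (sval Q)).
  have [->|nr] := eqVneq n r; last by apply: flat_zero; exact: zQ.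
  by apply: flat_iso (is_iso_inv (qq r)) fW.
have fC : flat (cok (sval Q) 0).
  apply: (flat_cok (fdim_enough_flat dA) dA fQ fHQ (r := r)) => n rn.
  by apply: zQ; rewrite gt_eqF.
pose dQ : hom (sval Q (Negz 0)) (sval Q 0) := dif (sval Q) (Negz 0) 0.
pose v1 : hom (sval Q (Negz 0)) X' := (v : chain_map (sval Q) (shift_ob (single_cx X'))) (Negz 0).
have v1d k : v1 ∘ dif (sval Q) k (Negz 0) = 0.
  rewrite [LHS](cmE (v : chain_map (sval Q) (shift_ob (single_cx X')))) /= oppr0.
  exact: comp0m.
pose c : hom (sval Q 0) (cok (sval Q) 0) := cokm (dif (sval Q) (0 - 1) 0).
have cd k : c ∘ dif (sval Q) k 0 = 0 by exact: cokm_dif.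
(* The pushout of [v1] and [dQ] is taken as the cokernel of [u], without a sign; hence [i ∘ v1] is
   minus [j ∘ dQ]. *)
pose u := pair v1 dQ.
pose i : hom X' (coker u) := cokm u ∘ in1 _ _.
pose j : hom (sval Q 0) (coker u) := cokm u ∘ in2 _ _.
have ij : i ∘ v1 + j ∘ dQ = 0 by rewrite -!compA -compDr -/(pair v1 dQ) cokm0.
have pu : copair 0 c ∘ u = 0 by rewrite copair_pair comp0m add0r; exact: cd.
pose p : hom (coker u) (cok (sval Q) 0) := cdesc pu.
have pi0 : p ∘ i = 0 by rewrite compA cdescK copair1.
have pj : p ∘ j = c by rewrite compA cdescK copair2.
have ip : short_exact i p.
  apply: short_exactP => //.
  - apply: mono0P => T t; rewrite -compA => /(cokernel_exact (cokmP u)).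
    move=> [T' [a [s [ea sE]]]]; apply: ea.
    have := congr1 (comp (pr1 _ _)) sE; rewrite !compA pair1 pr1in1 comp1m => <-.
    have := congr1 (comp (pr2 _ _)) sE; rewrite !compA pair2 pr2in1 !comp0m => sc.
    have [|T'' [b [k [y [eb yE]]]]] := @is_zero_coh _ (Negz 0) (sval Q) _ s _ sc; first exact: zQ.
    by apply: eb; rewrite -compA yE compA v1d !comp0m.
  - by apply: (@epi_factor _ _ _ _ _ j); rewrite pj; exact: epi_cokm.
  - move=> T t pt0; have [T1 [e1 [z [ee1 zE]]]] := epi_pullback t (@epi_cokm _ _ _ u).
    have : c ∘ (pr2 _ _ ∘ z) = 0.
      have : copair 0 c ∘ z = 0 by rewrite -(cdescK pu) -compA zE compA pt0 comp0m.
      by rewrite {1}(pair_eta z) copair_pair comp0m add0r.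
    move=> /(cokernel_exact (cokmP _))[T2 [e2 [s [ee2 sE]]]].
    exists T2, (e1 ∘ e2), (pr1 _ _ ∘ z ∘ e2 - v1 ∘ s); split; first exact: epiM.
    have E : in1 _ _ ∘ (pr1 _ _ ∘ z ∘ e2 - v1 ∘ s : hom T2 X') = z ∘ e2 - u ∘ s.
      apply: pair_eq; rewrite !compDr !compmN !compA ?pr1in1 ?pr2in1 ?pair1 ?pair2 ?comp1m //.
      rewrite !comp0m oppr0 addr0; apply/esym/eqP; rewrite subr_eq0; apply/eqP.
      exact: esym sE.
    apply: etrans (esym (compA _ _ _)) _; rewrite E compA -zE.
    by rewrite compDr compmN [cokm u ∘ (u ∘ s)]compA cokm0 comp0m subr0 compA.
pose yd n : hom (sval Q n) (single_cx_ob (cok (sval Q) 0) n) :=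
  match n as n0 return hom (sval Q n0) (single_cx_ob (cok (sval Q) 0) n0) with
  | Posz 0 => c | _ => 0 end.
have ydE m n : yd n ∘ dif (sval Q) m n = dif (single_cx (cok (sval Q) 0)) m n ∘ yd m.
  rewrite [RHS]comp0m; case: n => [[|n]|n]; [exact: cd | exact: comp0m | exact: comp0m].
pose y : hom Q (single A (cok (sval Q) 0)) :=
  @ChainMap A (sval Q) (single_cx (cok (sval Q) 0)) yd ydE.
(* The sign of [v1] makes [kd] commute with the differentials, and it cancels against the sign in
   [cone_shift], so that the composite with [cone_shift i] is [v] itself. *)
pose kd n : hom (sval Q n) (cone i n) :=
  match n as n0 return hom (sval Q n0) (cone_ob X' (coker u) n0) with
  | Negz 0 => - v1 | Posz 0 => j | _ => 0 end.
have kdE m n : kd n ∘ dif (sval Q) m n = dif (cone i) m n ∘ kd m.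
  have z (h : hom (cone i m) (cone i n)) : h = 0 -> kd n ∘ dif (sval Q) m n = 0 ->
      kd n ∘ dif (sval Q) m n = h ∘ kd m by move=> -> ->; rewrite comp0m.
  case: n z => [[|n]|[|n]] z; last 1 first.
  - by apply: z; [case: (m) => [[|k]|[|k]] | exact: comp0m].
  - case: m z => [m|[|m]] z.
    + by apply: z => //; rewrite dif_shape ?compm0.
    + rewrite /= compmN; apply/eqP; rewrite -addr_eq0; apply/eqP.
      by rewrite addrC; exact: ij.
    + by apply: z => //; rewrite dif_shape ?compm0.
  - by apply: z; [case: (m) => [[|k]|[|k]] | exact: comp0m].
  - apply: z; first by case: (m) => [[|k]|[|k]].
    by rewrite /= compNm v1d oppr0.
pose kap : @hom (complexes A) (sval Q) (cone i) := @ChainMap A (sval Q) (cone i) kd kdE.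
have e1 : (cone_single ip.1.1 : @hom (complexes A) (cone i) (single_cx _)) ∘ kap = y.
  apply: chain_mapP => -[[|n]|[|n]] /=; try exact: comp0m.
  exact: pj.
have e2 : (cone_shift i : @hom (complexes A) (cone i) (shift_ob (single_cx X'))) ∘ kap = v.
  apply: chain_mapP => -[[|n]|[|n]].
  - by apply: etrans (comp0m _ _) _; apply: esym; apply: zero_out; exact: zero_obP.
  - by apply: etrans (comp0m _ _) _; apply: esym; apply: zero_out; exact: zero_obP.
  - by rewrite /= compNm compmN opprK comp1m.
  - by apply: etrans (comp0m _ _) _; apply: esym; apply: zero_out; exact: zero_obP.
have iq := tfib_loc_plus_iso tq.
exists (coker u), (cok (sval Q) 0), i, p, ip, (fmap (loc_plus A) y ∘ inv_iso iq).
split=> //; apply: (is_iso_epi iq).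
rewrite -!compA inv_isoK compm1; apply: etrans _ (esym e); rewrite /der_connecting.
apply: etrans (esym (@compA (der A) _ _ _ _ _ _ _)) _.
have -> : fmap (loc_plus A) y = fmap (loc_functor (@qis A)) (cone_single ip.1.1
  : @hom (complexes A) (cone i) (single_cx _)) ∘ fmap (loc_functor (@qis A)) kap.
  by rewrite -fmapM e1.
rewrite [X in _ ∘ X](@compA (der A)) loc_invK comp1m -fmapM e2.
by [].
Qed.

End Effacement.

(** * Adjunctions between derived functors *)

Lemma fmap_comp (C D E : category) (G : functor D E) (F : functor C D) (X Y : C)
    (u : hom X Y) : fmap (G ⊚ F) u = fmap G (fmap F u).
Proof. by []. Qed.

Section DerivedMaps.
Variable A : abelian.
Implicit Types X Y Z : der_plus A.

(** The image in [der_plus] of a chain map between complexes whose boundedness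
    is certified by arbitrary proofs. *)

Definition dm X Y (u : chain_map (sval X) (sval Y)) : hom X Y :=
  fmap (loc_functor (@qis A)) (u : @hom (complexes A) (sval X) (sval Y)).

Definition chain_comp (X Y Z : complex A) (v : chain_map Y Z) (u : chain_map X Y) :
  chain_map X Z := (v : @hom (complexes A) Y Z) ∘ u.

Definition chain_id (X : complex A) : chain_map X X := idm (X : complexes A).

Lemma dmM X Y Z (v : chain_map (sval Y) (sval Z)) (u : chain_map (sval X) (sval Y)) :
  @dm Y Z v ∘ @dm X Y u = @dm X Z (chain_comp v u).
Proof. exact: (esym (fmapM (loc_functor (@qis A)) _ _)). Qed.

Lemma dm1 X : @dm X X (chain_id (sval X)) = idm X.
Proof. exact: (fmap1 (loc_functor (@qis A))). Qed.

Lemma loc_dm (X Y : cx_plus A) (u : hom X Y) :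
  fmap (loc_plus A) u = @dm (loc_plus A X) (loc_plus A Y) u.
Proof. by []. Qed.

Lemma dm_eq X Y (u v : chain_map (sval X) (sval Y)) :
  (forall n, u n = v n) -> @dm X Y u = @dm X Y v.
Proof. by move=> /chain_mapP ->. Qed.

Lemma dm_iso X Y (u : chain_map (sval X) (sval Y)) : qis u -> is_iso (@dm X Y u).
Proof. exact: loc_functor_inv. Qed.

(** Bounded complexes alone determine a natural transformation [b], while [a] is given on all of
    D^+. The two agree on bounded complexes, and the morphism from an object to its truncation,
    itself a chain map, shows that they agree everywhere. *)
Lemma dm_natural (E : category) (G H : functor (der_plus A) E)
    (a : forall X, hom (G X) (H X)) :
  (forall X Y (u : chain_map (sval X) (sval Y)),
     a Y ∘ fmap G (@dm X Y u) = fmap H (@dm X Y u) ∘ a X) ->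
  forall X Y (w : hom X Y), a Y ∘ fmap G w = fmap H w ∘ a X.
Proof.
move=> aN.
have [b bE] := nat_trans_extend (fun (X Y : cx_plus A) u => aN (loc_plus A X) (loc_plus A Y) u)
  (@loc_like_loc_plus A).
suff ab X : a X = b X by move=> X Y w; rewrite !ab ntcE.
have [m hX] := svalP X.
pose Y : cx_plus A := exist _ (tge A m (sval X)) (tge_bounded m (sval X)).
have iu : is_iso (@dm X (loc_plus A Y) (to_tge m (sval X))).
  by apply: dm_iso; exact: to_tge_qis.
apply: (is_iso_mono (is_iso_fmap H iu)).
by rewrite -ntcE bE -aN.
Qed.

Lemma der_coh_dm X Y (u : chain_map (sval X) (sval Y)) n :
  fmap (der_coh A n) (@dm X Y u) = coh_map n u.
Proof. exact: (loc_lift_functor (fun U V w hw => hw n)). Qed.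

Lemma der_shift_dm X Y (u : chain_map (sval X) (sval Y)) :
  fmap (der_shift A) (@dm X Y u) = @dm (der_shift A X) (der_shift A Y) (shift_map u).
Proof.
exact: (@loc_lift_functor (complexes A) (@qis A) (der A)
  (loc_functor (@qis A) ⊚ shift A) (fun U V w hw => loc_functor_inv (qis_shift hw)) _ _ u).
Qed.

Lemma coh_shift_natural X Y (w : hom X Y) n :
  coh_shift n (sval Y) ∘ fmap (der_coh A n) (fmap (der_shift A) w)
  = fmap (der_coh A (1 + n)) w ∘ coh_shift n (sval X).
Proof.
apply: (@dm_natural _ (der_coh A n ⊚ der_shift A) (der_coh A (1 + n))
  (fun X => coh_shift n (sval X))) => {w}U V u.
by rewrite fmap_comp der_shift_dm !der_coh_dm; exact: coh_shift_nat.
Qed.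

End DerivedMaps.

Section ExactDerived.
Variables (A B : abelian) (f : additive_functor A B) (fx : exact_functor f).

Lemma der_exact_dm (X Y : der_plus A) (u : chain_map (sval X) (sval Y)) :
  fmap (der_exact fx) (@dm A X Y u)
  = @dm B (der_exact fx X) (der_exact fx Y) (cx_map_hom f u).
Proof.
exact: (@loc_lift_functor (complexes A) (@qis A) (der B)
  (loc_functor (@qis B) ⊚ cx_map f) (fun U V w hw => loc_functor_inv (exact_qis fx hw)) _ _ u).
Qed.

Definition cx_map_unshift (X : complex A) :
  chain_map (cx_map_ob f (shift_ob X)) (shift_ob (cx_map_ob f X)).
Proof.
refine (@ChainMap B (cx_map_ob f (shift_ob X)) (shift_ob (cx_map_ob f X))
  (fun n => idm _) _) => i j.
by rewrite [LHS]comp1m [RHS]compm1 /= afunN.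
Defined.

Definition der_exact_shift (X : der_plus A) :
  hom (der_exact fx (der_shift A X)) (der_shift B (der_exact fx X)) :=
  @dm B (der_exact fx (der_shift A X)) (der_shift B (der_exact fx X))
    (cx_map_unshift (sval X)).

Lemma der_exact_shift_natural (X Y : der_plus A) (w : hom X Y) :
  der_exact_shift Y ∘ fmap (der_exact fx) (fmap (der_shift A) w)
  = fmap (der_shift B) (fmap (der_exact fx) w) ∘ der_exact_shift X.
Proof.
apply: (@dm_natural _ _ (der_exact fx ⊚ der_shift A) (der_shift B ⊚ der_exact fx)
  der_exact_shift) => {w}U V u.
rewrite !fmap_comp der_shift_dm !der_exact_dm der_shift_dm !dmM.
by apply: dm_eq => n; rewrite /= comp1m compm1.
Qed.

(** Both sides are the same complex with different proofs of boundedness, so an identity chain map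
    stands in for the identity. *)
Definition der_exact_loc (X : cx_plus A) :
  hom (der_exact fx (loc_plus A X)) (loc_plus B (cx_plus_map f X)) :=
  @dm B (der_exact fx (loc_plus A X)) (loc_plus B (cx_plus_map f X)) (chain_id _).

Lemma der_exact_loc_iso (X : cx_plus A) : is_iso (der_exact_loc X).
Proof.
exists (@dm B (loc_plus B (cx_plus_map f X)) (der_exact fx (loc_plus A X)) (chain_id _)).
by split; rewrite /der_exact_loc dmM -dm1; apply: dm_eq => n; exact: comp1m.
Qed.

Lemma der_exact_loc_natural (X Y : cx_plus A) (u : hom X Y) :
  der_exact_loc Y ∘ fmap (der_exact fx) (fmap (loc_plus A) u)
  = fmap (loc_plus B) (fmap (cx_plus_map f) u) ∘ der_exact_loc X.
Proof.
rewrite !loc_dm der_exact_dm !dmM.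
by apply: dm_eq => n; rewrite /= comp1m compm1.
Qed.

End ExactDerived.

Section UnitCounit.
Variables (A B : abelian) (f : additive_functor A B) (f' : additive_functor B A).
Variable adj : adjunction f' f.

Lemma pcounit_dif (X : complex A) i j :
  adj_counit adj (X j) ∘ fmap f' (fmap f (dif X i j)) = dif X i j ∘ adj_counit adj (X i).
Proof. exact: (ntcE (adj_counit adj) (dif X i j)). Qed.

Definition pcounit (X : cx_plus A) : hom (cx_plus_map f' (cx_plus_map f X)) X :=
  @ChainMap A (cx_map f' (cx_map f (sval X))) (sval X)
    (fun n => adj_counit adj (sval X n)) (pcounit_dif (sval X)).

Lemma punit_dif (M : complex B) i j :
  adj_unit adj (M j) ∘ dif M i j = fmap f (fmap f' (dif M i j)) ∘ adj_unit adj (M i).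
Proof. exact: (ntcE (adj_unit adj) (dif M i j)). Qed.

Definition punit (M : cx_plus B) : hom M (cx_plus_map f (cx_plus_map f' M)) :=
  @ChainMap B (sval M) (cx_map f (cx_map f' (sval M)))
    (fun n => adj_unit adj (sval M n)) (punit_dif (sval M)).

Lemma punit_natural (M N : cx_plus B) (w : hom M N) :
  punit N ∘ w = fmap (cx_plus_map f) (fmap (cx_plus_map f') w) ∘ punit M.
Proof.
by apply: chain_mapP => n; exact: (ntcE (adj_unit adj) ((w : chain_map _ _) n)).
Qed.

Lemma pcounit_natural (X Y : cx_plus A) (w : hom X Y) :
  pcounit Y ∘ fmap (cx_plus_map f') (fmap (cx_plus_map f) w) = w ∘ pcounit X.
Proof.
by apply: chain_mapP => n; exact: (ntcE (adj_counit adj) ((w : chain_map _ _) n)).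
Qed.

Lemma pcounit_unit (X : cx_plus A) :
  fmap (cx_plus_map f) (pcounit X) ∘ punit (cx_plus_map f X) = idm _.
Proof. by apply: chain_mapP => n; exact: (adj_triR adj). Qed.

End UnitCounit.

Section RightDerivedTheory.
Variables (A B : abelian) (f : additive_functor A B) (Rf : right_derived f).

Definition reta (X : cx_plus A) :
  hom (loc_plus B (cx_plus_map f X)) (Rf (loc_plus A X)) := rder_eta Rf X.

Lemma reta_natural (X Y : cx_plus A) (u : hom X Y) :
  reta Y ∘ fmap (loc_plus B) (fmap (cx_plus_map f) u)
  = fmap Rf (fmap (loc_plus A) u) ∘ reta X.
Proof. exact: (ntcE (rder_eta Rf) u). Qed.

Definition rsh (X : der_plus A) :
  hom (der_shift B (Rf X)) (Rf (der_shift A X)) := rder_shift Rf X.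

Lemma rsh_natural (X Y : der_plus A) (w : hom X Y) :
  rsh Y ∘ fmap (der_shift B) (fmap Rf w) = fmap Rf (fmap (der_shift A) w) ∘ rsh X.
Proof. exact: (ntcE (rder_shift Rf) w). Qed.

Definition shift_loc (C : abelian) (X : cx_plus C) :
  hom (loc_plus C (cx_shift C X)) (der_shift C (loc_plus C X)) :=
  @dm C (loc_plus C (cx_shift C X)) (der_shift C (loc_plus C X)) (chain_id _).

Lemma rsh_eta (X : cx_plus A) :
  rsh (loc_plus A X) ∘ fmap (der_shift B) (reta X)
  = fmap Rf (shift_loc X) ∘ reta (cx_shift A X)
    ∘ @dm B (der_shift B (loc_plus B (cx_plus_map f X)))
        (loc_plus B (cx_plus_map f (cx_shift A X))) (cx_map_shift f (sval X)).
Proof.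
apply: etrans (rder_shift_eta Rf X) _.
rewrite /shift_loc (_ : dm _ = loc_plus_shift X) //.
exact: (fmap1 (loc_functor (@qis A))).
Qed.

(** The uniqueness part of [rder_univ] for unbundled families. [G] may be any functor because the
    Kan extension is absolute. *)
Lemma lan_uniq (E : category) (G : functor (der_plus B) E) (H : functor (der_plus A) E)
    (b b' : forall Y, hom (G (Rf Y)) (H Y)) :
  (forall X Y (w : hom X Y), b Y ∘ fmap G (fmap Rf w) = fmap H w ∘ b X) ->
  (forall X Y (w : hom X Y), b' Y ∘ fmap G (fmap Rf w) = fmap H w ∘ b' X) ->
  (forall X : cx_plus A, b (loc_plus A X) ∘ fmap G (reta X)
                       = b' (loc_plus A X) ∘ fmap G (reta X)) ->
  forall Y, b Y = b' Y.
Proof.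
move=> bN b'N bb'.
pose nb : nat_trans (G ⊚ Rf) H := @NatTrans _ _ (G ⊚ Rf) H b bN.
pose nb' : nat_trans (G ⊚ Rf) H := @NatTrans _ _ (G ⊚ Rf) H b' b'N.
have aN (X Y : cx_plus A) (u : hom X Y) :
    (b (loc_plus A Y) ∘ fmap G (reta Y)) ∘ fmap G (fmap (loc_plus B) (fmap (cx_plus_map f) u))
    = fmap H (fmap (loc_plus A) u) ∘ (b (loc_plus A X) ∘ fmap G (reta X)).
  by rewrite -compA -fmapM reta_natural fmapM compA bN compA.
have [c [_ cU]] := rder_univ Rf (@NatTrans _ _ (G ⊚ (loc_plus B ⊚ cx_plus_map f))
  (H ⊚ loc_plus A) (fun X => b (loc_plus A X) ∘ fmap G (reta X)) aN).
have e : nb = nb'.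
  by rewrite -(cU nb) // -(cU nb') // => X; rewrite /= -bb'.
by move=> Y; rewrite -[b Y]/(nb Y) e.
Qed.

Variables (f' : additive_functor B A) (adj : adjunction f' f) (fx : exact_functor f').

(** Absoluteness, with the derived f' as [G], reduces the construction to complexes, where the
    counit of the adjunction is applied termwise. *)
Lemma derived_counit : exists e : forall Y : der_plus A, hom (der_exact fx (Rf Y)) Y,
  (forall X Y (w : hom X Y), e Y ∘ fmap (der_exact fx) (fmap Rf w) = w ∘ e X) /\
  forall X : cx_plus A, e (loc_plus A X) ∘ fmap (der_exact fx) (reta X)
    = fmap (loc_plus A) (pcounit adj X) ∘ der_exact_loc fx (cx_plus_map f X).
Proof.
pose a X := fmap (loc_plus A) (pcounit adj X) ∘ der_exact_loc fx (cx_plus_map f X).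
have aN (X Y : cx_plus A) (u : hom X Y) :
    a Y ∘ fmap (der_exact fx) (fmap (loc_plus B) (fmap (cx_plus_map f) u))
    = fmap (loc_plus A) u ∘ a X.
  by rewrite /a -compA der_exact_loc_natural compA -fmapM pcounit_natural fmapM compA.
have [c [cE _]] := rder_univ Rf (@NatTrans _ _ (der_exact fx ⊚ (loc_plus B ⊚ cx_plus_map f))
  (id_functor (der_plus A) ⊚ loc_plus A) a aN).
exists (fun Y => c Y); split; first by move=> X Y w; exact: (ntcE c w).
exact: cE.
Qed.

(** The termwise unit followed by [reta] is natural in bounded complexes. As f' passes to D^+
    termwise, source and target are functors on D^+, and [nat_trans_extend] applies. *)
Lemma derived_unit : exists u : forall M : der_plus B, hom M (Rf (der_exact fx M)),
  (forall M N (w : hom M N), u N ∘ w = fmap Rf (fmap (der_exact fx) w) ∘ u M) /\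
  forall M : cx_plus B, fmap Rf (der_exact_loc fx M) ∘ u (loc_plus B M)
    = reta (cx_plus_map f' M) ∘ fmap (loc_plus B) (punit adj M).
Proof.
pose il M := der_exact_loc_iso fx M.
pose a (M : cx_plus B) : hom (loc_plus B M) (Rf (der_exact fx (loc_plus B M))) :=
  fmap Rf (inv_iso (il M)) ∘ (reta (cx_plus_map f' M) ∘ fmap (loc_plus B) (punit adj M)).
have aN (M N : cx_plus B) (u : hom M N) :
    a N ∘ fmap (loc_plus B) u = fmap Rf (fmap (der_exact fx) (fmap (loc_plus B) u)) ∘ a M.
  rewrite /a [RHS]compA -fmapM.
  have -> : fmap (der_exact fx) (fmap (loc_plus B) u) ∘ inv_iso (il M)
      = inv_iso (il N) ∘ fmap (loc_plus A) (fmap (cx_plus_map f') u).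
    apply: (is_iso_mono (il N)); apply: (is_iso_epi (il M)).
    rewrite !compA inv_isoKV comp1m -!compA inv_isoK compm1.
    exact: der_exact_loc_natural.
  rewrite fmapM -!compA; congr (_ ∘ _); rewrite [RHS]compA -reta_natural -compA.
  by congr (_ ∘ _); rewrite -!fmapM punit_natural.
have [b bE] := @nat_trans_extend _ _ (loc_plus B) _ (id_functor (der_plus B))
  (Rf ⊚ der_exact fx) a aN (@loc_like_loc_plus B).
exists (fun M => b M); split; first by move=> M N w; exact: (ntcE b w).
by move=> M; rewrite bE /a compA -fmapM inv_isoKV fmap1 comp1m.
Qed.

(** Uniqueness on [reta] reduces this to the termwise identity [pcounit_unit]. Its purpose is that
    every morphism M -> Rf Y is the transpose of a morphism f' M -> Y. *)
Lemma triangle (e : forall Y : der_plus A, hom (der_exact fx (Rf Y)) Y)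
    (u : forall M : der_plus B, hom M (Rf (der_exact fx M))) :
  (forall X Y (w : hom X Y), e Y ∘ fmap (der_exact fx) (fmap Rf w) = w ∘ e X) ->
  (forall X : cx_plus A, e (loc_plus A X) ∘ fmap (der_exact fx) (reta X)
    = fmap (loc_plus A) (pcounit adj X) ∘ der_exact_loc fx (cx_plus_map f X)) ->
  (forall M N (w : hom M N), u N ∘ w = fmap Rf (fmap (der_exact fx) w) ∘ u M) ->
  (forall M : cx_plus B, fmap Rf (der_exact_loc fx M) ∘ u (loc_plus B M)
    = reta (cx_plus_map f' M) ∘ fmap (loc_plus B) (punit adj M)) ->
  forall Y, fmap Rf (e Y) ∘ u (Rf Y) = idm (Rf Y).
Proof.
move=> eN eE uN uE; apply: (@lan_uniq _ (id_functor (der_plus B)) Rf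
  (fun Y => fmap Rf (e Y) ∘ u (Rf Y)) (fun Y => idm (Rf Y))).
- move=> X Y w; apply: etrans (esym (compA _ _ _)) _.
  by apply: etrans (congr1 (comp _) (uN _ _ _)) _; rewrite !compA -!fmapM eN.
- by move=> X Y w; apply: etrans (comp1m _) (esym (compm1 _)).
- move=> X; apply: etrans (esym (compA _ _ _)) _.
  apply: etrans (congr1 (comp _) (uN _ _ _)) _; apply: etrans _ (esym (comp1m _)).
  rewrite compA -fmapM eE fmapM -compA uE compA -reta_natural -compA -(fmapM (loc_plus B)).
  by rewrite pcounit_unit fmap1 compm1.
Qed.

End RightDerivedTheory.

(** * The derived tensor product and external products *)

Lemma bitmapM (C : category) (T : functor (C × C) C) (X X' X'' Y Y' Y'' : C)
    (u' : hom X' X'') (u : hom X X') (v' : hom Y' Y'') (v : hom Y Y') :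
  tmap T u' v' ∘ tmap T u v = tmap T (u' ∘ u) (v' ∘ v).
Proof. exact: (esym (fmapM T (hpair u' v') (hpair u v))). Qed.

Lemma is_iso_tmap (C : category) (T : functor (C × C) C) (X X' Y Y' : C)
    (u : hom X X') (v : hom Y Y') : is_iso u -> is_iso v -> is_iso (tmap T u v).
Proof. by move=> iu iv; apply: (is_iso_fmap T); exact: is_iso_hpair. Qed.

Section DerivedTensor.
Variables (A : tensor_abelian) (torA : finite_tor_dim A) (T : derived_tensor A).

Definition tot_plus (X Y : cx_plus A) : cx_plus A := tot_functor A (X, Y).

Definition tot_plus_map (X X' Y Y' : cx_plus A) (u : hom X X') (v : hom Y Y') :
  hom (tot_plus X Y) (tot_plus X' Y') := fmap (tot_functor A) (hpair u v).

Lemma tot_plus_mapM (X X' X'' Y Y' Y'' : cx_plus A) (u' : hom X' X'') (u : hom X X')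
    (v' : hom Y' Y'') (v : hom Y Y') :
  tot_plus_map u' v' ∘ tot_plus_map u v = tot_plus_map (u' ∘ u) (v' ∘ v).
Proof. exact: (esym (fmapM (tot_functor A) (hpair u' v') (hpair u v))). Qed.

Definition teps (X Y : cx_plus A) :
  hom (T (loc_plus A X, loc_plus A Y)) (loc_plus A (tot_plus X Y)) := dtens_eps T (X, Y).

Lemma teps_natural (X X' Y Y' : cx_plus A) (u : hom X X') (v : hom Y Y') :
  teps X' Y' ∘ tmap T (fmap (loc_plus A) u) (fmap (loc_plus A) v)
  = fmap (loc_plus A) (tot_plus_map u v) ∘ teps X Y.
Proof. exact: (ntcE (dtens_eps T) (hpair u v)). Qed.

Lemma teps_iso (X Y : cx_plus A) : flat_plus X -> flat_plus Y -> is_iso (teps X Y).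
Proof. exact: dtens_flat. Qed.

Section FlatLifting.
Variables (E : category) (G H : functor (der_plus A × der_plus A) E).
Variable R : functor (cx_plus A × cx_plus A) E.
Variable r : forall X, hom (H (loc2 A X)) (R X).
Variable s : forall X, hom (G (loc2 A X)) (R X).
Hypothesis r_iso : forall X, flat2 X -> is_iso (r X).

(** This is how morphisms into derived tensor products are built: [r] is an image of [teps] or of a
    variant of it, and [s] is what the lift has to induce on ordinary tensor products. On flat pairs
    the lift is the inverse of [r] composed with [s]; its defining equation extends to all pairs by
    naturality along flat covers. *)
Lemma flat_lifting :
  (forall X Y (u : hom X Y), r Y ∘ fmap H (fmap (loc2 A) u) = fmap R u ∘ r X) ->
  (forall X Y (u : hom X Y), s Y ∘ fmap G (fmap (loc2 A) u) = fmap R u ∘ s X) ->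
  exists2 b : forall X, hom (G X) (H X),
    forall X Y (w : hom X Y), b Y ∘ fmap G w = fmap H w ∘ b X &
    forall X, r X ∘ b (loc2 A X) = s X.
Proof.
move=> rN sN; pose a X (fX : flat2 X) := inv_iso (r_iso fX) ∘ s X.
have [P R' fP fR u|b bE] := @flat_nat_trans_extend A torA E G H a.
  rewrite /a; apply: (is_iso_mono (r_iso fR)).
  rewrite !compA inv_isoKV comp1m sN rN -!compA; congr (_ ∘ _).
  by rewrite compA inv_isoKV comp1m.
exists (fun X => b X); first by move=> X Y w; exact: ntcE.
have rb P : flat2 P -> r P ∘ b (loc2 A P) = s P.
  by move=> fP; rewrite (bE _ fP) /a compA inv_isoKV comp1m.
move=> [X Y]; have [P [p [fP tp]]] := flat_cover torA X.
have [Q [q [fQ tq]]] := flat_cover torA Y.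
have i : is_iso (fmap (loc2 A) (hpair p q)).
  exact: (is_iso_hpair (tfib_loc_plus_iso tp) (tfib_loc_plus_iso tq)).
apply: (is_iso_epi (is_iso_fmap G i)).
by rewrite -compA ntcE compA rN -compA rb // sN.
Qed.

End FlatLifting.

Lemma flat_natural_eq (E : category) (G H : functor (der_plus A × der_plus A) E)
    (a b : forall X, hom (G X) (H X)) :
  (forall X Y (w : hom X Y), a Y ∘ fmap G w = fmap H w ∘ a X) ->
  (forall X Y (w : hom X Y), b Y ∘ fmap G w = fmap H w ∘ b X) ->
  (forall P Q, flat_plus P -> flat_plus Q ->
    a (loc_plus A P, loc_plus A Q) = b (loc_plus A P, loc_plus A Q)) ->
  forall X, a X = b X.
Proof.
move=> aN bN ab X; apply: (@flat_nat_trans_eq A torA E G H (NatTrans aN) (NatTrans bN)).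
by move=> [P Q] [fP fQ]; exact: ab.
Qed.

(** The shift of the first variable for [b = true], of the second one for
    [b = false]. *)

Definition oshift (C : abelian) (b : bool) : functor (der_plus C) (der_plus C) :=
  if b then der_shift C else id_functor (der_plus C).

Definition ocx (C : abelian) (b : bool) : functor (cx_plus C) (cx_plus C) :=
  if b then cx_shift C else id_functor (cx_plus C).

Definition oloc (C : abelian) (b : bool) (X : cx_plus C) :
    hom (loc_plus C (ocx C b X)) (oshift C b (loc_plus C X)) :=
  match b with true => shift_loc X | false => idm (loc_plus C X) end.

Lemma shift_loc_natural (C : abelian) (X Y : cx_plus C) (u : hom X Y) :
  shift_loc Y ∘ fmap (loc_plus C) (fmap (cx_shift C) u)
  = fmap (der_shift C) (fmap (loc_plus C) u) ∘ shift_loc X.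
Proof.
rewrite !loc_dm der_shift_dm /shift_loc !dmM.
by apply: dm_eq => n; exact: etrans (comp1m _) (esym (compm1 _)).
Qed.

Lemma oloc_natural (C : abelian) (b : bool) (X Y : cx_plus C) (u : hom X Y) :
  oloc b Y ∘ fmap (loc_plus C) (fmap (ocx C b) u)
  = fmap (oshift C b) (fmap (loc_plus C) u) ∘ oloc b X.
Proof.
case: b; first exact: shift_loc_natural.
exact: etrans (comp1m _) (esym (compm1 _)).
Qed.

Lemma oloc_iso (C : abelian) (b : bool) (X : cx_plus C) : is_iso (oloc b X).
Proof.
case: b; last exact: is_iso1.
exists (@dm C (der_shift C (loc_plus C X)) (loc_plus C (cx_shift C X)) (chain_id _)).
rewrite [oloc _ _]/(shift_loc X) /shift_loc.
by split; rewrite dmM -dm1; apply: dm_eq => n; exact: comp1m.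
Qed.

Lemma tmapNl (X X' Y Y' : A) (u : hom X X') (v : hom Y Y') :
  (- u : hom X X') ⊗ₘ v = - (u ⊗ₘ v).
Proof. by apply/eqP; rewrite -addr_eq0 -tmapDl addNr tmap0m. Qed.

Lemma tmapNr (X X' Y Y' : A) (u : hom X X') (v : hom Y Y') :
  u ⊗ₘ (- v : hom Y Y') = - (u ⊗ₘ v).
Proof. by apply/eqP; rewrite -addr_eq0 -tmapDr addNr tmapm0. Qed.

Lemma sgn_sqr (p : int) : (-1 : int) ^+ `|p|%N * (-1) ^+ `|p|%N = 1.
Proof. by rewrite -exprD addnn -signr_odd odd_double expr0. Qed.

Lemma tot_dif_inj (X Y : cx_plus A) i j p q : p + q = i ->
  tot_dif X Y i j ∘ tot_inj X Y p q i = tot_dif_summand X Y j p q.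
Proof. by move=> e; exact: tot_descE. Qed.

Section TotalShift.
Variables X Y : cx_plus A.

Definition tot_shiftl_def n : hom (tot_ob (cx_shift A X) Y n) (tot_ob X Y (1 + n)) :=
  @tot_desc A (cx_shift A X) Y n _ (fun p q => tot_inj X Y (1 + p) q (1 + n)).

Lemma tot_shiftl_inj p q n :
  tot_shiftl_def n ∘ tot_inj (cx_shift A X) Y p q n = tot_inj X Y (1 + p) q (1 + n).
Proof.
have [e|e] := eqVneq (p + q) n; first by rewrite tot_descE.
by rewrite !tot_inj0 ?compm0 // -addrA (inj_eq (addrI _)).
Qed.

Lemma tot_shiftl_dif i j :
  tot_shiftl_def j ∘ tot_dif (cx_shift A X) Y i j
  = (- tot_dif X Y (1 + i) (1 + j) : hom (tot_ob X Y (1 + i)) (tot_ob X Y (1 + j)))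
    ∘ tot_shiftl_def i.
Proof.
apply: tot_eq => p q pq; rewrite -!compA tot_descE // tot_shiftl_inj compNm.
rewrite [RHS](_ : _ = - tot_dif_summand X Y (1 + j) (1 + p) q); last first.
  by congr (- _); apply: tot_dif_inj; rewrite -addrA pq.
rewrite /tot_dif_summand compDr comp_mulrz !compA !tot_shiftl_inj /= tmapNl compmN.
by rewrite sgn1D mulrNz opprD opprK.
Qed.

Definition tot_shiftl : chain_map (tot (cx_shift A X) Y) (shift_ob (tot X Y)) :=
  @ChainMap A (tot (cx_shift A X) Y) (shift_ob (tot X Y)) tot_shiftl_def tot_shiftl_dif.

(** The shift turns d into -d on the total complex but leaves the differential of the first factor
    alone. The factor (-1)^p, which alternates with p, supplies the missing sign of dx ⊗ y. On the
    left this is unnecessary, since there the degree of x changes parity together with the shift. *)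
Definition tot_shiftr_def n : hom (tot_ob X (cx_shift A Y) n) (tot_ob X Y (1 + n)) :=
  @tot_desc A X (cx_shift A Y) n _
    (fun p q => tot_inj X Y p (1 + q) (1 + n) *~ (-1) ^+ `|p|%N).

Lemma tot_shiftr_inj p q n :
  tot_shiftr_def n ∘ tot_inj X (cx_shift A Y) p q n
  = tot_inj X Y p (1 + q) (1 + n) *~ (-1) ^+ `|p|%N.
Proof.
have [e|e] := eqVneq (p + q) n; first by rewrite tot_descE.
by rewrite !tot_inj0 ?compm0 ?mul0rz // addrCA (inj_eq (addrI _)).
Qed.

Lemma tot_shiftr_dif i j :
  tot_shiftr_def j ∘ tot_dif X (cx_shift A Y) i j
  = (- tot_dif X Y (1 + i) (1 + j) : hom (tot_ob X Y (1 + i)) (tot_ob X Y (1 + j)))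
    ∘ tot_shiftr_def i.
Proof.
apply: tot_eq => p q pq; rewrite -!compA tot_descE // tot_shiftr_inj compNm comp_mulrz.
rewrite [RHS](_ : _ = - (tot_dif_summand X Y (1 + j) p (1 + q) *~ (-1) ^+ `|p|%N)); last first.
  by congr (- (_ *~ _)); apply: tot_dif_inj; rewrite addrCA pq.
rewrite /tot_dif_summand compDr comp_mulrz !compA !tot_shiftr_inj /= tmapNr compmN.
rewrite !mulrz_comp mulrzDl sgn1D mulrNz mulNrz opprD -!mulrzA sgn_sqr.
by congr (_ + _).
Qed.

Definition tot_shiftr : chain_map (tot X (cx_shift A Y)) (shift_ob (tot X Y)) :=
  @ChainMap A (tot X (cx_shift A Y)) (shift_ob (tot X Y)) tot_shiftr_def tot_shiftr_dif.

End TotalShift.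

Definition otot (b : bool) (X Y : cx_plus A) :
    hom (tot_plus (ocx A b X) (ocx A (~~ b) Y)) (cx_shift A (tot_plus X Y)) :=
  match b with true => tot_shiftl X Y | false => tot_shiftr X Y end.

Lemma otot_natural b (X X' Y Y' : cx_plus A) (u : hom X X') (v : hom Y Y') :
  otot b X' Y' ∘ tot_plus_map (fmap (ocx A b) u) (fmap (ocx A (~~ b)) v)
  = fmap (cx_shift A) (tot_plus_map u v) ∘ otot b X Y.
Proof.
case: b; apply: chain_mapP => n; apply: tot_eq => p q pq.
  apply: (@etrans _ _ (tot_shiftl_def X' Y' n ∘ (tot_inj (cx_shift A X') Y' p q n
      ∘ ((u : chain_map _ _) (1 + p) ⊗ₘ (v : chain_map _ _) q)))).
    apply: etrans (esym (compA _ _ _)) _; congr (_ ∘ _).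
    exact: (@tot_map_inj A (cx_shift A X) (cx_shift A X') Y Y' (shift_map u) v p q n).
  apply: (@etrans _ _ (tot_map_def u v (1 + n) ∘ tot_inj X Y (1 + p) q (1 + n))).
    apply: etrans (compA _ _ _) _; rewrite tot_shiftl_inj; exact: (esym (tot_map_inj _ _ _ _ _)).
  by apply: esym; apply: etrans (esym (compA _ _ _)) _; congr (_ ∘ _); exact: tot_shiftl_inj.
apply: (@etrans _ _ (tot_shiftr_def X' Y' n ∘ (tot_inj X' (cx_shift A Y') p q n
    ∘ ((u : chain_map _ _) p ⊗ₘ (v : chain_map _ _) (1 + q))))).
  apply: etrans (esym (compA _ _ _)) _; congr (_ ∘ _).
  exact: (@tot_map_inj A X X' (cx_shift A Y) (cx_shift A Y') u (shift_map v) p q n).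
apply: (@etrans _ _ (tot_map_def u v (1 + n) ∘ (tot_inj X Y p (1 + q) (1 + n) *~ (-1) ^+ `|p|%N))).
  apply: etrans (compA _ _ _) _; rewrite tot_shiftr_inj mulrz_comp comp_mulrz.
  by congr (_ *~ _); exact: (esym (tot_map_inj _ _ _ _ _)).
by apply: esym; apply: etrans (esym (compA _ _ _)) _; congr (_ ∘ _); exact: tot_shiftr_inj.
Qed.

(** An application of [flat_lifting], with the shifted [teps] as [r] and a morphism induced by the
    chain map [otot] as [s]. The morphisms [oloc] and [shift_loc] only mediate between different
    proofs of boundedness. *)
Lemma tensor_shift_ex b :
  exists2 t : forall X Y : der_plus A,
      hom (T (oshift A b X, oshift A (~~ b) Y)) (der_shift A (T (X, Y))),
    forall X X' Y Y' (u : hom X X') (v : hom Y Y'),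
      t X' Y' ∘ tmap T (fmap (oshift A b) u) (fmap (oshift A (~~ b)) v)
      = fmap (der_shift A) (tmap T u v) ∘ t X Y &
    forall X Y : cx_plus A,
      fmap (der_shift A) (teps X Y) ∘ t (loc_plus A X) (loc_plus A Y)
        ∘ tmap T (oloc b X) (oloc (~~ b) Y)
      = shift_loc (tot_plus X Y) ∘ fmap (loc_plus A) (otot b X Y)
        ∘ teps (ocx A b X) (ocx A (~~ b) Y).
Proof.
pose G := dtens T ⊚ prod_functor (oshift A b) (oshift A (~~ b)).
pose H := der_shift A ⊚ dtens T.
pose R := der_shift A ⊚ loc_plus A ⊚ tot_functor A.
pose r X : hom (H (loc2 A X)) (R X) := fmap (der_shift A) (teps X.1 X.2).
pose i (X : cx_plus A × cx_plus A) := is_iso_tmap T (oloc_iso b X.1) (oloc_iso (~~ b) X.2).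
pose s X : hom (G (loc2 A X)) (R X) :=
  shift_loc (tot_plus X.1 X.2) ∘ fmap (loc_plus A) (otot b X.1 X.2)
    ∘ teps (ocx A b X.1) (ocx A (~~ b) X.2) ∘ inv_iso (i X).
have iN (X Y : cx_plus A × cx_plus A) (u : hom X Y) :
    inv_iso (i Y) ∘ tmap T (fmap (oshift A b) (fmap (loc_plus A) u.1))
      (fmap (oshift A (~~ b)) (fmap (loc_plus A) u.2))
    = tmap T (fmap (loc_plus A) (fmap (ocx A b) u.1)) (fmap (loc_plus A) (fmap (ocx A (~~ b)) u.2))
      ∘ inv_iso (i X).
  apply: (is_iso_mono (i Y)); rewrite !compA inv_isoKV comp1m.
  apply: (is_iso_epi (i X)); rewrite -[RHS]compA inv_isoK compm1 !bitmapM.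
  by rewrite !oloc_natural.
have [X fX|X Y u|X Y u|t tN tE] := @flat_lifting _ G H R r s.
- apply: is_iso_fmap; case: fX => f1 f2; exact: teps_iso.
- rewrite /r /H /R !fmap_comp -[LHS]fmapM -[RHS]fmapM; congr (fmap _ _).
  exact: (teps_natural u.1 u.2).
- apply: etrans (esym (compA _ _ _)) _; apply: etrans (congr1 (comp _) (iN X Y u)) _.
  rewrite compA -[_ ∘ teps _ _ ∘ _]compA teps_natural /s !compA; congr (_ ∘ _ ∘ _).
  rewrite -!compA -fmapM otot_natural fmapM !compA; congr (_ ∘ _).
  exact: shift_loc_natural.
exists (fun X Y => t (X, Y)).
  by move=> X X' Y Y' u v; exact: (tN (X, Y) (X', Y') (hpair u v)).
move=> X Y; apply: (@etrans _ _ (s (X, Y) ∘ tmap T (oloc b X) (oloc (~~ b) Y))).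
  by congr (_ ∘ _); exact: (tE (X, Y)).
apply: etrans (esym (compA _ _ _)) _; apply: etrans _ (compm1 _); congr (_ ∘ _).
exact: (inv_isoK (i (X, Y))).
Qed.

End DerivedTensor.

(** * External products in cohomology *)

Section ExternalProducts.
Variables (A : tensor_abelian) (torA : finite_tor_dim A) (T : derived_tensor A).

(** Right exactness in each variable: [phi] descends first along [q ⊗ₘ idm Y'] and then along
    [idm Q ⊗ₘ r]. *)
Lemma bicokernel_desc (X X' Q Y Y' R Z : A) (i : hom X X') (q : hom X' Q)
    (j : hom Y Y') (r : hom Y' R) (phi : hom (X' ⊗ Y') Z) :
  is_cokernel i q -> is_cokernel j r ->
  phi ∘ (i ⊗ₘ idm Y') = 0 -> phi ∘ (idm X' ⊗ₘ j) = 0 ->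
  exists psi : hom (Q ⊗ R) Z, psi ∘ (q ⊗ₘ r) = phi.
Proof.
move=> iq jr phi1 phi2.
have [psi psiE] := cokernel_desc (@tensor_rexactl A _ _ _ Y' _ _ iq) phi1.
have psi0 : psi ∘ (idm Q ⊗ₘ j) = 0.
  apply: (@epi_tmapl A _ _ Y _ (cokernel_epi iq)).
  by rewrite comp0m -compA -tmapC compA [X in X ∘ _]psiE.
have [chi chiE] := cokernel_desc (@tensor_rexactr A _ _ _ Q _ _ jr) psi0.
exists chi; have -> : q ⊗ₘ r = (idm Q ⊗ₘ r) ∘ (q ⊗ₘ idm Y').
  by rewrite tmapM comp1m compm1.
by rewrite compA [X in X ∘ _]chiE.
Qed.

Lemma coh_product_ex (X Y : cx_plus A) p q n :
  exists m : hom (coh p (sval X) ⊗ coh q (sval Y)) (coh n (tot X Y)),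
    m ∘ (cls p (sval X) ⊗ₘ cls q (sval Y)) = cls n (tot X Y) ∘ cocyc_tensor X Y p q n.
Proof.
apply: bicokernel_desc (cokmP _) (cokmP _) _ _; rewrite -compA.
  have [e|e] := eqVneq (p + q) n; last first.
    have -> : cocyc_tensor X Y p q n = 0; last by rewrite comp0m compm0.
    by apply: cocycm_mono; rewrite cocyc_liftK tot_inj0 // comp0m compm0.
  (* For a cocycle y, the element dx ⊗ y is the differential of x ⊗ y. *)
  apply: (@cls_dif A n (tot X Y) (p - 1 + q) _ _
    (tot_inj X Y (p - 1) q (p - 1 + q) ∘ (idm _ ⊗ₘ cocycm q (sval Y)))).
  rewrite compA cocyc_liftK -compA tmapM cocycm_cobound compm1 compA.
  rewrite [dif _ _ _ ∘ _](tot_dif_inj X Y n (erefl (p - 1 + q))) /tot_dif_summand.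
  rewrite compDl mulrz_comp -!compA !tmapM dif_cocyc tmapm0 compm0 mul0rz addr0.
  by rewrite addrCA subrr addr0 comp1m compm1.
have [e|e] := eqVneq (p + q) n; last first.
  have -> : cocyc_tensor X Y p q n = 0; last by rewrite comp0m compm0.
  by apply: cocycm_mono; rewrite cocyc_liftK tot_inj0 // comp0m compm0.
(* For a cocycle x of degree p, the element x ⊗ dy is (-1)^p times the differential of x ⊗ y. *)
apply: (@cls_dif A n (tot X Y) (p + (q - 1)) _ _
  ((tot_inj X Y p (q - 1) (p + (q - 1)) ∘ (cocycm p (sval X) ⊗ₘ idm _)) *~ (-1) ^+ `|p|%N)).
rewrite compA cocyc_liftK -compA tmapM cocycm_cobound compm1 comp_mulrz compA.
rewrite [dif _ _ _ ∘ _](tot_dif_inj X Y n (erefl (p + (q - 1)))) /tot_dif_summand.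
rewrite compDl mulrz_comp -!compA !tmapM dif_cocyc tmap0m compm0 add0r.
by rewrite -mulrzA sgn_sqr mulr1z addrCA subrr addr0 comp1m compm1.
Qed.

Definition coh_product (X Y : cx_plus A) p q n :
    hom (coh p (sval X) ⊗ coh q (sval Y)) (coh n (tot X Y)) :=
  projT1 (cid (coh_product_ex X Y p q n)).

Lemma coh_productE (X Y : cx_plus A) p q n :
  coh_product X Y p q n ∘ (cls p (sval X) ⊗ₘ cls q (sval Y))
  = cls n (tot X Y) ∘ cocyc_tensor X Y p q n.
Proof. by rewrite /coh_product; case: cid. Qed.

Lemma cls_tmap_epi (X Y : complex A) p q : epi (cls p X ⊗ₘ cls q Y).
Proof. by apply: epi_tmap; exact: cls_epi. Qed.

Lemma coh_product_natural (X X' Y Y' : cx_plus A) p q n (u : hom X X') (v : hom Y Y') :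
  coh_product X' Y' p q n ∘ (coh_map p u ⊗ₘ coh_map q v)
  = coh_map n (tot_plus_map u v) ∘ coh_product X Y p q n.
Proof.
apply: cls_tmap_epi; rewrite -compA tmapM !coh_mapE -tmapM compA coh_productE.
rewrite -[RHS]compA coh_productE [RHS]compA coh_mapE -!compA; congr (_ ∘ _).
apply: cocycm_mono; rewrite !compA !cocyc_liftK -!compA cocyc_liftK tmapM !cocyc_liftK.
rewrite -tmapM !compA; congr (_ ∘ _); exact: (esym (tot_map_inj _ _ _ _ _)).
Qed.

(** [external_product] for an unbundled natural transformation. *)

Definition ext_product p q n
    (k : forall X Y : der_plus A, hom (der_coh A p X ⊗ der_coh A q Y) (der_coh A n (T (X, Y)))) :=
  (forall (X X' Y Y' : der_plus A) (u : hom X X') (v : hom Y Y'),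
     k X' Y' ∘ (fmap (der_coh A p) u ⊗ₘ fmap (der_coh A q) v)
     = fmap (der_coh A n) (tmap T u v) ∘ k X Y) /\
  (forall X Y : cx_plus A,
     fmap (der_coh A n) (teps T X Y) ∘ k (loc_plus A X) (loc_plus A Y)
     = coh_product X Y p q n).

(** On flat pairs [teps] is invertible, so the product with values in the ordinary total complex
    lifts to the derived tensor product. *)
Lemma ext_product_ex p q n : exists k, @ext_product p q n k.
Proof.
pose G := tens A ⊚ prod_functor (der_coh A p) (der_coh A q).
pose H := der_coh A n ⊚ dtens T.
pose R := der_coh A n ⊚ loc_plus A ⊚ tot_functor A.
pose r X : hom (H (loc2 A X)) (R X) := fmap (der_coh A n) (teps T X.1 X.2).
pose s X : hom (G (loc2 A X)) (R X) := coh_product X.1 X.2 p q n.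
have [X fX|X Y u|X Y u|k kN kE] := @flat_lifting A torA _ G H R r s.
- by apply: (is_iso_fmap (der_coh A n)); case: fX => f1 f2; exact: teps_iso.
- exact: etrans (esym (fmapM (der_coh A n) _ _)) (etrans
    (congr1 (fmap (der_coh A n)) (teps_natural T u.1 u.2)) (fmapM (der_coh A n) _ _)).
- have := coh_product_natural p q n u.1 u.2.
  by rewrite -!der_coh_loc.
exists (fun X Y => k (X, Y)); split.
  by move=> X X' Y Y' u v; exact: (kN (X, Y) (X', Y') (hpair u v)).
by move=> X Y; exact: (kE (X, Y)).
Qed.

Lemma coh_shift_cls (X : complex A) n :
  exists a : hom (cocyc n (shift_ob X)) (cocyc (1 + n) X),
    coh_shift n X ∘ cls n (shift_ob X) = cls (1 + n) X ∘ a /\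
    cocycm (1 + n) X ∘ a = cocycm n (shift_ob X).
Proof.
exists (cocyc_lift (coh_shift_subproof1 n X)).
by split; [exact: coh_descK | exact: cocyc_liftK].
Qed.

Lemma coh_product_shiftl (X Y : cx_plus A) p q n :
  coh_product X Y (1 + p) q (1 + n) ∘ (coh_shift p (sval X) ⊗ₘ idm (coh q (sval Y)))
  = coh_shift n (tot X Y) ∘ coh_map n (tot_shiftl X Y) ∘ coh_product (cx_shift A X) Y p q n.
Proof.
have [a [aE ma]] := coh_shift_cls (sval X) p; have [b [bE mb]] := coh_shift_cls (tot X Y) n.
apply: (@cls_tmap_epi (shift_ob (sval X)) (sval Y) p q).
rewrite -compA tmapM aE comp1m -[cls q _]compm1 -tmapM compA coh_productE.
rewrite compm1 -[RHS]compA [X in _ = _ ∘ X](coh_productE (cx_shift A X) Y p q n).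
rewrite -[RHS]compA [coh_map _ _ ∘ _]compA coh_mapE [RHS]compA [X in _ = X ∘ _]compA bE.
rewrite -!compA; congr (_ ∘ _); apply: cocycm_mono.
rewrite compA cocyc_liftK -compA tmapM ma compm1 [RHS]compA mb [RHS]compA cocyc_liftK.
by rewrite -[RHS]compA cocyc_liftK [RHS]compA tot_shiftl_inj.
Qed.

(** The sign is that of [tot_shiftr]; being its own inverse, it may stand on either side. *)
Lemma coh_product_shiftr (X Y : cx_plus A) p q n :
  coh_product X Y p (1 + q) (1 + n) ∘ (idm (coh p (sval X)) ⊗ₘ coh_shift q (sval Y))
  = (coh_shift n (tot X Y) ∘ coh_map n (tot_shiftr X Y)
      ∘ coh_product X (cx_shift A Y) p q n) *~ (-1) ^+ `|p|%N.
Proof.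
have [a [aE ma]] := coh_shift_cls (sval Y) q; have [b [bE mb]] := coh_shift_cls (tot X Y) n.
apply: (@cls_tmap_epi (sval X) (shift_ob (sval Y)) p q); rewrite mulrz_comp.
have E : coh_shift n (tot X Y) ∘ coh_map n (tot_shiftr X Y)
      ∘ coh_product X (cx_shift A Y) p q n ∘ (cls p (sval X) ⊗ₘ cls q (shift_ob (sval Y)))
    = cls (1 + n) (tot X Y)
      ∘ (b ∘ (cocyc_map n (tot_shiftr X Y) ∘ cocyc_tensor X (cx_shift A Y) p q n)).
  apply: etrans (esym (compA _ _ _)) _.
  apply: etrans (congr1 (comp _) (coh_productE X (cx_shift A Y) p q n)) _.
  by rewrite -compA [coh_map _ _ ∘ _]compA coh_mapE !compA bE.
rewrite E -compA tmapM aE comp1m -[cls p _]compm1 -tmapM compA coh_productE -compA -comp_mulrz.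
congr (_ ∘ _); apply: cocycm_mono; rewrite comp_mulrz compA cocyc_liftK -compA tmapM ma compm1.
have E' : cocycm (1 + n) (tot X Y)
      ∘ (b ∘ (cocyc_map n (tot_shiftr X Y) ∘ cocyc_tensor X (cx_shift A Y) p q n))
    = tot_shiftr_def X Y n ∘ (tot_inj X (cx_shift A Y) p q n
       ∘ (cocycm p (sval X) ⊗ₘ cocycm q (shift_ob (sval Y)))).
  by rewrite compA mb compA cocyc_liftK -compA cocyc_liftK.
rewrite E' compA tot_shiftr_inj mulrz_comp -mulrzA sgn_sqr mulr1z.
by [].
Qed.

End ExternalProducts.

(** * The derived cup product *)

Lemma afun_sign (A B : abelian) (f : additive_functor A B) (X Y : A) (u : hom X Y) m :
  fmap f (u *~ (-1) ^+ m) = fmap f u *~ (-1) ^+ m.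
Proof.
by rewrite -signr_odd; case: (odd m); rewrite ?expr1 ?expr0 ?mulr1z // !mulrN1z afunN.
Qed.

Section TotalPairing.
Variables (A B : tensor_abelian) (f g h : additive_functor A B).
Variable mu : cup_pairing (tens A) (tens B) f g h.

Definition cupm (X Y : A) : hom (f X ⊗ g Y) (h (X ⊗ Y)) := mu (X, Y).

Lemma cupm_natural (X X' Y Y' : A) (u : hom X X') (v : hom Y Y') :
  cupm X' Y' ∘ (fmap f u ⊗ₘ fmap g v) = fmap h (u ⊗ₘ v) ∘ cupm X Y.
Proof. exact: (ntcE mu (hpair u v)). Qed.

Section Objects.
Variables X Y : cx_plus A.

Definition mutot_def n : hom (tot_ob (cx_plus_map f X) (cx_plus_map g Y) n) (h (tot_ob X Y n)) :=
  @tot_desc B (cx_plus_map f X) (cx_plus_map g Y) n _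
    (fun p q => fmap h (tot_inj X Y p q n) ∘ cupm (sval X p) (sval Y q)).

Lemma mutot_inj p q n :
  mutot_def n ∘ tot_inj (cx_plus_map f X) (cx_plus_map g Y) p q n
  = fmap h (tot_inj X Y p q n) ∘ cupm (sval X p) (sval Y q).
Proof.
have [e|e] := eqVneq (p + q) n; first by rewrite tot_descE.
by rewrite !tot_inj0 // compm0 afun0 comp0m.
Qed.

Lemma mutot_dif i j :
  mutot_def j ∘ tot_dif (cx_plus_map f X) (cx_plus_map g Y) i j
  = fmap h (tot_dif X Y i j) ∘ mutot_def i.
Proof.
apply: tot_eq => p q pq; rewrite -!compA tot_descE // mutot_inj [RHS]compA -fmapM.
rewrite [tot_dif X Y i j ∘ _]tot_dif_inj // /tot_dif_summand afunD afun_sign.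
rewrite compDr comp_mulrz compDl mulrz_comp !fmapM !compA !mutot_inj -!compA.
by rewrite -!cupm_natural !fmap1.
Qed.

Definition mutot : hom (tot_plus (cx_plus_map f X) (cx_plus_map g Y)) (cx_plus_map h
  (tot_plus X Y)) :=
  @ChainMap B (tot (cx_plus_map f X) (cx_plus_map g Y)) (cx_map h (tot X Y))
    mutot_def mutot_dif.

End Objects.

Lemma mutot_natural (X X' Y Y' : cx_plus A) (u : hom X X') (v : hom Y Y') :
  mutot X' Y' ∘ tot_plus_map (fmap (cx_plus_map f) u) (fmap (cx_plus_map g) v)
  = fmap (cx_plus_map h) (tot_plus_map u v) ∘ mutot X Y.
Proof.
apply: chain_mapP => n; apply: tot_eq => p q pq.
apply: (@etrans _ _ (mutot_def X' Y' n ∘ (tot_inj (cx_plus_map f X') (cx_plus_map g Y') p q n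
   ∘ (fmap f ((u : chain_map _ _) p) ⊗ₘ fmap g ((v : chain_map _ _) q))))).
  apply: etrans (esym (compA _ _ _)) _; congr (_ ∘ _).
  exact: (@tot_map_inj B (cx_plus_map f X) (cx_plus_map f X') (cx_plus_map g Y) (cx_plus_map g Y')
    (cx_map_hom f u) (cx_map_hom g v)).
apply: (@etrans _ _ (fmap h (tot_map_def u v n) ∘ (fmap h (tot_inj X Y p q n)
  ∘ cupm (sval X p) (sval Y q)))).
  rewrite compA mutot_inj -compA cupm_natural !compA -!fmapM; congr (fmap _ _ ∘ _).
  exact: (esym (tot_map_inj _ _ _ _ _)).
by apply: esym; apply: etrans (esym (compA _ _ _)) _; congr (_ ∘ _); exact: mutot_inj.
Qed.

Variables (f' g' : additive_functor B A) (adjf : adjunction f' f) (adjg : adjunction g' g).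

Definition mpair (M N : cx_plus B) :
    hom (tot_plus M N) (cx_plus_map h (tot_plus (cx_plus_map f' M) (cx_plus_map g' N))) :=
  mutot (cx_plus_map f' M) (cx_plus_map g' N) ∘ tot_plus_map (punit adjf M) (punit adjg N).

Lemma mpair_natural (M M' N N' : cx_plus B) (u : hom M M') (v : hom N N') :
  mpair M' N' ∘ tot_plus_map u v
  = fmap (cx_plus_map h) (tot_plus_map (fmap (cx_plus_map f') u) (fmap (cx_plus_map g') v))
    ∘ mpair M N.
Proof.
rewrite /mpair -compA tot_plus_mapM !punit_natural -tot_plus_mapM compA mutot_natural.
by rewrite compA.
Qed.

(** The triangle identities recover the termwise pairing from its transpose [mpair]. For this reason
    the derived cup product induces the original pairing on complexes. *)
Lemma mpair_counit (X Y : cx_plus A) :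
  fmap (cx_plus_map h) (tot_plus_map (pcounit adjf X) (pcounit adjg Y))
    ∘ mpair (cx_plus_map f X) (cx_plus_map g Y) = mutot X Y.
Proof.
rewrite /mpair compA -mutot_natural -compA tot_plus_mapM !pcounit_unit.
rewrite [tot_plus_map _ _](_ : _ = idm _) ?compm1 //.
exact: (fmap1 (tot_functor B) (cx_plus_map f X, cx_plus_map g Y)).
Qed.

Definition unshift_plus (k : additive_functor B A) (b : bool) (M : cx_plus B) :
    hom (cx_plus_map k (ocx B b M)) (ocx A b (cx_plus_map k M)) :=
  match b with true => cx_map_unshift k (sval M) | false => idm (cx_plus_map k M) end.

Definition shift_plus (k : additive_functor A B) (X : cx_plus A) :
    hom (cx_shift B (cx_plus_map k X)) (cx_plus_map k (cx_shift A X)) :=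
  cx_map_shift k (sval X).

Definition ocast (k : additive_functor A B) (b : bool) (X : cx_plus A) :
    hom (ocx B b (cx_plus_map k X)) (cx_plus_map k (ocx A b X)) :=
  match b with true => shift_plus k X | false => idm (cx_plus_map k X) end.

Lemma ocast_unit (k : additive_functor A B) (k' : additive_functor B A)
    (adj : adjunction k' k) b (M : cx_plus B) :
  ocast k b (cx_plus_map k' M) ∘ fmap (ocx B b) (punit adj M)
  = fmap (cx_plus_map k) (unshift_plus k' b M) ∘ punit adj (ocx B b M).
Proof.
case: b; apply: chain_mapP => n.
  by apply: etrans (comp1m _) _; apply: esym; apply: etrans _ (comp1m _); congr (_ ∘ _);
    exact: fmap1.
by apply: etrans (comp1m _) _; apply: esym; apply: etrans _ (comp1m _); congr (_ ∘ _); exact: fmap1.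
Qed.

(** Both sides carry the same sign on each summand of the total complex, and [h] preserves it by
    additivity. *)
Lemma mutot_shift b (X Y : cx_plus A) :
  shift_plus h (tot_plus X Y) ∘ fmap (cx_shift B) (mutot X Y)
    ∘ otot b (cx_plus_map f X) (cx_plus_map g Y)
  = fmap (cx_plus_map h) (otot b X Y) ∘ mutot (ocx A b X) (ocx A (~~ b) Y)
    ∘ tot_plus_map (ocast f b X) (ocast g (~~ b) Y).
Proof.
case: b; apply: chain_mapP => n; apply: tot_eq => p q pq.
  apply: (@etrans _ _ (mutot_def X Y (1 + n)
      ∘ (tot_shiftl_def (cx_plus_map f X) (cx_plus_map g Y) n
        ∘ tot_inj (cx_shift B (cx_plus_map f X)) (cx_plus_map g Y) p q n))).
    by rewrite compA; congr (_ ∘ _ ∘ _); exact: comp1m.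
  rewrite tot_shiftl_inj mutot_inj.
  apply: (@etrans _ _ (fmap h (tot_shiftl_def X Y n) ∘ (mutot_def (cx_shift A X) Y n
      ∘ tot_inj (cx_plus_map f (cx_shift A X)) (cx_plus_map g Y) p q n))).
    rewrite mutot_inj compA -fmapM; congr (fmap _ _ ∘ _).
    exact: (esym (tot_shiftl_inj X Y p q n)).
  have e : tot_map_def (shift_plus f X : chain_map _ _) (chain_id (sval (cx_plus_map g Y))) n
      ∘ tot_inj (cx_shift B (cx_plus_map f X)) (cx_plus_map g Y) p q n
    = tot_inj (cx_plus_map f (cx_shift A X)) (cx_plus_map g Y) p q n.
    by rewrite tot_map_inj; apply: etrans _ (compm1 _); congr (_ ∘ _); exact: tmap1.
  by rewrite -e !compA.
apply: (@etrans _ _ (mutot_def X Y (1 + n)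
    ∘ (tot_shiftr_def (cx_plus_map f X) (cx_plus_map g Y) n
      ∘ tot_inj (cx_plus_map f X) (cx_shift B (cx_plus_map g Y)) p q n))).
  by rewrite compA; congr (_ ∘ _ ∘ _); exact: comp1m.
rewrite tot_shiftr_inj comp_mulrz mutot_inj.
apply: (@etrans _ _ (fmap h (tot_shiftr_def X Y n) ∘ (mutot_def X (cx_shift A Y) n
    ∘ tot_inj (cx_plus_map f X) (cx_plus_map g (cx_shift A Y)) p q n))).
  rewrite mutot_inj compA -fmapM -mulrz_comp -afun_sign; congr (fmap _ _ ∘ _).
  exact: (esym (tot_shiftr_inj X Y p q n)).
have e : tot_map_def (chain_id (sval (cx_plus_map f X))) (shift_plus g Y : chain_map _ _) n
    ∘ tot_inj (cx_plus_map f X) (cx_shift B (cx_plus_map g Y)) p q n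
  = tot_inj (cx_plus_map f X) (cx_plus_map g (cx_shift A Y)) p q n.
  by rewrite tot_map_inj; apply: etrans _ (compm1 _); congr (_ ∘ _); exact: tmap1.
by rewrite -e !compA.
Qed.

Lemma mpair_shift b (M N : cx_plus B) :
  shift_plus h (tot_plus (cx_plus_map f' M) (cx_plus_map g' N))
    ∘ fmap (cx_shift B) (mpair M N) ∘ otot b M N
  = fmap (cx_plus_map h) (otot b (cx_plus_map f' M) (cx_plus_map g' N)
      ∘ tot_plus_map (unshift_plus f' b M) (unshift_plus g' (~~ b) N))
    ∘ mpair (ocx B b M) (ocx B (~~ b) N).
Proof.
rewrite /mpair fmapM -!compA -otot_natural !compA mutot_shift -!compA tot_plus_mapM.
by rewrite !ocast_unit -tot_plus_mapM [mutot _ _ ∘ (_ ∘ _)]compA mutot_natural fmapM !compA.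
Qed.

End TotalPairing.

Section ShiftCompatibility.
Variables (A B : tensor_abelian) (f : additive_functor A B) (Rf : right_derived f).

Definition osig (b : bool) (X : der_plus A) :
    hom (oshift B b (Rf X)) (Rf (oshift A b X)) :=
  match b with true => rsh Rf X | false => idm (Rf X) end.

Lemma rsh_reta (X : cx_plus A) :
  rsh Rf (loc_plus A X) ∘ fmap (der_shift B) (reta Rf X) ∘ shift_loc (cx_plus_map f X)
  = fmap Rf (shift_loc X) ∘ reta Rf (cx_shift A X) ∘ fmap (loc_plus B) (shift_plus f X).
Proof.
rewrite rsh_eta -compA; congr (_ ∘ _); rewrite /shift_loc dmM.
by apply: dm_eq => n; exact: compm1.
Qed.

Variables (f' : additive_functor B A) (adj : adjunction f' f) (fx : exact_functor f').

Definition oexact (b : bool) (M : der_plus B) :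
    hom (der_exact fx (oshift B b M)) (oshift A b (der_exact fx M)) :=
  match b with true => der_exact_shift fx M | false => idm (der_exact fx M) end.

Lemma oexact_natural b (M N : der_plus B) (w : hom M N) :
  oexact b N ∘ fmap (der_exact fx) (fmap (oshift B b) w)
  = fmap (oshift A b) (fmap (der_exact fx) w) ∘ oexact b M.
Proof.
case: b; first exact: der_exact_shift_natural.
exact: etrans (comp1m _) (esym (compm1 _)).
Qed.

Lemma oexact_loc b (M : cx_plus B) :
  fmap (oshift A b) (der_exact_loc fx M) ∘ oexact b (loc_plus B M)
    ∘ fmap (der_exact fx) (oloc b M)
  = oloc b (cx_plus_map f' M) ∘ fmap (loc_plus A) (unshift_plus f' b M)
    ∘ der_exact_loc fx (ocx B b M).
Proof.
case: b.
  rewrite [oloc true M]/(shift_loc M) [oloc true _]/(shift_loc _) /shift_loc.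
  rewrite [oexact true _]/(der_exact_shift _ _) /der_exact_shift /der_exact_loc.
  rewrite [fmap (oshift A true) _](der_shift_dm (X := der_exact fx (loc_plus B M))
    (Y := loc_plus A (cx_plus_map f' M)) (chain_id _)).
  rewrite der_exact_dm loc_dm !dmM; apply: dm_eq => n.
  by rewrite /= !comp1m fmap1.
apply: etrans (congr1 (comp _) (fmap1 (der_exact fx) _)) _.
apply: etrans (compm1 _) _; apply: etrans (compm1 _) _; apply: esym.
apply: etrans (congr1 (fun z => comp z (der_exact_loc fx M)) (comp1m _)) _.
apply: etrans (congr1 (fun z => comp z (der_exact_loc fx M)) (fmap1 (loc_plus A)
  (cx_plus_map f' M))) _.
exact: comp1m.
Qed.

Variable e : forall Y : der_plus A, hom (der_exact fx (Rf Y)) Y.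
Hypothesis eN : forall X Y (w : hom X Y),
  e Y ∘ fmap (der_exact fx) (fmap Rf w) = w ∘ e X.
Hypothesis eE : forall X : cx_plus A, e (loc_plus A X) ∘ fmap (der_exact fx) (reta Rf X)
  = fmap (loc_plus A) (pcounit adj X) ∘ der_exact_loc fx (cx_plus_map f X).

Lemma pcounit_shift (X : cx_plus A) :
  fmap (cx_shift A) (pcounit adj X) ∘ unshift_plus f' true (cx_plus_map f X)
  = pcounit adj (cx_shift A X) ∘ fmap (cx_plus_map f') (shift_plus f X).
Proof.
apply: chain_mapP => n; apply: etrans (compm1 _) _; apply: esym.
apply: etrans (congr1 (comp _) (fmap1 f' _)) _; exact: compm1.
Qed.

Lemma counit_shift_reta (X : cx_plus A) :
  fmap (der_shift A) (e (loc_plus A X)) ∘ der_exact_shift fx (Rf (loc_plus A X))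
    ∘ fmap (der_exact fx) (fmap (der_shift B) (reta Rf X))
  = e (der_shift A (loc_plus A X)) ∘ fmap (der_exact fx) (rsh Rf (loc_plus A X))
    ∘ fmap (der_exact fx) (fmap (der_shift B) (reta Rf X)).
Proof.
(* Composition with this isomorphism replaces the source by the image of a bounded complex, where
   the compatibilities with [oloc] and [reta] apply. *)
have iL : is_iso (fmap (der_exact fx) (shift_loc (cx_plus_map f X))).
  by apply: is_iso_fmap; exact: (oloc_iso true).
apply: (is_iso_epi iL).
have e1 : fmap (der_shift A) (der_exact_loc fx (cx_plus_map f X))
    ∘ der_exact_shift fx (loc_plus B (cx_plus_map f X))
    ∘ fmap (der_exact fx) (shift_loc (cx_plus_map f X))
  = shift_loc (cx_plus_map f' (cx_plus_map f X))
    ∘ fmap (loc_plus A) (unshift_plus f' true (cx_plus_map f X))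
    ∘ der_exact_loc fx (cx_shift B (cx_plus_map f X)) by exact: (oexact_loc true).
have e2 := congr1 (fmap (der_exact fx)) (rsh_reta X); rewrite !fmapM in e2.
have E1 : fmap (der_shift A) (e (loc_plus A X)) ∘ der_exact_shift fx (Rf (loc_plus A X))
    ∘ fmap (der_exact fx) (fmap (der_shift B) (reta Rf X))
    ∘ fmap (der_exact fx) (shift_loc (cx_plus_map f X))
  = shift_loc X ∘ fmap (loc_plus A) (fmap (cx_shift A) (pcounit adj X)
      ∘ unshift_plus f' true (cx_plus_map f X))
    ∘ der_exact_loc fx (cx_shift B (cx_plus_map f X)).
  rewrite -[_ ∘ _ ∘ fmap _ (fmap _ (reta Rf X))]compA der_exact_shift_natural.
  rewrite [fmap _ (e _) ∘ _]compA -[fmap _ (e _) ∘ fmap _ _]fmapM eE fmapM.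
  rewrite -!compA [fmap _ (der_exact_loc _ _) ∘ _]compA e1 !compA -shift_loc_natural.
  by rewrite -[shift_loc X ∘ _ ∘ _]compA -fmapM.
apply: etrans E1 _; apply: esym.
rewrite -[_ ∘ _ ∘ fmap _ (fmap _ (reta Rf X))]compA -[_ ∘ fmap _ (shift_loc _)]compA.
rewrite [X in _ ∘ X](e2) !compA eN -[shift_loc X ∘ _ ∘ _]compA eE -!compA.
rewrite der_exact_loc_natural [fmap (loc_plus A) (pcounit _ _) ∘ _]compA -fmapM.
by rewrite pcounit_shift compA.
Qed.

(** By uniqueness on [reta] it suffices to consider complexes, where the counit acts termwise and
    commutes with the shift ([pcounit_shift]). *)
Lemma counit_shift b (X : der_plus A) :
  fmap (oshift A b) (e X) ∘ oexact b (Rf X)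
  = e (oshift A b X) ∘ fmap (der_exact fx) (osig b X).
Proof.
case: b; last first.
  apply: etrans (compm1 _) _; apply: etrans (esym (compm1 _)) _.
  by congr (_ ∘ _); exact: (esym (fmap1 (der_exact fx) _)).
move: X; apply: (@lan_uniq A B f Rf _ (der_exact fx ⊚ der_shift B) (der_shift A)
  (fun X => fmap (der_shift A) (e X) ∘ der_exact_shift fx (Rf X))
  (fun X => e (der_shift A X) ∘ fmap (der_exact fx) (rsh Rf X))).
- move=> X Y w; rewrite fmap_comp -compA der_exact_shift_natural !compA -!fmapM.
  by rewrite eN.
- move=> X Y w; have e1 := congr1 (fmap (der_exact fx)) (rsh_natural Rf w).
  rewrite !fmapM in e1; apply: etrans (esym (compA _ _ _)) _.
  by apply: etrans (congr1 (comp _) e1) _; rewrite compA eN -compA.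
- by move=> X; exact: counit_shift_reta.
Qed.

End ShiftCompatibility.

Section DerivedCup.
Variables (A B : tensor_abelian) (torA : finite_tor_dim A) (torB : finite_tor_dim B).
Variables (TA : derived_tensor A) (TB : derived_tensor B).
Variables (f g h : additive_functor A B).
Variables (Rf : right_derived f) (Rg : right_derived g) (Rh : right_derived h).
Variable mu : cup_pairing (tens A) (tens B) f g h.
Variables (f' g' : additive_functor B A) (adjf : adjunction f' f) (adjg : adjunction g' g).
Variables (fx : exact_functor f') (gx : exact_functor g').
Hypothesis flatf : forall P, flat P -> flat (f' P).
Hypothesis flatg : forall P, flat P -> flat (g' P).

Definition teps_exact (M N : cx_plus B) :
    hom (TA (der_exact fx (loc_plus B M), der_exact gx (loc_plus B N)))
        (loc_plus A (tot_plus (cx_plus_map f' M) (cx_plus_map g' N))) :=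
  teps TA (cx_plus_map f' M) (cx_plus_map g' N)
    ∘ tmap TA (der_exact_loc fx M) (der_exact_loc gx N).

Lemma teps_exactE (M N : cx_plus B) : teps_exact M N =
  teps TA (cx_plus_map f' M) (cx_plus_map g' N)
    ∘ tmap TA (der_exact_loc fx M) (der_exact_loc gx N).
Proof. by []. Qed.

Lemma teps_exact_natural (M M' N N' : cx_plus B) (u : hom M M') (v : hom N N') :
  teps_exact M' N' ∘ tmap TA (fmap (der_exact fx) (fmap (loc_plus B) u))
      (fmap (der_exact gx) (fmap (loc_plus B) v))
  = fmap (loc_plus A) (tot_plus_map (fmap (cx_plus_map f') u) (fmap (cx_plus_map g') v))
    ∘ teps_exact M N.
Proof.
rewrite /teps_exact -compA bitmapM !der_exact_loc_natural -bitmapM compA.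
by rewrite teps_natural compA.
Qed.

(** This is where preservation of flatness enters: f' M and g' N are again complexes of flat
    objects. *)
Lemma teps_exact_iso (M N : cx_plus B) :
  flat_plus M -> flat_plus N -> is_iso (teps_exact M N).
Proof.
move=> fM fN; apply: is_isoM.
  by apply: teps_iso => n; [apply: flatf; exact: fM | apply: flatg; exact: fN].
by apply: is_iso_tmap; exact: der_exact_loc_iso.
Qed.

(* The derived version of M ⊗ N -> f f'M ⊗ g g'N -> h (f'M ⊗ g'N). *)
Lemma derived_pair_ex :
  exists2 ps : forall M N : der_plus B,
      hom (TB (M, N)) (Rh (TA (der_exact fx M, der_exact gx N))),
    forall M M' N N' (u : hom M M') (v : hom N N'),
      ps M' N' ∘ tmap TB u v
      = fmap Rh (tmap TA (fmap (der_exact fx) u) (fmap (der_exact gx) v)) ∘ ps M N &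
    forall M N : cx_plus B,
      fmap Rh (teps_exact M N) ∘ ps (loc_plus B M) (loc_plus B N)
      = reta Rh (tot_plus (cx_plus_map f' M) (cx_plus_map g' N))
        ∘ fmap (loc_plus B) (mpair mu adjf adjg M N) ∘ teps TB M N.
Proof.
pose G : functor (der_plus B × der_plus B) (der_plus B) := TB.
pose H := Rh ⊚ dtens TA ⊚ prod_functor (der_exact fx) (der_exact gx).
pose R := Rh ⊚ loc_plus A ⊚ tot_functor A ⊚ prod_functor (cx_plus_map f') (cx_plus_map g').
pose r X : hom (H (loc2 B X)) (R X) := fmap Rh (teps_exact X.1 X.2).
pose s X : hom (G (loc2 B X)) (R X) :=
  reta Rh (tot_plus (cx_plus_map f' X.1) (cx_plus_map g' X.2))
    ∘ fmap (loc_plus B) (mpair mu adjf adjg X.1 X.2) ∘ teps TB X.1 X.2.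
have [X fX|X Y u|X Y u|t tN tE] := @flat_lifting B torB _ G H R r s.
- by apply: (is_iso_fmap Rh); case: fX => f1 f2; exact: teps_exact_iso.
- exact: etrans (esym (fmapM Rh _ _)) (etrans
    (congr1 (fmap Rh) (teps_exact_natural u.1 u.2)) (fmapM Rh _ _)).
- apply: etrans (esym (compA _ _ _)) _.
  apply: etrans (congr1 (comp _) (teps_natural TB u.1 u.2)) _.
  rewrite compA -[_ ∘ _ ∘ fmap _ (tot_plus_map _ _)]compA -fmapM mpair_natural fmapM.
  by rewrite compA reta_natural /s !compA.
exists (fun M N => t (M, N)).
  by move=> M M' N N' u v; exact: (tN (M, N) (M', N') (hpair u v)).
by move=> M N; exact: (tE (M, N)).
Qed.

Variable ef : forall Y : der_plus A, hom (der_exact fx (Rf Y)) Y.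
Variable eg : forall Y : der_plus A, hom (der_exact gx (Rg Y)) Y.
Hypothesis efN : forall X Y (w : hom X Y),
  ef Y ∘ fmap (der_exact fx) (fmap Rf w) = w ∘ ef X.
Hypothesis egN : forall X Y (w : hom X Y),
  eg Y ∘ fmap (der_exact gx) (fmap Rg w) = w ∘ eg X.
Hypothesis efE : forall X : cx_plus A, ef (loc_plus A X) ∘ fmap (der_exact fx) (reta Rf X)
  = fmap (loc_plus A) (pcounit adjf X) ∘ der_exact_loc fx (cx_plus_map f X).
Hypothesis egE : forall X : cx_plus A, eg (loc_plus A X) ∘ fmap (der_exact gx) (reta Rg X)
  = fmap (loc_plus A) (pcounit adjg X) ∘ der_exact_loc gx (cx_plus_map g X).

Variable ps : forall M N : der_plus B,
      hom (TB (M, N)) (Rh (TA (der_exact fx M, der_exact gx N))).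
Hypothesis psN : forall M M' N N' (u : hom M M') (v : hom N N'),
  ps M' N' ∘ tmap TB u v
  = fmap Rh (tmap TA (fmap (der_exact fx) u) (fmap (der_exact gx) v)) ∘ ps M N.
Hypothesis psE : forall M N : cx_plus B,
  fmap Rh (teps_exact M N) ∘ ps (loc_plus B M) (loc_plus B N)
  = reta Rh (tot_plus (cx_plus_map f' M) (cx_plus_map g' N))
    ∘ fmap (loc_plus B) (mpair mu adjf adjg M N) ∘ teps TB M N.

Definition dcup (X Y : der_plus A) : hom (TB (Rf X, Rg Y)) (Rh (TA (X, Y))) :=
  fmap Rh (tmap TA (ef X) (eg Y)) ∘ ps (Rf X) (Rg Y).

Lemma dcup_natural (X X' Y Y' : der_plus A) (u : hom X X') (v : hom Y Y') :
  dcup X' Y' ∘ tmap TB (fmap Rf u) (fmap Rg v) = fmap Rh (tmap TA u v) ∘ dcup X Y.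
Proof.
by rewrite /dcup -compA psN !compA -!(fmapM Rh) !bitmapM efN egN.
Qed.

(** On complexes the derived counits become termwise ones, and [mpair_counit] turns the transposed
    pairing back into [mutot]. The property for r = s = 0 is derived from this equation. *)
Lemma dcup_reta (X Y : cx_plus A) :
  fmap Rh (teps TA X Y) ∘ dcup (loc_plus A X) (loc_plus A Y)
    ∘ tmap TB (reta Rf X) (reta Rg Y)
  = reta Rh (tot_plus X Y) ∘ fmap (loc_plus B) (mutot mu X Y)
    ∘ teps TB (cx_plus_map f X) (cx_plus_map g Y).
Proof.
rewrite /dcup -!compA psN !compA -!(fmapM Rh) -!compA bitmapM efE egE -bitmapM.
rewrite compA teps_natural -compA -teps_exactE fmapM -compA psE.
rewrite !compA -reta_natural -(mpair_counit mu adjf adjg) -[reta _ _ ∘ _ ∘ _]compA.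
by rewrite -fmapM.
Qed.

Variable b : bool.
Variable tA : forall X Y : der_plus A,
  hom (TA (oshift A b X, oshift A (~~ b) Y)) (der_shift A (TA (X, Y))).
Variable tB : forall X Y : der_plus B,
  hom (TB (oshift B b X, oshift B (~~ b) Y)) (der_shift B (TB (X, Y))).
Hypothesis tAN : forall X X' Y Y' (u : hom X X') (v : hom Y Y'),
  tA X' Y' ∘ tmap TA (fmap (oshift A b) u) (fmap (oshift A (~~ b)) v)
  = fmap (der_shift A) (tmap TA u v) ∘ tA X Y.
Hypothesis tBN : forall X X' Y Y' (u : hom X X') (v : hom Y Y'),
  tB X' Y' ∘ tmap TB (fmap (oshift B b) u) (fmap (oshift B (~~ b)) v)
  = fmap (der_shift B) (tmap TB u v) ∘ tB X Y.
Hypothesis tAE : forall X Y : cx_plus A,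
  fmap (der_shift A) (teps TA X Y) ∘ tA (loc_plus A X) (loc_plus A Y)
    ∘ tmap TA (oloc b X) (oloc (~~ b) Y)
  = shift_loc (tot_plus X Y) ∘ fmap (loc_plus A) (otot b X Y)
    ∘ teps TA (ocx A b X) (ocx A (~~ b) Y).
Hypothesis tBE : forall X Y : cx_plus B,
  fmap (der_shift B) (teps TB X Y) ∘ tB (loc_plus B X) (loc_plus B Y)
    ∘ tmap TB (oloc b X) (oloc (~~ b) Y)
  = shift_loc (tot_plus X Y) ∘ fmap (loc_plus B) (otot b X Y)
    ∘ teps TB (ocx B b X) (ocx B (~~ b) Y).

(** Composed with the isomorphisms [teps_exact] and [oloc], both sides become [reta] together with a
    chain map and [teps]. The two chain maps are equal by [mpair_shift]. *)
Lemma derived_pair_shift_loc (M N : cx_plus B) : flat_plus M -> flat_plus N ->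
  rsh Rh _ ∘ fmap (der_shift B) (ps (loc_plus B M) (loc_plus B N))
    ∘ tB (loc_plus B M) (loc_plus B N)
  = fmap Rh (tA (der_exact fx (loc_plus B M)) (der_exact gx (loc_plus B N))
      ∘ tmap TA (oexact fx b (loc_plus B M)) (oexact gx (~~ b) (loc_plus B N)))
    ∘ ps (oshift B b (loc_plus B M)) (oshift B (~~ b) (loc_plus B N)).
Proof.
move=> fM fN; set M0 := loc_plus B M; set N0 := loc_plus B N.
have ie : is_iso (fmap Rh (fmap (der_shift A) (teps_exact M N))).
  by do 2!apply: is_iso_fmap; exact: teps_exact_iso.
have io : is_iso (tmap TB (oloc b M) (oloc (~~ b) N)).
  by apply: is_iso_tmap; exact: oloc_iso.
apply: (is_iso_mono ie); apply: (is_iso_epi io).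
pose X := cx_plus_map f' M; pose Y := cx_plus_map g' N.
have EL : fmap Rh (fmap (der_shift A) (teps_exact M N))
    ∘ (rsh Rh _ ∘ fmap (der_shift B) (ps M0 N0) ∘ tB M0 N0)
    ∘ tmap TB (oloc b M) (oloc (~~ b) N)
  = fmap Rh (shift_loc (tot_plus X Y)) ∘ reta Rh (cx_shift A (tot_plus X Y))
    ∘ fmap (loc_plus B) (shift_plus h (tot_plus X Y)
        ∘ fmap (cx_shift B) (mpair mu adjf adjg M N) ∘ otot b M N)
    ∘ teps TB (ocx B b M) (ocx B (~~ b) N).
  rewrite !compA -rsh_natural -[rsh _ _ ∘ _ ∘ _]compA -fmapM psE !fmapM !compA.
  rewrite -!compA [fmap (der_shift B) (teps TB M N) ∘ _]compA tBE !compA.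
  do 2!rewrite -[_ ∘ fmap _ (fmap (loc_plus B) _) ∘ shift_loc _]compA -shift_loc_natural !compA.
  by rewrite rsh_reta.
have ER : fmap Rh (fmap (der_shift A) (teps_exact M N))
    ∘ (fmap Rh (tA (der_exact fx M0) (der_exact gx N0)
        ∘ tmap TA (oexact fx b M0) (oexact gx (~~ b) N0))
       ∘ ps (oshift B b M0) (oshift B (~~ b) N0))
    ∘ tmap TB (oloc b M) (oloc (~~ b) N)
  = fmap Rh (shift_loc (tot_plus X Y)) ∘ reta Rh (cx_shift A (tot_plus X Y))
    ∘ fmap (loc_plus B) (fmap (cx_plus_map h) (otot b X Y
        ∘ tot_plus_map (unshift_plus f' b M) (unshift_plus g' (~~ b) N))
      ∘ mpair mu adjf adjg (ocx B b M) (ocx B (~~ b) N))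
    ∘ teps TB (ocx B b M) (ocx B (~~ b) N).
  rewrite -!compA psN !compA -!fmapM -!compA !bitmapM teps_exactE.
  rewrite [fmap (der_shift A) _]fmapM -!compA [fmap _ (tmap _ _ _) ∘ _]compA -tAN.
  rewrite -!compA bitmapM !compA !oexact_loc -!bitmapM !compA tAE.
  rewrite -[_ ∘ teps _ _ _ ∘ _]compA teps_natural !compA -[_ ∘ teps _ _ _ ∘ _]compA.
  rewrite -teps_exactE [fmap Rh (_ ∘ teps_exact _ _)]fmapM -[LHS]compA psE.
  rewrite !fmapM !compA -[_ ∘ _ ∘ reta _ _]compA -fmapM -reta_natural.
  by rewrite !fmapM !compA -[_ ∘ fmap Rh _ ∘ reta _ _]compA -reta_natural !compA.
by rewrite EL ER mpair_shift.
Qed.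

Lemma derived_pair_shift (M N : der_plus B) :
  rsh Rh _ ∘ fmap (der_shift B) (ps M N) ∘ tB M N
  = fmap Rh (tA (der_exact fx M) (der_exact gx N) ∘ tmap TA (oexact fx b M) (oexact gx (~~ b) N))
    ∘ ps (oshift B b M) (oshift B (~~ b) N).
Proof.
pose G := dtens TB ⊚ prod_functor (oshift B b) (oshift B (~~ b)).
pose H := Rh ⊚ der_shift A ⊚ dtens TA ⊚ prod_functor (der_exact fx) (der_exact gx).
apply: (@flat_natural_eq B torB _ G H
  (fun X => rsh Rh _ ∘ fmap (der_shift B) (ps X.1 X.2) ∘ tB X.1 X.2)
  (fun X => fmap Rh (tA (der_exact fx X.1) (der_exact gx X.2)
      ∘ tmap TA (oexact fx b X.1) (oexact gx (~~ b) X.2))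
    ∘ ps (oshift B b X.1) (oshift B (~~ b) X.2)) _ _ _ (M, N)).
- move=> X Y w; apply: etrans (esym (compA _ _ _)) _.
  apply: etrans (congr1 (comp _) (tBN w.1 w.2)) _.
  rewrite compA -[_ ∘ _ ∘ fmap _ (tmap _ _ _)]compA -fmapM psN fmapM !compA.
  by rewrite rsh_natural.
- move=> X Y w; apply: etrans (esym (compA _ _ _)) _.
  apply: etrans (congr1 (comp _) (psN (fmap (oshift B b) w.1) (fmap (oshift B (~~ b)) w.2))) _.
  rewrite compA -(fmapM Rh) -compA bitmapM !oexact_natural -bitmapM compA tAN.
  by rewrite -compA fmapM -compA.
- by move=> P Q; exact: derived_pair_shift_loc.
Qed.

(** The transposed pairing commutes with the shift by [derived_pair_shift], and the counits by
    [counit_shift]. No sign is visible, since for [b = false] it is contained in [tA] and [tB]. *)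
Lemma dcup_shift (X Y : der_plus A) :
  rsh Rh (TA (X, Y)) ∘ fmap (der_shift B) (dcup X Y) ∘ tB (Rf X) (Rg Y)
  = fmap Rh (tA X Y) ∘ dcup (oshift A b X) (oshift A (~~ b) Y)
    ∘ tmap TB (osig Rf b X) (osig Rg (~~ b) Y).
Proof.
rewrite /dcup fmapM !compA rsh_natural -!compA [rsh _ _ ∘ _]compA derived_pair_shift psN.
rewrite !compA -!(fmapM Rh) !compA -tAN -!compA !bitmapM.
rewrite (counit_shift efN efE) (counit_shift egN egE).
by [].
Qed.

End DerivedCup.

(** * Connecting morphisms and tensor products *)

Section ConeTensor.
Variables (A : tensor_abelian) (X Y Z : A) (i : hom X Y).

Lemma cone_bounded : bounded (cone i).
Proof. by exists (-1) => -[[|n]|[|n]] // _; exact: zero_obP. Qed.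

Definition cone_plus : cx_plus A := exist _ (cone i) cone_bounded.

Lemma tot_single_inj (U V : A) p q n :
  tot_single_def U V n ∘ tot_inj (single A U) (single A V) p q n = tot_single_summand U V n p q.
Proof.
have [e|e] := eqVneq (p + q) n; first exact: tot_descE.
rewrite tot_inj0 // compm0.
by case: p q n e => [[|p]|p] [[|q]|q] [[|n]|n].
Qed.

(** The tensor product with [Z] commutes with the cone. As the cone lives in degrees -1 and 0 and
    [Z] in degree 0, only two summands are nonzero, and matching on the degrees spares transports.
    There is no sign on the other side either, since [Z] sits in degree 0. *)
Definition cone_tensl_summand (n p q : int) :
    hom (cone_ob X Y p ⊗ single_cx_ob Z q) (cone_ob (X ⊗ Z) (Y ⊗ Z) n) :=
  match p as p0, q as q0, n as n0 return
    hom (cone_ob X Y p0 ⊗ single_cx_ob Z q0) (cone_ob (X ⊗ Z) (Y ⊗ Z) n0) with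
  | Negz 0, Posz 0, Negz 0 => idm (X ⊗ Z)
  | Posz 0, Posz 0, Posz 0 => idm (Y ⊗ Z)
  | _, _, _ => 0
  end.

Definition cone_tensl_def n :
    hom (tot_ob cone_plus (single A Z) n) (cone_ob (X ⊗ Z) (Y ⊗ Z) n) :=
  @tot_desc A cone_plus (single A Z) n _ (cone_tensl_summand n).

Lemma cone_tensl_inj p q n :
  cone_tensl_def n ∘ tot_inj cone_plus (single A Z) p q n = cone_tensl_summand n p q.
Proof.
have [e|e] := eqVneq (p + q) n; first exact: tot_descE.
rewrite tot_inj0 // compm0.
by case: p q n e => [[|p]|[|p]] [[|q]|q] [[|n]|[|n]].
Qed.

Lemma cone_tensl_dif k l :
  cone_tensl_def l ∘ tot_dif cone_plus (single A Z) k l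
  = cone_dif (i ⊗ₘ idm Z) k l ∘ cone_tensl_def k.
Proof.
apply: tot_eq => p q pq; rewrite -[LHS]compA tot_dif_inj // -[RHS]compA cone_tensl_inj.
rewrite /tot_dif_summand tmapm0 compm0 mul0rz addr0 compA cone_tensl_inj.
rewrite -pq; case: p {pq} => [[|p]|[|p]].
- rewrite [dif _ _ _](_ : _ = 0) // tmap0m compm0.
  by case: q l => [[|q]|q] [[|l]|[|l]]; rewrite /= ?comp0m ?compm0.
- by rewrite [dif _ _ _](_ : _ = 0) // tmap0m !compm0.
- case: q => [[|q]|q].
  + by case: l => [[|l]|[|l]]; rewrite /= ?comp0m ?comp1m ?compm1.
  + by rewrite /= comp0m compm0.
  + by rewrite /= comp0m compm0.
- by rewrite [dif _ _ _](_ : _ = 0) // tmap0m !compm0.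
Qed.

Definition cone_tensl : chain_map (tot cone_plus (single A Z)) (cone (i ⊗ₘ idm Z)) :=
  @ChainMap A (tot cone_plus (single A Z)) (cone (i ⊗ₘ idm Z)) cone_tensl_def cone_tensl_dif.

Definition cone_tensr_summand (n p q : int) :
    hom (single_cx_ob Z p ⊗ cone_ob X Y q) (cone_ob (Z ⊗ X) (Z ⊗ Y) n) :=
  match p as p0, q as q0, n as n0 return
    hom (single_cx_ob Z p0 ⊗ cone_ob X Y q0) (cone_ob (Z ⊗ X) (Z ⊗ Y) n0) with
  | Posz 0, Negz 0, Negz 0 => idm (Z ⊗ X)
  | Posz 0, Posz 0, Posz 0 => idm (Z ⊗ Y)
  | _, _, _ => 0
  end.

Definition cone_tensr_def n :
    hom (tot_ob (single A Z) cone_plus n) (cone_ob (Z ⊗ X) (Z ⊗ Y) n) :=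
  @tot_desc A (single A Z) cone_plus n _ (cone_tensr_summand n).

Lemma cone_tensr_inj p q n :
  cone_tensr_def n ∘ tot_inj (single A Z) cone_plus p q n = cone_tensr_summand n p q.
Proof.
have [e|e] := eqVneq (p + q) n; first exact: tot_descE.
rewrite tot_inj0 // compm0.
by case: p q n e => [[|p]|p] [[|q]|[|q]] [[|n]|[|n]].
Qed.

Lemma cone_tensr_dif k l :
  cone_tensr_def l ∘ tot_dif (single A Z) cone_plus k l
  = cone_dif (idm Z ⊗ₘ i) k l ∘ cone_tensr_def k.
Proof.
apply: tot_eq => p q pq; rewrite -[LHS]compA tot_dif_inj // -[RHS]compA cone_tensr_inj.
rewrite /tot_dif_summand tmap0m compm0 add0r comp_mulrz compA cone_tensr_inj.
rewrite -pq; case: p {pq} => [[|p]|p].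
- rewrite expr0 mulr1z add0r; case: q => [[|q]|[|q]].
  + rewrite [dif _ _ _](_ : _ = 0) // tmapm0 compm0.
    by case: l => [[|l]|[|l]]; rewrite /= ?comp0m ?compm0.
  + by rewrite [dif _ _ _](_ : _ = 0) // tmapm0 !compm0.
  + by case: l => [[|l]|[|l]]; rewrite /= ?comp0m ?comp1m ?compm1.
  + by rewrite [dif _ _ _](_ : _ = 0) // tmapm0 !compm0.
- by rewrite /= comp0m compm0 mul0rz.
- by rewrite /= comp0m compm0 mul0rz.
Qed.

Definition cone_tensr : chain_map (tot (single A Z) cone_plus) (cone (idm Z ⊗ₘ i)) :=
  @ChainMap A (tot (single A Z) cone_plus) (cone (idm Z ⊗ₘ i)) cone_tensr_def cone_tensr_dif.

End ConeTensor.

Section ConnectingTensor.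
Variables (A : tensor_abelian) (X Y Z V : A) (i : hom X Y) (p : hom Y Z).

Definition cone_shift_plus (U W : A) (j : hom U W) : hom (cone_plus j) (cx_shift A (single A U)) :=
  cone_shift j.

Definition cone_single_plus (U W T : A) (j : hom U W) (q : hom W T) (jq : short_exact j q) :
  hom (cone_plus j) (single A T) := cone_single jq.1.1.

Lemma cone_single_iso (U W T : A) (j : hom U W) (q : hom W T) (jq : short_exact j q) :
  is_iso (fmap (loc_plus A) (cone_single_plus jq)).
Proof. exact: loc_functor_inv (cone_qis jq). Qed.

(** The isomorphism from the cone cancels the formal inverse in the connecting morphism, and a chain
    map remains. *)
Lemma der_connecting_cone (U W T : A) (j : hom U W) (q : hom W T) (jq : short_exact j q) :
  der_connecting jq ∘ fmap (loc_plus A) (cone_single_plus jq)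
  = shift_loc (single A U) ∘ fmap (loc_plus A) (cone_shift_plus j).
Proof.
apply: (@etrans _ _ (fmap (loc_functor (@qis A)) (cone_shift j : @hom (complexes A) _ _))).
  apply: etrans (esym (@compA (der A) _ _ _ _ _ _ _)) _.
  by apply: etrans (congr1 (@comp (der A) _ _ _ _) (loc_invK _)) (@compm1 (der A) _ _ _).
apply: esym; apply: etrans (congr1 (fun z => comp z _) (fmap1 (loc_functor (@qis A)) _)) _.
exact: (@comp1m (der A)).
Qed.

Lemma cone_shift_tensl :
  fmap (cx_shift A) (tot_single X V) ∘ otot true (single A X) (single A V)
    ∘ tot_plus_map (cone_shift_plus i) (idm (single A V))
  = cone_shift_plus (i ⊗ₘ idm V)
    ∘ (cone_tensl V i : @hom (cx_plus A) (tot_plus (cone_plus i) (single A V)) (cone_plus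
      (i ⊗ₘ idm V))).
Proof.
apply: chain_mapP => n; apply: tot_eq => k l kl.
have E : tot_single_def X V (1 + n) ∘ (tot_shiftl_def (single A X) (single A V) n
    ∘ (tot_inj (cx_shift A (single A X)) (single A V) k l n
       ∘ (cone_shift i k ⊗ₘ (chain_id (single_cx V)) l)))
  = cone_shift (i ⊗ₘ idm V) n ∘ (cone_tensl_def V i n ∘ tot_inj (cone_plus i) (single A V) k l n).
  rewrite cone_tensl_inj [tot_shiftl_def _ _ _ ∘ _]compA tot_shiftl_inj compA tot_single_inj -kl.
  case: k {kl} => [[|k]|[|k]].
  - by rewrite tmap0m compm0; case: l => [[|l]|l]; rewrite /= ?comp0m ?compm0.
  - by rewrite tmap0m !compm0.
  - case: l => [[|l]|l]; rewrite /= ?comp0m ?compm0 //.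
    by rewrite tmapNl tmap1 comp1m compm1.
  - by rewrite tmap0m !compm0.
apply: etrans _ (etrans E _); last by rewrite compA.
rewrite -[in RHS](tot_map_inj (X := cone_plus i) (X' := cx_shift A (single A X))
  (Y := single A V) (Y' := single A V) (cone_shift i) (chain_id (single_cx V)) k l n).
by rewrite !compA.
Qed.

Lemma cone_single_tensl (ip : short_exact i p) (ipV : short_exact (i ⊗ₘ idm V) (p ⊗ₘ idm V)) :
  (tot_single Z V : hom (tot_plus _ _) _) ∘ tot_plus_map (cone_single_plus ip) (idm (single A V))
  = cone_single_plus ipV ∘ (cone_tensl V i
    : @hom (cx_plus A) (tot_plus (cone_plus i) (single A V)) (cone_plus (i ⊗ₘ idm V))).
Proof.
apply: chain_mapP => n; apply: tot_eq => k l kl.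
have E : tot_single_def Z V n ∘ (tot_inj (single A Z) (single A V) k l n
       ∘ (cone_single ip.1.1 k ⊗ₘ (chain_id (single_cx V)) l))
  = cone_single ipV.1.1 n ∘ (cone_tensl_def V i n ∘ tot_inj (cone_plus i) (single A V) k l n).
  rewrite cone_tensl_inj compA tot_single_inj -kl.
  case: k {kl} => [[|k]|[|k]].
  - case: l => [[|l]|l]; rewrite /= ?comp0m ?compm0 //.
    by rewrite comp1m compm1.
  - by rewrite tmap0m !compm0.
  - by rewrite tmap0m compm0; case: l => [[|l]|l]; rewrite /= ?comp0m ?compm0.
  - by rewrite tmap0m !compm0.
apply: etrans _ (etrans E _); last by rewrite compA.
rewrite -[in RHS](tot_map_inj (X := cone_plus i) (X' := single A Z) (Y := single A V)
  (Y' := single A V) (cone_single ip.1.1) (chain_id (single_cx V)) k l n).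
by rewrite !compA.
Qed.

Lemma cone_shift_tensr :
  fmap (cx_shift A) (tot_single V X) ∘ otot false (single A V) (single A X)
    ∘ tot_plus_map (idm (single A V)) (cone_shift_plus i)
  = cone_shift_plus (idm V ⊗ₘ i)
    ∘ (cone_tensr V i : @hom (cx_plus A) (tot_plus (single A V) (cone_plus i)) (cone_plus
      (idm V ⊗ₘ i))).
Proof.
apply: chain_mapP => n; apply: tot_eq => k l kl.
have E : tot_single_def V X (1 + n) ∘ (tot_shiftr_def (single A V) (single A X) n
    ∘ (tot_inj (single A V) (cx_shift A (single A X)) k l n
       ∘ ((chain_id (single_cx V)) k ⊗ₘ cone_shift i l)))
  = cone_shift (idm V ⊗ₘ i) n ∘ (cone_tensr_def V i n ∘ tot_inj (single A V) (cone_plus i) k l n).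
  rewrite cone_tensr_inj [tot_shiftr_def _ _ _ ∘ _]compA tot_shiftr_inj mulrz_comp comp_mulrz.
  rewrite compA tot_single_inj -kl.
  case: l {kl} => [[|l]|[|l]].
  - by rewrite tmapm0 compm0 mul0rz; case: k => [[|k]|k]; rewrite /= ?comp0m ?compm0.
  - by rewrite tmapm0 !compm0 mul0rz; case: k => [[|k]|k]; rewrite /= ?compm0.
  - case: k => [[|k]|k]; rewrite /= ?comp0m ?compm0 ?mul0rz //.
    by rewrite expr0 mulr1z tmapNr tmap1 comp1m compm1.
  - by rewrite tmapm0 !compm0 mul0rz; case: k => [[|k]|k]; rewrite /= ?compm0.
apply: etrans _ (etrans E _); last by rewrite compA.
rewrite -[in RHS](tot_map_inj (X := single A V) (X' := single A V) (Y := cone_plus i)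
  (Y' := cx_shift A (single A X)) (chain_id (single_cx V)) (cone_shift i) k l n).
by rewrite !compA.
Qed.

Lemma cone_single_tensr (ip : short_exact i p) (Vip : short_exact (idm V ⊗ₘ i) (idm V ⊗ₘ p)) :
  (tot_single V Z : hom (tot_plus _ _) _) ∘ tot_plus_map (idm (single A V)) (cone_single_plus ip)
  = cone_single_plus Vip ∘ (cone_tensr V i
    : @hom (cx_plus A) (tot_plus (single A V) (cone_plus i)) (cone_plus (idm V ⊗ₘ i))).
Proof.
apply: chain_mapP => n; apply: tot_eq => k l kl.
have E : tot_single_def V Z n ∘ (tot_inj (single A V) (single A Z) k l n
       ∘ ((chain_id (single_cx V)) k ⊗ₘ cone_single ip.1.1 l))
  = cone_single Vip.1.1 n ∘ (cone_tensr_def V i n ∘ tot_inj (single A V) (cone_plus i) k l n).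
  rewrite cone_tensr_inj compA tot_single_inj -kl.
  case: l {kl} => [[|l]|[|l]].
  - case: k => [[|k]|k]; rewrite /= ?comp0m ?compm0 //.
    by rewrite comp1m compm1.
  - by rewrite tmapm0 !compm0; case: k => [[|k]|k]; rewrite /= ?compm0.
  - by rewrite tmapm0 compm0; case: k => [[|k]|k]; rewrite /= ?comp0m ?compm0.
  - by rewrite tmapm0 !compm0; case: k => [[|k]|k]; rewrite /= ?compm0.
apply: etrans _ (etrans E _); last by rewrite compA.
rewrite -[in RHS](tot_map_inj (X := single A V) (X' := single A V) (Y := cone_plus i)
  (Y' := single A Z) (chain_id (single_cx V)) (cone_single ip.1.1) k l n).
by rewrite !compA.
Qed.

End ConnectingTensor.

Section SingleTensor.
Variables (A : tensor_abelian) (T : derived_tensor A).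

Definition tsingle (X Y : A) : hom (tot_plus (single A X) (single A Y)) (single A (X ⊗ Y)) :=
  tot_single X Y.

Lemma tsingle_natural (X X' Y Y' : A) (u : hom X X') (v : hom Y Y') :
  tsingle X' Y' ∘ tot_plus_map (fmap (single A) u) (fmap (single A) v)
  = fmap (single A) (u ⊗ₘ v) ∘ tsingle X Y.
Proof.
apply: chain_mapP => n; apply: tot_eq => k l kl.
have E : tot_single_def X' Y' n ∘ (tot_inj (single A X') (single A Y') k l n
       ∘ (single_cx_map u k ⊗ₘ single_cx_map v l))
  = single_cx_map (u ⊗ₘ v) n ∘ (tot_single_def X Y n ∘ tot_inj (single A X) (single A Y) k l n).
  rewrite tot_single_inj compA tot_single_inj -kl.
  case: k {kl} => [[|k]|k]; rewrite /= ?comp0m ?compm0 //.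
  case: l => [[|l]|l]; rewrite /= ?comp0m ?compm0 //.
  by rewrite comp1m compm1.
apply: etrans _ (etrans E _); last by rewrite compA.
rewrite -[in RHS](tot_map_inj (X := single A X) (X' := single A X') (Y := single A Y)
  (Y' := single A Y') (single_cx_map u) (single_cx_map v) k l n).
by rewrite !compA.
Qed.

Definition single_tensor (X Y : A) :
    hom (T (loc_plus A (single A X), loc_plus A (single A Y))) (loc_plus A (single A (X ⊗ Y))) :=
  fmap (loc_plus A) (tsingle X Y) ∘ teps T (single A X) (single A Y).

Lemma single_tensor_natural (X X' Y Y' : A) (u : hom X X') (v : hom Y Y') :
  single_tensor X' Y' ∘ tmap T (fmap (loc_plus A) (fmap (single A) u)) (fmap (loc_plus A)
    (fmap (single A) v))
  = fmap (loc_plus A) (fmap (single A) (u ⊗ₘ v)) ∘ single_tensor X Y.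
Proof.
by rewrite /single_tensor -compA teps_natural !compA -!(fmapM (loc_plus A)) tsingle_natural.
Qed.

(** After composition with the isomorphism from the cone of [i], both connecting morphisms are given
    by chain maps. The claim becomes one about total complexes, settled by [cone_shift_tensl] and
    [cone_single_tensl]. *)
Lemma single_tensor_connectingl
    (t : forall X Y : der_plus A, hom (T (oshift A true X, oshift A false Y)) (der_shift A (T
      (X, Y))))
    (tE : forall X Y : cx_plus A,
      fmap (der_shift A) (teps T X Y) ∘ t (loc_plus A X) (loc_plus A Y)
        ∘ tmap T (oloc true X) (oloc false Y)
      = shift_loc (tot_plus X Y) ∘ fmap (loc_plus A) (otot true X Y)
        ∘ teps T (ocx A true X) (ocx A false Y))
    (X Y Z V : A) (i : hom X Y) (p : hom Y Z) (ip : short_exact i p)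
    (ipV : short_exact (i ⊗ₘ idm V) (p ⊗ₘ idm V)) :
  fmap (der_shift A) (single_tensor X V) ∘ t (loc_plus A (single A X)) (loc_plus A (single A V))
    ∘ tmap T (der_connecting ip) (idm (loc_plus A (single A V)))
  = der_connecting ipV ∘ single_tensor Z V.
Proof.
have iq : is_iso (tmap T (fmap (loc_plus A) (cone_single_plus ip)) (fmap (loc_plus A) (idm
  (single A V)))).
  by apply: is_iso_tmap; [exact: cone_single_iso | rewrite fmap1; exact: is_iso1].
apply: (is_iso_epi iq).
have L : tmap T (der_connecting ip) (idm (loc_plus A (single A V)))
    ∘ tmap T (fmap (loc_plus A) (cone_single_plus ip)) (fmap (loc_plus A) (idm (single A V)))
  = tmap T (oloc true (single A X)) (oloc false (single A V))
    ∘ tmap T (fmap (loc_plus A) (cone_shift_plus i)) (fmap (loc_plus A) (idm (single A V))).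
  by rewrite !bitmapM der_connecting_cone.
pose k : @hom (cx_plus A) (tot_plus (cone_plus i) (single A V)) (cone_plus
  (i ⊗ₘ idm V)) := cone_tensl V i.
have K := cone_shift_tensl V i.
have R : single_tensor Z V
    ∘ tmap T (fmap (loc_plus A) (cone_single_plus ip)) (fmap (loc_plus A) (idm (single A V)))
  = fmap (loc_plus A) (cone_single_plus ipV) ∘ fmap (loc_plus A) k
    ∘ teps T (cone_plus i) (single A V).
  rewrite /single_tensor -compA teps_natural compA -!(fmapM (loc_plus A)).
  by congr (fmap _ _ ∘ _); exact: cone_single_tensl.
rewrite -[RHS]compA R -[LHS]compA L /single_tensor fmapM !compA der_connecting_cone.
rewrite -[_ ∘ fmap _ (teps _ _ _) ∘ _]compA -[_ ∘ _ ∘ tmap _ (oloc _ _) _]compA tE.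
rewrite !compA -shift_loc_natural -[_ ∘ teps _ _ _ ∘ _]compA teps_natural !compA.
congr (_ ∘ _); rewrite -!compA -!(fmapM (loc_plus A)) !compA; congr (_ ∘ fmap _ _).
exact: K.
Qed.

Lemma single_tensor_connectingr
    (t : forall X Y : der_plus A, hom (T (oshift A false X, oshift A true Y)) (der_shift A (T
      (X, Y))))
    (tE : forall X Y : cx_plus A,
      fmap (der_shift A) (teps T X Y) ∘ t (loc_plus A X) (loc_plus A Y)
        ∘ tmap T (oloc false X) (oloc true Y)
      = shift_loc (tot_plus X Y) ∘ fmap (loc_plus A) (otot false X Y)
        ∘ teps T (ocx A false X) (ocx A true Y))
    (X Y Z V : A) (i : hom X Y) (p : hom Y Z) (ip : short_exact i p)
    (Vip : short_exact (idm V ⊗ₘ i) (idm V ⊗ₘ p)) :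
  fmap (der_shift A) (single_tensor V X) ∘ t (loc_plus A (single A V)) (loc_plus A (single A X))
    ∘ tmap T (idm (loc_plus A (single A V))) (der_connecting ip)
  = der_connecting Vip ∘ single_tensor V Z.
Proof.
have iq : is_iso (tmap T (fmap (loc_plus A) (idm (single A V))) (fmap (loc_plus A)
  (cone_single_plus ip))).
  by apply: is_iso_tmap; [rewrite fmap1; exact: is_iso1 | exact: cone_single_iso].
apply: (is_iso_epi iq).
have L : tmap T (idm (loc_plus A (single A V))) (der_connecting ip)
    ∘ tmap T (fmap (loc_plus A) (idm (single A V))) (fmap (loc_plus A) (cone_single_plus ip))
  = tmap T (oloc false (single A V)) (oloc true (single A X))
    ∘ tmap T (fmap (loc_plus A) (idm (single A V))) (fmap (loc_plus A) (cone_shift_plus i)).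
  by rewrite !bitmapM der_connecting_cone.
pose k : @hom (cx_plus A) (tot_plus (single A V) (cone_plus i)) (cone_plus
  (idm V ⊗ₘ i)) := cone_tensr V i.
have K := cone_shift_tensr V i.
have R : single_tensor V Z
    ∘ tmap T (fmap (loc_plus A) (idm (single A V))) (fmap (loc_plus A) (cone_single_plus ip))
  = fmap (loc_plus A) (cone_single_plus Vip) ∘ fmap (loc_plus A) k
    ∘ teps T (single A V) (cone_plus i).
  rewrite /single_tensor -compA teps_natural compA -!(fmapM (loc_plus A)).
  by congr (fmap _ _ ∘ _); exact: cone_single_tensr.
rewrite -[RHS]compA R -[LHS]compA L /single_tensor fmapM !compA der_connecting_cone.
rewrite -[_ ∘ fmap _ (teps _ _ _) ∘ _]compA -[_ ∘ _ ∘ tmap _ (oloc _ _) _]compA tE.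
rewrite !compA -shift_loc_natural -[_ ∘ teps _ _ _ ∘ _]compA teps_natural !compA.
congr (_ ∘ _); rewrite -!compA -!(fmapM (loc_plus A)) !compA; congr (_ ∘ fmap _ _).
exact: K.
Qed.

End SingleTensor.

Section ExternalShift.
Variables (A : tensor_abelian) (torA : finite_tor_dim A) (T : derived_tensor A).

Lemma der_coh_shift_loc (X : cx_plus A) n :
  fmap (der_coh A n) (shift_loc X) = idm (coh n (shift_ob (sval X))).
Proof.
by rewrite /shift_loc der_coh_dm; exact: (fmap1 (coh_functor A n) (shift_ob (sval X))).
Qed.

Lemma der_coh1 (X : der_plus A) n : fmap (der_coh A n) (idm X) = idm (der_coh A n X).
Proof. exact: fmap1. Qed.

Variables (p q n : int).
Variable k0 : forall X Y : der_plus A, hom (der_coh A p X ⊗ der_coh A q Y) (der_coh A n (T (X, Y))).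
Hypothesis k0P : ext_product k0.

(** On flat pairs [teps] is invertible and the claim reduces to [coh_product_shiftl]; naturality
    carries it to D^+. *)
Lemma ext_product_shiftl
    (k1 : forall X Y : der_plus A, hom (der_coh A (1 + p) X ⊗ der_coh A q Y) (der_coh A
      (1 + n) (T (X, Y))))
    (k1P : ext_product k1)
    (t : forall X Y : der_plus A, hom (T (oshift A true X, oshift A false Y)) (der_shift A (T
      (X, Y))))
    (tN : forall X X' Y Y' (u : hom X X') (v : hom Y Y'),
      t X' Y' ∘ tmap T (fmap (oshift A true) u) (fmap (oshift A false) v)
      = fmap (der_shift A) (tmap T u v) ∘ t X Y)
    (tE : forall X Y : cx_plus A,
      fmap (der_shift A) (teps T X Y) ∘ t (loc_plus A X) (loc_plus A Y)
        ∘ tmap T (oloc true X) (oloc false Y)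
      = shift_loc (tot_plus X Y) ∘ fmap (loc_plus A) (otot true X Y)
        ∘ teps T (ocx A true X) (ocx A false Y)) (M N : der_plus A) :
  k1 M N ∘ (coh_shift p (sval M) ⊗ₘ idm (der_coh A q N))
  = coh_shift n (sval (T (M, N))) ∘ fmap (der_coh A n) (t M N) ∘ k0 (der_shift A M) N.
Proof.
have [k0N k0E] := k0P; have [k1N k1E] := k1P.
have F (P Q : cx_plus A) : flat_plus P -> flat_plus Q ->
    k1 (loc_plus A P) (loc_plus A Q)
      ∘ (coh_shift p (sval (loc_plus A P)) ⊗ₘ idm (der_coh A q (loc_plus A Q)))
    = coh_shift n (sval (T (loc_plus A P, loc_plus A Q)))
      ∘ fmap (der_coh A n) (t (loc_plus A P) (loc_plus A Q))
      ∘ k0 (der_shift A (loc_plus A P)) (loc_plus A Q).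
  move=> fP fQ.
  have it : is_iso (fmap (der_coh A (1 + n)) (teps T P Q)).
    by apply: is_iso_fmap; exact: teps_iso.
  have io : is_iso (fmap (der_coh A p) (oloc true P) ⊗ₘ fmap (der_coh A q) (oloc false Q)).
    by apply: is_iso_tmap; apply: is_iso_fmap; exact: oloc_iso.
  apply: (is_iso_mono it); apply: (is_iso_epi io).
  rewrite !compA k1E -coh_shift_natural.
  have E : fmap (der_coh A n) (fmap (der_shift A) (teps T P Q))
      ∘ (fmap (der_coh A n) (t (loc_plus A P) (loc_plus A Q))
      ∘ (k0 (der_shift A (loc_plus A P)) (loc_plus A Q)
      ∘ (fmap (der_coh A p) (oloc true P) ⊗ₘ fmap (der_coh A q) (oloc false Q))))
    = coh_map n (tot_shiftl P Q) ∘ coh_product (cx_shift A P) Q p q n.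
    rewrite (k0N _ _ _ _ (oloc true P) (oloc false Q)) !compA -!(fmapM (der_coh A n)) tE !fmapM.
    rewrite der_coh_shift_loc comp1m der_coh_loc -compA k0E.
    by [].
  rewrite -!compA [X in _ = comp _ X]E.
  rewrite der_coh1 [fmap _ (oloc true P)]der_coh_shift_loc tmap1 compm1 compA.
  exact: coh_product_shiftl.
pose G := tens A ⊚ prod_functor (der_coh A p ⊚ der_shift A) (der_coh A q).
pose H := der_coh A (1 + n) ⊚ dtens T ⊚ prod_functor (id_functor (der_plus A)) (id_functor
  (der_plus A)).
pose a X : hom (G X) (H X) := k1 X.1 X.2 ∘ (coh_shift p (sval X.1) ⊗ₘ idm (der_coh A q X.2)).
pose b X : hom (G X) (H X) := coh_shift n (sval (T (X.1, X.2))) ∘ fmap (der_coh A n) (t X.1 X.2)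
     ∘ k0 (der_shift A X.1) X.2.
apply: (@flat_natural_eq A torA _ G H a b _ _ _ (M, N)).
- move=> X Y w; apply: etrans (esym (compA _ _ _)) _.
  apply: etrans (congr1 (comp _) (tmapM _ _ _ _)) _.
  rewrite coh_shift_natural comp1m -[fmap _ w.2]compm1 -tmapM compA k1N -compA.
  by [].
- move=> X Y w; apply: etrans (esym (compA _ _ _)) _.
  apply: etrans (congr1 (comp _) (k0N _ _ _ _ (fmap (der_shift A) w.1) w.2)) _.
  rewrite compA -[_ ∘ fmap _ (t _ _) ∘ _]compA -(fmapM (der_coh A n)) [t _ _ ∘ _]tN.
  by rewrite fmapM !compA coh_shift_natural.
- by move=> P Q; exact: F.
Qed.

Lemma ext_product_shiftr
    (k1 : forall X Y : der_plus A, hom (der_coh A p X ⊗ der_coh A (1 + q) Y) (der_coh A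
      (1 + n) (T (X, Y))))
    (k1P : ext_product k1)
    (t : forall X Y : der_plus A, hom (T (oshift A false X, oshift A true Y)) (der_shift A (T
      (X, Y))))
    (tN : forall X X' Y Y' (u : hom X X') (v : hom Y Y'),
      t X' Y' ∘ tmap T (fmap (oshift A false) u) (fmap (oshift A true) v)
      = fmap (der_shift A) (tmap T u v) ∘ t X Y)
    (tE : forall X Y : cx_plus A,
      fmap (der_shift A) (teps T X Y) ∘ t (loc_plus A X) (loc_plus A Y)
        ∘ tmap T (oloc false X) (oloc true Y)
      = shift_loc (tot_plus X Y) ∘ fmap (loc_plus A) (otot false X Y)
        ∘ teps T (ocx A false X) (ocx A true Y)) (M N : der_plus A) :
  k1 M N ∘ (idm (der_coh A p M) ⊗ₘ coh_shift q (sval N))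
  = (coh_shift n (sval (T (M, N))) ∘ fmap (der_coh A n) (t M N)
    ∘ k0 M (der_shift A N)) *~ (-1) ^+ `|p|%N.
Proof.
have [k0N k0E] := k0P; have [k1N k1E] := k1P.
have F (P Q : cx_plus A) : flat_plus P -> flat_plus Q ->
    k1 (loc_plus A P) (loc_plus A Q)
      ∘ (idm (der_coh A p (loc_plus A P)) ⊗ₘ coh_shift q (sval (loc_plus A Q)))
    = (coh_shift n (sval (T (loc_plus A P, loc_plus A Q)))
      ∘ fmap (der_coh A n) (t (loc_plus A P) (loc_plus A Q))
      ∘ k0 (loc_plus A P) (der_shift A (loc_plus A Q))) *~ (-1) ^+ `|p|%N.
  move=> fP fQ.
  have it : is_iso (fmap (der_coh A (1 + n)) (teps T P Q)).
    by apply: is_iso_fmap; exact: teps_iso.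
  have io : is_iso (fmap (der_coh A p) (oloc false P) ⊗ₘ fmap (der_coh A q) (oloc true Q)).
    by apply: is_iso_tmap; apply: is_iso_fmap; exact: oloc_iso.
  apply: (is_iso_mono it); apply: (is_iso_epi io).
  rewrite !compA k1E !comp_mulrz !mulrz_comp !compA -coh_shift_natural.
  have E : fmap (der_coh A n) (fmap (der_shift A) (teps T P Q))
      ∘ (fmap (der_coh A n) (t (loc_plus A P) (loc_plus A Q))
      ∘ (k0 (loc_plus A P) (der_shift A (loc_plus A Q))
      ∘ (fmap (der_coh A p) (oloc false P) ⊗ₘ fmap (der_coh A q) (oloc true Q))))
    = coh_map n (tot_shiftr P Q) ∘ coh_product P (cx_shift A Q) p q n.
    rewrite (k0N _ _ _ _ (oloc false P) (oloc true Q)) !compA -!(fmapM (der_coh A n)) tE !fmapM.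
    rewrite der_coh_shift_loc comp1m der_coh_loc -compA k0E.
    by [].
  rewrite -!compA; apply: (@etrans _ _ ((coh_shift n (tot P Q)
    ∘ (coh_map n (tot_shiftr P Q) ∘ coh_product P (cx_shift A Q) p q n)) *~ (-1) ^+ `|p|%N));
      last first.
    by congr (_ *~ _); exact: esym (congr1 (comp _) E).
  rewrite der_coh1 der_coh_shift_loc tmap1 compm1 compA.
  exact: coh_product_shiftr.
pose G := tens A ⊚ prod_functor (der_coh A p) (der_coh A q ⊚ der_shift A).
pose H := der_coh A (1 + n) ⊚ dtens T ⊚ prod_functor (id_functor (der_plus A)) (id_functor
  (der_plus A)).
pose a X : hom (G X) (H X) := k1 X.1 X.2 ∘ (idm (der_coh A p X.1) ⊗ₘ coh_shift q (sval X.2)).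
pose b X : hom (G X) (H X) := coh_shift n (sval (T (X.1, X.2))) ∘ fmap (der_coh A n) (t X.1 X.2)
     ∘ k0 X.1 (der_shift A X.2).
have bN X Y (w : hom X Y) : b Y ∘ fmap G w = fmap H w ∘ b X.
  apply: etrans (esym (compA _ _ _)) _.
  apply: etrans (congr1 (comp _) (k0N _ _ _ _ w.1 (fmap (der_shift A) w.2))) _.
  rewrite compA -[_ ∘ fmap _ (t _ _) ∘ _]compA -(fmapM (der_coh A n)) [t _ _ ∘ _]tN.
  by rewrite fmapM !compA coh_shift_natural.
apply: (@flat_natural_eq A torA _ G H a (fun X => b X *~ (-1) ^+ `|p|%N
  : hom (G X) (H X)) _ _ _ (M, N)).
- move=> X Y w; apply: etrans (esym (compA _ _ _)) _.
  apply: etrans (congr1 (comp _) (tmapM _ _ _ _)) _.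
  rewrite coh_shift_natural comp1m -[fmap _ w.1]compm1 -tmapM compA k1N -compA.
  by [].
- by move=> X Y w; rewrite mulrz_comp comp_mulrz bN.
- by move=> P Q; exact: F.
Qed.

End ExternalShift.

(** * Effaceability *)

Section Effaceability.
Variables (A B : tensor_abelian) (f : additive_functor A B) (Rf : right_derived f).
Variables (f' : additive_functor B A) (adj : adjunction f' f) (fx : exact_functor f').

Definition sph_plus (C : abelian) (r : int) (M : C) : cx_plus C :=
  exist _ (sph r M) (sph_bounded r M).

Section Adjoint.
Variable e : forall Y : der_plus A, hom (der_exact fx (Rf Y)) Y.
Variable u : forall M : der_plus B, hom M (Rf (der_exact fx M)).
Hypothesis eN : forall X Y (w : hom X Y),
  e Y ∘ fmap (der_exact fx) (fmap Rf w) = w ∘ e X.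
Hypothesis eE : forall X : cx_plus A, e (loc_plus A X) ∘ fmap (der_exact fx) (reta Rf X)
  = fmap (loc_plus A) (pcounit adj X) ∘ der_exact_loc fx (cx_plus_map f X).
Hypothesis uN : forall M N (w : hom M N), u N ∘ w = fmap Rf (fmap (der_exact fx) w) ∘ u M.
Hypothesis uE : forall M : cx_plus B, fmap Rf (der_exact_loc fx M) ∘ u (loc_plus B M)
  = reta Rf (cx_plus_map f' M) ∘ fmap (loc_plus B) (punit adj M).

Lemma derived_transpose (M : der_plus B) (Y : der_plus A) (c : hom M (Rf Y)) :
  fmap Rf (e Y ∘ fmap (der_exact fx) c) ∘ u M = c.
Proof.
by rewrite fmapM -compA -uN compA (triangle eN eE uN uE) comp1m.
Qed.

Lemma derived_transpose_loc (M : cx_plus B) (Y : der_plus A) (c : hom (loc_plus B M) (Rf Y)) :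
  exists x : hom (loc_plus A (cx_plus_map f' M)) Y,
    fmap Rf (x ∘ der_exact_loc fx M) ∘ u (loc_plus B M) = c.
Proof.
exists (e Y ∘ fmap (der_exact fx) c ∘ inv_iso (der_exact_loc_iso fx M)).
by rewrite -[_ ∘ _ ∘ der_exact_loc _ _]compA inv_isoK compm1; exact: derived_transpose.
Qed.

(** Let M be the cocycles of degree 0 of [N]. The tautological morphism from M, placed in degree 0,
    to [N] is the transpose of a morphism from f' M to X. By [full_degree0] the latter is a chain
    map, so the tautological morphism factors through [reta]; on cohomology it induces the
    epimorphism [cls]. *)
Lemma reta_single_epi (X : A) : epi (fmap (der_coh B 0) (reta Rf (single A X))).
Proof.
pose N := Rf (loc_plus A (single A X)); pose M := cocyc 0 (sval N).
have zc : cyc (cocycm 0 (sval N)) by exact: dif_cocyc.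
pose S := sph_plus 0 M.
pose c : hom (loc_plus B S) N := @dm B (loc_plus B S) N (sph_map zc).
have [x xE] := derived_transpose_loc c.
have [|w wE] := full_degree0 x.
  by move=> n n0; apply: (afun_zero f'); exact: sph_zero.
have cE : c = reta Rf (single A X)
    ∘ fmap (loc_plus B) (fmap (cx_plus_map f) w ∘ punit adj S).
  rewrite -xE wE fmapM -compA uE compA -reta_natural -compA.
  by rewrite -(fmapM (loc_plus B)).
have E : fmap (der_coh B 0) c ∘ sph_cls 0 M = cls 0 (sval N).
  rewrite /c der_coh_dm; apply: etrans (sph_map_cls zc) _.
  rewrite (_ : cocyc_lift zc = idm _) ?compm1 //.
  by apply: cocycm_mono; rewrite cocyc_liftK compm1.
apply: (@epi_factor _ _ _ _ _ (fmap (der_coh B 0)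
  (fmap (loc_plus B) (fmap (cx_plus_map f) w ∘ punit adj S)) ∘ sph_cls 0 M)).
rewrite compA -(fmapM (der_coh B 0)) -cE [X in epi X]E; exact: cls_epi.
Qed.

Lemma effaceable (torA : finite_tor_dim A) (torB : finite_tor_dim B) (r : nat) (X' : A) :
  (forall P, flat P -> flat (f' P)) ->
  exists (X X'' : A) (i : hom X' X) (p : hom X X'') (ip : short_exact i p),
    flat X'' /\ exists (M : B) (y : hom M (rderived Rf r X'')), epi (connecting Rf ip r ∘ y).
Proof.
move=> ff; pose Y := loc_plus A (single A X'); pose N := der_shift B (Rf Y).
have [d dB] := finite_tor_dim_fdim torB.
(* [M] covers all cocycles of degree [r], so the single morphism [c] hits every class. It is chosen
   flat in order that f' M be flat, as [effacement] demands. *)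
have [M [m [fM em]]] := fdim_enough_flat dB (cocyc r (sval N)).
have zc : cyc (cocycm r (sval N) ∘ m) by apply: cyc_comp; exact: dif_cocyc.
pose S := sph_plus r M.
pose c : hom (loc_plus B S) N := @dm B (loc_plus B S) N (sph_map zc).
(* Carried by [rsh] to the derived functor of the shifted object, [c] becomes the transpose of a
   morphism from f' S to X'[1]. *)
have [x xE] := derived_transpose_loc (rsh Rf Y ∘ c).
have [| |X [X'' [i [p [ip [y0 [fX'' yE]]]]]]] := effacement torA (r := r) x.
- have [b ib] := exact_coh_iso fx (sph r M) r.
  apply: flat_iso ib _; apply: ff; exact: flat_iso (sph_cls_iso r M) fM.
- move=> n nr; have [b [b' [b'b bb']]] := exact_coh_iso fx (sph r M) n.
  rewrite /is_zero -bb' (zero_out b' _) ?compm0 //.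
  by apply: afun_zero; exact: sph_coh_zero.
exists X, X'', i, p, ip; split=> //.
pose y1 : hom (loc_plus B S) (Rf (loc_plus A (single A X''))) :=
  fmap Rf (y0 ∘ der_exact_loc fx S) ∘ u (loc_plus B S).
exists M, (fmap (der_coh B r) y1 ∘ sph_cls r M).
have E : fmap Rf (der_connecting ip) ∘ y1 = rsh Rf Y ∘ c.
  by rewrite /y1 compA -fmapM compA yE.
have E' : inv_iso (rder_shift_iso Rf Y) ∘ fmap Rf (der_connecting ip) ∘ y1 = c.
  rewrite -compA E compA; apply: etrans (comp1m c); congr (_ ∘ _).
  exact: (inv_isoK (rder_shift_iso Rf Y)).
have iS : is_iso (coh_shift r (sval (Rf Y))).
  exists (coh_unshift r (sval (Rf Y))).
  by split; [exact: coh_shiftK | exact: coh_unshiftK].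
have F : fmap (der_coh B r) (inv_iso (rder_shift_iso Rf Y) ∘ fmap Rf (der_connecting ip))
    ∘ fmap (der_coh B r) y1 = fmap (der_coh B r) c.
  by rewrite -(fmapM (der_coh B r)) [X in fmap _ X]E'.
(* Up to the isomorphism [coh_shift], the composite is the class of [m], which is an epimorphism
   because [m] covers the cocycles. *)
have -> : connecting Rf ip r ∘ (fmap (der_coh B r) y1 ∘ sph_cls r M)
    = coh_shift r (sval (Rf Y)) ∘ (fmap (der_coh B r) c ∘ sph_cls r M).
  apply: etrans (esym (compA _ _ _)) _; congr (_ ∘ _).
  by apply: etrans (compA _ _ _) _; congr (_ ∘ _); exact: F.
apply: epiM.
  exact: (is_iso_epi iS).
rewrite /c der_coh_dm (_ : _ ∘ _ = cls r (sval N) ∘ cocyc_lift zc); last exact: sph_map_cls.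
apply: epiM; first exact: cls_epi.
rewrite (_ : cocyc_lift zc = m) //.
by apply: cocycm_mono; rewrite cocyc_liftK.
Qed.

End Adjoint.

End Effaceability.

Lemma rderived0_epi (A B : tensor_abelian) (f : additive_functor A B) (hf : pre_cup_functor f)
    (Rf : right_derived f) (X : A) : epi (rderived0 Rf X).
Proof.
have [f' [adj [fx ff]]] := hf.
have [e [eN eE]] := derived_counit Rf adj fx; have [u [uN uE]] := derived_unit Rf adj fx.
apply: epiM; first exact: reta_single_epi eN eE uN uE X.
apply: epiM; first exact: cls_epi.
pose l : hom (f X) (cocyc 0 (cx_map f (single_cx X))) := cocyc_lift (rderived0_subproof f X).
have l1 : cocycm 0 (cx_map f (single_cx X)) ∘ l = idm (f X) by exact: cocyc_liftK.
apply: (is_iso_epi (u := l)); exists (cocycm 0 (cx_map f (single_cx X))); split=> //.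
by apply: cocycm_mono; rewrite compA l1 compm1; exact: comp1m.
Qed.

Lemma pre_cup_effaceable (A B : tensor_abelian) (torA : finite_tor_dim A) (torB : finite_tor_dim B)
    (f : additive_functor A B) (hf : pre_cup_functor f) (Rf : right_derived f) (r : nat) (X' : A) :
  exists (X X'' : A) (i : hom X' X) (p : hom X X'') (ip : short_exact i p),
    flat X'' /\ exists (M : B) (y : hom M (rderived Rf r X'')), epi (connecting Rf ip r ∘ y).
Proof.
have [f' [adj [fx ff]]] := hf.
have [e [eN eE]] := derived_counit Rf adj fx; have [u [uN uE]] := derived_unit Rf adj fx.
exact: effaceable eN eE uN uE torA torB r X' ff.
Qed.

(** * The cup products *)

Section CupProduct.
Variables (A B : tensor_abelian) (TA : derived_tensor A) (TB : derived_tensor B).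
Variables (f g h : additive_functor A B).
Variables (Rf : right_derived f) (Rg : right_derived g) (Rh : right_derived h).
Variable mu : cup_pairing (tens A) (tens B) f g h.

Variable D : forall X Y : der_plus A, hom (TB (Rf X, Rg Y)) (Rh (TA (X, Y))).
Hypothesis DN : forall X X' Y Y' (u : hom X X') (v : hom Y Y'),
  D X' Y' ∘ tmap TB (fmap Rf u) (fmap Rg v) = fmap Rh (tmap TA u v) ∘ D X Y.
Hypothesis DE : forall X Y : cx_plus A,
  fmap Rh (teps TA X Y) ∘ D (loc_plus A X) (loc_plus A Y)
    ∘ tmap TB (reta Rf X) (reta Rg Y)
  = reta Rh (tot_plus X Y) ∘ fmap (loc_plus B) (mutot mu X Y)
    ∘ teps TB (cx_plus_map f X) (cx_plus_map g Y).

Variable k : forall (p q n : int) (X Y : der_plus B),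
  hom (der_coh B p X ⊗ der_coh B q Y) (der_coh B n (TB (X, Y))).
Hypothesis kP : forall p q n, ext_product (k p q n).

Definition single_cup (X Y : A) :
    hom (TB (Rf (loc_plus A (single A X)), Rg (loc_plus A (single A Y))))
        (Rh (loc_plus A (single A (X ⊗ Y)))) :=
  fmap Rh (single_tensor TA X Y) ∘ D (loc_plus A (single A X)) (loc_plus A (single A Y)).

Lemma single_cup_natural (X X' Y Y' : A) (u : hom X X') (v : hom Y Y') :
  single_cup X' Y' ∘ tmap TB (fmap Rf (fmap (loc_plus A) (fmap (single A) u)))
                             (fmap Rg (fmap (loc_plus A) (fmap (single A) v)))
  = fmap Rh (fmap (loc_plus A) (fmap (single A) (u ⊗ₘ v))) ∘ single_cup X Y.
Proof. by rewrite /single_cup -compA DN !compA -!(fmapM Rh) single_tensor_natural. Qed.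

Definition cup_mor (r s n : nat) (X Y : A) :
    hom (rderived Rf r X ⊗ rderived Rg s Y) (rderived Rh n (X ⊗ Y)) :=
  fmap (der_coh B n) (single_cup X Y)
    ∘ k r s n (Rf (loc_plus A (single A X))) (Rg (loc_plus A (single A Y))).

Lemma cup_mor_natural (r s n : nat) (X X' Y Y' : A) (u : hom X X') (v : hom Y Y') :
  cup_mor r s n X' Y' ∘ (fmap (rderived Rf r) u ⊗ₘ fmap (rderived Rg s) v)
  = fmap (rderived Rh n) (u ⊗ₘ v) ∘ cup_mor r s n X Y.
Proof.
have [kN kE] := kP r s n.
apply: etrans (esym (compA _ _ _)) _.
apply: etrans (congr1 (comp _) (kN _ _ _ _ _ _)) _.
apply: etrans (compA _ _ _) _; apply: etrans _ (esym (compA _ _ _)); congr (_ ∘ _).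
by rewrite -(fmapM (der_coh B n)) single_cup_natural fmapM.
Qed.

Lemma single_cup_reta (X Y : A) :
  single_cup X Y ∘ tmap TB (reta Rf (single A X)) (reta Rg (single A Y))
  = reta Rh (single A (X ⊗ Y))
    ∘ fmap (loc_plus B) (fmap (cx_plus_map h) (tsingle X Y) ∘ mutot mu (single A X) (single A Y))
    ∘ teps TB (cx_plus_map f (single A X)) (cx_plus_map g (single A Y)).
Proof.
rewrite /single_cup /single_tensor [fmap Rh (_ ∘ _)]fmapM -[_ ∘ _ ∘ D _ _]compA -compA DE !compA.
by rewrite -reta_natural -[_ ∘ _ ∘ fmap _ (mutot _ _ _)]compA -(fmapM (loc_plus B)).
Qed.

(** Everything is evaluated on the tautological cocycles given by f X and g Y in degree 0. [E1] and
    [E2] compute their external product, [E4] replaces the derived cup product by a chain map, and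
    [E3] identifies this chain map in degree 0 with [mu]. *)
Lemma cup_mor_extends (X Y : A) :
  cup_mor 0 0 0 X Y ∘ (rderived0 Rf X ⊗ₘ rderived0 Rg Y) = rderived0 Rh (X ⊗ Y) ∘ mu (X, Y).
Proof.
have [kN kE] := kP 0 0 0.
pose fX := cx_plus_map f (single A X); pose gY := cx_plus_map g (single A Y).
pose lf : hom (f X) (cocyc 0 (sval fX)) := cocyc_lift (rderived0_subproof f X).
pose lg : hom (g Y) (cocyc 0 (sval gY)) := cocyc_lift (rderived0_subproof g Y).
pose m := fmap (cx_plus_map h) (tsingle X Y) ∘ mutot mu (single A X) (single A Y).
have E1 : k 0 0 0 (Rf (loc_plus A (single A X))) (Rg (loc_plus A (single A Y)))
    ∘ (rderived0 Rf X ⊗ₘ rderived0 Rg Y)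
  = fmap (der_coh B 0) (tmap TB (reta Rf (single A X)) (reta Rg (single A Y)))
    ∘ k 0 0 0 (loc_plus B fX) (loc_plus B gY) ∘ ((cls 0 (sval fX) ∘ lf) ⊗ₘ (cls 0 (sval gY) ∘ lg)).
  rewrite -kN; apply: etrans _ (compA _ _ _); congr (_ ∘ _); exact: (esym (tmapM _ _ _ _)).
have E2 : fmap (der_coh B 0) (teps TB fX gY) ∘ k 0 0 0 (loc_plus B fX) (loc_plus B gY)
    ∘ ((cls 0 (sval fX) ∘ lf) ⊗ₘ (cls 0 (sval gY) ∘ lg))
  = cls 0 (tot fX gY) ∘ (cocyc_tensor fX gY 0 0 0 ∘ (lf ⊗ₘ lg)).
  by rewrite kE -tmapM [LHS]compA coh_productE [RHS]compA.
have E3 : cocyc_map 0 (m : chain_map _ _) ∘ (cocyc_tensor fX gY 0 0 0 ∘ (lf ⊗ₘ lg))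
    = cocyc_lift (rderived0_subproof h (X ⊗ Y)) ∘ mu (X, Y).
  have P : cocycm 0 (tot fX gY) ∘ (cocyc_tensor fX gY 0 0 0 ∘ (lf ⊗ₘ lg)) = tot_inj fX gY 0 0 0.
    rewrite compA cocyc_liftK -compA tmapM; apply: etrans _ (compm1 _); congr (_ ∘ _).
    apply: etrans _ (tmap1 (f X) (g Y)).
    have -> : cocycm 0 (sval fX) ∘ lf = idm (f X) by exact: cocyc_liftK.
    by have -> : cocycm 0 (sval gY) ∘ lg = idm (g Y) by exact: cocyc_liftK.
  apply: cocycm_mono; rewrite [LHS]compA cocyc_liftK -[LHS]compA [X in comp _ X = _]P
    [RHS]compA cocyc_liftK.
  apply: (@etrans _ _ (fmap h (tot_single_def X Y 0)
    ∘ (mutot_def mu (single A X) (single A Y) 0 ∘ tot_inj fX gY 0 0 0))); first by rewrite compA.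
  rewrite mutot_inj compA -fmapM tot_single_inj /= fmap1 !comp1m.
  by [].
have E4 : fmap (der_coh B 0) (single_cup X Y)
    ∘ fmap (der_coh B 0) (tmap TB (reta Rf (single A X)) (reta Rg (single A Y)))
  = fmap (der_coh B 0) (reta Rh (single A (X ⊗ Y)))
    ∘ (coh_map 0 (m : chain_map _ _) ∘ fmap (der_coh B 0) (teps TB fX gY)).
  by rewrite -(fmapM (der_coh B 0)) single_cup_reta 2!(fmapM (der_coh B 0)) der_coh_loc compA.
apply: etrans (esym (compA _ _ _)) _; apply: etrans (congr1 (comp _) E1) _.
apply: etrans (congr1 (comp _) (esym (compA _ _ _))) _; apply: etrans (compA _ _ _) _.
apply: etrans (congr1 (fun z => comp z _) E4) _; apply: etrans (esym (compA _ _ _)) _.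
apply: etrans _ (compA _ _ _); congr (_ ∘ _).
apply: etrans (esym (compA _ _ _)) _; apply: etrans (congr1 (comp _) (compA _ _ _)) _.
apply: etrans (congr1 (comp _) E2) _; apply: etrans (compA _ _ _) _.
apply: etrans (congr1 (fun z => comp z _) (coh_mapE 0 (m : chain_map _ _))) _.
apply: etrans (esym (compA _ _ _)) _; apply: etrans (congr1 (comp _) E3) _.
exact: compA.
Qed.

Lemma rsh_connecting (k0 : additive_functor A B) (Rk : right_derived k0) (X Y Z : A)
    (i : hom X Y) (p : hom Y Z) (ip : short_exact i p) :
  rsh Rk (loc_plus A (single A X))
    ∘ (inv_iso (rder_shift_iso Rk (loc_plus A (single A X))) ∘ fmap Rk (der_connecting ip))
  = fmap Rk (der_connecting ip).
Proof.
apply: etrans (compA _ _ _) _; apply: etrans _ (comp1m _); congr (_ ∘ _).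
exact: (inv_isoKV (rder_shift_iso Rk (loc_plus A (single A X)))).
Qed.

Section Left.
Variable tA : forall X Y : der_plus A,
  hom (TA (oshift A true X, oshift A false Y)) (der_shift A (TA (X, Y))).
Variable tB : forall X Y : der_plus B,
  hom (TB (oshift B true X, oshift B false Y)) (der_shift B (TB (X, Y))).
Hypothesis tBN : forall X X' Y Y' (u : hom X X') (v : hom Y Y'),
  tB X' Y' ∘ tmap TB (fmap (oshift B true) u) (fmap (oshift B false) v)
  = fmap (der_shift B) (tmap TB u v) ∘ tB X Y.
Hypothesis tAE : forall X Y : cx_plus A,
  fmap (der_shift A) (teps TA X Y) ∘ tA (loc_plus A X) (loc_plus A Y)
    ∘ tmap TA (oloc true X) (oloc false Y)
  = shift_loc (tot_plus X Y) ∘ fmap (loc_plus A) (otot true X Y)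
    ∘ teps TA (ocx A true X) (ocx A false Y).
Hypothesis tBE : forall X Y : cx_plus B,
  fmap (der_shift B) (teps TB X Y) ∘ tB (loc_plus B X) (loc_plus B Y)
    ∘ tmap TB (oloc true X) (oloc false Y)
  = shift_loc (tot_plus X Y) ∘ fmap (loc_plus B) (otot true X Y)
    ∘ teps TB (ocx B true X) (ocx B false Y).
Hypothesis DS : forall X Y : der_plus A,
  rsh Rh (TA (X, Y)) ∘ fmap (der_shift B) (D X Y) ∘ tB (Rf X) (Rg Y)
  = fmap Rh (tA X Y) ∘ D (oshift A true X) (oshift A false Y)
    ∘ tmap TB (osig Rf true X) (osig Rg false Y).
Variables (X Y Z V : A) (i : hom X Y) (p : hom Y Z) (ip : short_exact i p).
Variable ipV : short_exact (i ⊗ₘ idm V) (p ⊗ₘ idm V).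

(** Composition with [rsh] removes the inverse isomorphisms from the connecting morphisms. What
    remains follows from [DS], the naturality of [D] and [single_tensor_connectingl]. *)
Lemma single_cup_connectingl :
  fmap (der_shift B) (single_cup X V)
    ∘ tB (Rf (loc_plus A (single A X))) (Rg (loc_plus A (single A V)))
    ∘ tmap TB (inv_iso (rder_shift_iso Rf (loc_plus A (single A X))) ∘ fmap Rf (der_connecting ip))
        (idm (Rg (loc_plus A (single A V))))
  = inv_iso (rder_shift_iso Rh (loc_plus A (single A (X ⊗ V)))) ∘ fmap Rh (der_connecting ipV)
    ∘ single_cup Z V.
Proof.
apply: (is_iso_mono (rder_shift_iso Rh (loc_plus A (single A (X ⊗ V))))).
apply: etrans _ (esym (compA _ _ _)).
apply: etrans _ (esym (congr1 (fun z => comp z _) (rsh_connecting Rh ipV))).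
rewrite /single_cup [fmap (der_shift B) _]fmapM !compA.
rewrite [_ ∘ fmap _ (fmap Rh _)](rsh_natural Rh).
rewrite -[_ ∘ rsh _ _ ∘ _]compA -[_ ∘ _ ∘ tB _ _]compA DS.
rewrite !compA -[_ ∘ tmap TB (osig _ _ _) _ ∘ _]compA bitmapM.
rewrite [X in tmap TB X _](rsh_connecting Rf ip) compm1.
rewrite (_ : osig Rg false (loc_plus A (single A V)) = fmap Rg (idm (loc_plus A
  (single A V)))); last first.
  exact: (esym (fmap1 Rg _)).
rewrite -[_ ∘ D _ _ ∘ _]compA DN !compA -!(fmapM Rh).
by rewrite single_tensor_connectingl.
Qed.

(** The external product commutes with the shift by [ext_product_shiftl], and [single_cup] with the
    connecting morphisms; [coh_shift] passes through by naturality. *)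
Lemma cup_mor_connectingl (torB : finite_tor_dim B) (r s n : nat) :
  cup_mor r.+1 s n.+1 X V ∘ (connecting Rf ip r ⊗ₘ idm (rderived Rg s V))
  = connecting Rh ipV n ∘ cup_mor r s n Z V.
Proof.
pose a := inv_iso (rder_shift_iso Rf (loc_plus A (single A X))) ∘ fmap Rf (der_connecting ip).
pose c := inv_iso (rder_shift_iso Rh (loc_plus A (single A (X ⊗ V))))
  ∘ fmap Rh (der_connecting ipV).
pose N := Rg (loc_plus A (single A V)).
have [kN kE] := kP r s n.
have E1 : k r.+1 s n.+1 (Rf (loc_plus A (single A X))) N
      ∘ (connecting Rf ip r ⊗ₘ idm (rderived Rg s V))
    = coh_shift n (sval (TB (Rf (loc_plus A (single A X)), N)))
      ∘ (fmap (der_coh B n) (tB (Rf (loc_plus A (single A X))) N)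
      ∘ (fmap (der_coh B n) (tmap TB a (idm N)) ∘ k r s n (Rf (loc_plus A (single A Z))) N)).
  have -> : connecting Rf ip r ⊗ₘ idm (rderived Rg s V)
      = (coh_shift r (sval (Rf (loc_plus A (single A X)))) ⊗ₘ idm (der_coh B s N))
        ∘ (fmap (der_coh B r) a ⊗ₘ fmap (der_coh B s) (idm N)).
    by rewrite der_coh1 tmapM comp1m.
  apply: etrans (compA _ _ _) _.
  apply: etrans (congr1 (fun z => comp z _)
    (ext_product_shiftl torB (kP r s n) (kP r.+1 s n.+1) tBN tBE _ _)) _.
  apply: etrans (esym (compA _ _ _)) _; apply: etrans (congr1 (comp _) (kN _ _ _ _ _ _)) _.
  exact: (esym (compA _ _ _)).
have E2 : fmap (der_coh B n) (fmap (der_shift B) (single_cup X V))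
      ∘ (fmap (der_coh B n) (tB (Rf (loc_plus A (single A X))) N)
      ∘ (fmap (der_coh B n) (tmap TB a (idm N)) ∘ k r s n (Rf (loc_plus A (single A Z))) N))
    = fmap (der_coh B n) c ∘ (fmap (der_coh B n) (single_cup Z V)
      ∘ k r s n (Rf (loc_plus A (single A Z))) N).
  by rewrite !compA -!(fmapM (der_coh B n)) single_cup_connectingl.
apply: etrans (esym (compA _ _ _)) _; apply: etrans (congr1 (comp _) E1) _.
apply: etrans (compA _ _ _) _.
apply: etrans (congr1 (fun z => comp z _) (esym (coh_shift_natural (single_cup X V) n))) _.
apply: etrans (esym (compA _ _ _)) _; apply: etrans _ (compA _ _ _); congr (_ ∘ _).
exact: E2.
Qed.

End Left.

Section Right.
Variable tA : forall X Y : der_plus A,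
  hom (TA (oshift A false X, oshift A true Y)) (der_shift A (TA (X, Y))).
Variable tB : forall X Y : der_plus B,
  hom (TB (oshift B false X, oshift B true Y)) (der_shift B (TB (X, Y))).
Hypothesis tBN : forall X X' Y Y' (u : hom X X') (v : hom Y Y'),
  tB X' Y' ∘ tmap TB (fmap (oshift B false) u) (fmap (oshift B true) v)
  = fmap (der_shift B) (tmap TB u v) ∘ tB X Y.
Hypothesis tAE : forall X Y : cx_plus A,
  fmap (der_shift A) (teps TA X Y) ∘ tA (loc_plus A X) (loc_plus A Y)
    ∘ tmap TA (oloc false X) (oloc true Y)
  = shift_loc (tot_plus X Y) ∘ fmap (loc_plus A) (otot false X Y)
    ∘ teps TA (ocx A false X) (ocx A true Y).
Hypothesis tBE : forall X Y : cx_plus B,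
  fmap (der_shift B) (teps TB X Y) ∘ tB (loc_plus B X) (loc_plus B Y)
    ∘ tmap TB (oloc false X) (oloc true Y)
  = shift_loc (tot_plus X Y) ∘ fmap (loc_plus B) (otot false X Y)
    ∘ teps TB (ocx B false X) (ocx B true Y).
Hypothesis DS : forall X Y : der_plus A,
  rsh Rh (TA (X, Y)) ∘ fmap (der_shift B) (D X Y) ∘ tB (Rf X) (Rg Y)
  = fmap Rh (tA X Y) ∘ D (oshift A false X) (oshift A true Y)
    ∘ tmap TB (osig Rf false X) (osig Rg true Y).
Variables (X Y Z V : A) (i : hom X Y) (p : hom Y Z) (ip : short_exact i p).
Variable Vip : short_exact (idm V ⊗ₘ i) (idm V ⊗ₘ p).

Lemma single_cup_connectingr :
  fmap (der_shift B) (single_cup V X)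
    ∘ tB (Rf (loc_plus A (single A V))) (Rg (loc_plus A (single A X)))
    ∘ tmap TB (idm (Rf (loc_plus A (single A V))))
        (inv_iso (rder_shift_iso Rg (loc_plus A (single A X))) ∘ fmap Rg (der_connecting ip))
  = inv_iso (rder_shift_iso Rh (loc_plus A (single A (V ⊗ X)))) ∘ fmap Rh (der_connecting Vip)
    ∘ single_cup V Z.
Proof.
apply: (is_iso_mono (rder_shift_iso Rh (loc_plus A (single A (V ⊗ X))))).
apply: etrans _ (esym (compA _ _ _)).
apply: etrans _ (esym (congr1 (fun z => comp z _) (rsh_connecting Rh Vip))).
rewrite /single_cup [fmap (der_shift B) _]fmapM !compA.
rewrite [_ ∘ fmap _ (fmap Rh _)](rsh_natural Rh).
rewrite -[_ ∘ rsh _ _ ∘ _]compA -[_ ∘ _ ∘ tB _ _]compA DS.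
rewrite !compA -[_ ∘ tmap TB (osig _ _ _) _ ∘ _]compA bitmapM.
rewrite [X in tmap TB _ X](rsh_connecting Rg ip) compm1.
rewrite (_ : osig Rf false (loc_plus A (single A V)) = fmap Rf (idm (loc_plus A
  (single A V)))); last first.
  exact: (esym (fmap1 Rf _)).
rewrite -[_ ∘ D _ _ ∘ _]compA DN !compA -!(fmapM Rh).
by rewrite single_tensor_connectingr.
Qed.

(** The sign comes from [ext_product_shiftr], applied to a class of degree [r];
    [single_cup_connectingr] contributes none. *)
Lemma cup_mor_connectingr (torB : finite_tor_dim B) (r s n : nat) :
  cup_mor r s.+1 n.+1 V X ∘ (idm (rderived Rf r V) ⊗ₘ connecting Rg ip s)
  = (connecting Rh Vip n ∘ cup_mor r s n V Z) *~ (-1) ^+ r.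
Proof.
pose a := inv_iso (rder_shift_iso Rg (loc_plus A (single A X))) ∘ fmap Rg (der_connecting ip).
pose c := inv_iso (rder_shift_iso Rh (loc_plus A (single A (V ⊗ X))))
  ∘ fmap Rh (der_connecting Vip).
pose M := Rf (loc_plus A (single A V)).
have [kN kE] := kP r s n.
have E1 : k r s.+1 n.+1 M (Rg (loc_plus A (single A X)))
      ∘ (idm (rderived Rf r V) ⊗ₘ connecting Rg ip s)
    = (coh_shift n (sval (TB (M, Rg (loc_plus A (single A X)))))
      ∘ (fmap (der_coh B n) (tB M (Rg (loc_plus A (single A X))))
      ∘ (fmap (der_coh B n) (tmap TB (idm M) a) ∘ k r s n M (Rg (loc_plus A (single A Z))))))
      *~ (-1) ^+ r.
  have -> : idm (rderived Rf r V) ⊗ₘ connecting Rg ip s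
      = (idm (der_coh B r M) ⊗ₘ coh_shift s (sval (Rg (loc_plus A (single A X)))))
        ∘ (fmap (der_coh B r) (idm M) ⊗ₘ fmap (der_coh B s) a).
    by rewrite der_coh1 tmapM comp1m.
  have E0 : coh_shift n (sval (TB (M, Rg (loc_plus A (single A X)))))
        ∘ fmap (der_coh B n) (tB M (Rg (loc_plus A (single A X))))
        ∘ k r s n M (der_shift B (Rg (loc_plus A (single A X))))
        ∘ (fmap (der_coh B r) (idm M) ⊗ₘ fmap (der_coh B s) a)
      = coh_shift n (sval (TB (M, Rg (loc_plus A (single A X)))))
        ∘ (fmap (der_coh B n) (tB M (Rg (loc_plus A (single A X))))
        ∘ (fmap (der_coh B n) (tmap TB (idm M) a) ∘ k r s n M (Rg (loc_plus A (single A Z))))).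
    apply: etrans (esym (compA _ _ _)) _; apply: etrans (congr1 (comp _) (kN _ _ _ _ _ _)) _.
    exact: (esym (compA _ _ _)).
  rewrite -E0 -mulrz_comp; apply: etrans (compA _ _ _) _.
  exact: (congr1 (fun z => comp z _)
    (ext_product_shiftr torB (kP r s n) (kP r s.+1 n.+1) tBN tBE _ _)).
have E2 : fmap (der_coh B n) (fmap (der_shift B) (single_cup V X))
      ∘ (fmap (der_coh B n) (tB M (Rg (loc_plus A (single A X))))
      ∘ (fmap (der_coh B n) (tmap TB (idm M) a) ∘ k r s n M (Rg (loc_plus A (single A Z)))))
    = fmap (der_coh B n) c ∘ (fmap (der_coh B n) (single_cup V Z)
      ∘ k r s n M (Rg (loc_plus A (single A Z)))).
  by rewrite !compA -!(fmapM (der_coh B n)) single_cup_connectingr.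
have E3 : fmap (der_coh B n.+1) (single_cup V X)
      ∘ (coh_shift n (sval (TB (M, Rg (loc_plus A (single A X)))))
      ∘ (fmap (der_coh B n) (tB M (Rg (loc_plus A (single A X))))
      ∘ (fmap (der_coh B n) (tmap TB (idm M) a) ∘ k r s n M (Rg (loc_plus A (single A Z))))))
    = connecting Rh Vip n ∘ cup_mor r s n V Z.
  apply: etrans (compA _ _ _) _.
  apply: etrans (congr1 (fun z => comp z _) (esym (coh_shift_natural (single_cup V X) n))) _.
  apply: etrans (esym (compA _ _ _)) _; apply: etrans _ (compA _ _ _); congr (_ ∘ _).
  exact: E2.
apply: etrans (esym (compA _ _ _)) _; apply: etrans (congr1 (comp _) E1) _.
by apply: etrans (comp_mulrz _ _ _) _; rewrite -E3.
Qed.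

End Right.

End CupProduct.

Lemma cup_products_unique (A B : tensor_abelian)
    (torA : finite_tor_dim A) (torB : finite_tor_dim B) (f g h : additive_functor A B)
    (hf : pre_cup_functor f) (hg : pre_cup_functor g)
    (Rf : right_derived f) (Rg : right_derived g) (Rh : right_derived h)
    (mu : cup_pairing (tens A) (tens B) f g h) (c c' : cup_products Rf Rg Rh) :
  extends_pairing mu c -> connecting_left c -> connecting_right c ->
  extends_pairing mu c' -> connecting_left c' -> connecting_right c' ->
  forall (r s n : nat) (e : (r + s)%N = n) (X Y : A),
    c' r s n e (X, Y) = c r s n e (X, Y).
Proof.
move=> cE cL cR c'E c'L c'R.
have [d dA] := finite_tor_dim_fdim torA.
have enough := fdim_enough_flat dA.
(* The outer induction shifts the first variable for all [s] and all objects at once; for [r = 0]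
   the inner induction shifts the second one. *)
elim=> [|r IHr].
  elim=> [|s IHs] n e X Y.
    subst n; rewrite (eq_irrelevance (erefl _ : (0 + 0)%N = 0%N) erefl).
    have ee : epi (rderived0 Rf X ⊗ₘ rderived0 Rg Y).
      by apply: epi_tmap; exact: rderived0_epi.
    by apply: ee; rewrite c'E cE.
  have [X0 [X'' [i [p [ip [fX [M [y ey]]]]]]]] := pre_cup_effaceable torA torB hg Rg s Y.
  have Xip := flat_quotient_exact enough X ip fX.
  (* The products are indexed by proofs of the degree equation. All such proofs are equal, and this
     is the one that occurs in [connecting_right]. *)
  have -> : e = etrans (etrans (addnS 0 s) (congr1 S (erefl (0 + s)%N))) e.
    exact: eq_irrelevance.
  subst n.
  (* The tensor product preserves epimorphisms, so a product on the target of the connecting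
     morphism is determined by its composite with this morphism. *)
  have ee : epi (idm (rderived Rf 0 X) ⊗ₘ (connecting Rg ip s ∘ y)).
    by apply: epi_tmap => //; exact: epi1.
  apply: ee; rewrite -[idm _]comp1m -tmapM !compA.
  congr (_ ∘ _); apply: etrans (c'R _ _ _ _ _ _ ip Xip 0%N s _ (erefl (0 + s)%N)) _.
  by apply: etrans _ (esym (cR _ _ _ _ _ _ ip Xip 0%N s _ (erefl (0 + s)%N))); rewrite IHs.
move=> s n e X Y.
have [X0 [X'' [i [p [ip [fX [M [y ey]]]]]]]] := pre_cup_effaceable torA torB hf Rf r X.
have ipY := flat_quotient_exactl enough Y ip fX.
have -> : e = etrans (congr1 S (erefl (r + s)%N)) e by exact: eq_irrelevance.
subst n.
have ee : epi ((connecting Rf ip r ∘ y) ⊗ₘ idm (rderived Rg s Y)).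
  by apply: epi_tmap => //; exact: epi1.
apply: ee; rewrite -[idm _]comp1m -tmapM !compA.
congr (_ ∘ _); apply: etrans (c'L _ _ _ _ _ _ ip ipY r s _ (erefl (r + s)%N)) _.
by apply: etrans _ (esym (cL _ _ _ _ _ _ ip ipY r s _ (erefl (r + s)%N))); rewrite IHr.
Qed.

Theorem theorem2p1p6 (A B : tensor_abelian)
  (torA : finite_tor_dim A) (torB : finite_tor_dim B)
  (TA : derived_tensor A) (TB : derived_tensor B)
  (f g h : additive_functor A B)
  (hf : pre_cup_functor f) (hg : pre_cup_functor g) (hh : pre_cup_functor h)
  (Rf : right_derived f) (Rg : right_derived g) (Rh : right_derived h)
  (mu : cup_pairing (tens A) (tens B) f g h) :
  exists (Phi : cup_pairing TA TB Rf Rg Rh) (cup : cup_products Rf Rg Rh),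
    [/\ induced_by Phi cup,
        extends_pairing mu cup,
        connecting_left cup,
        connecting_right cup
      & forall cup' : cup_products Rf Rg Rh,
          extends_pairing mu cup' ->
          connecting_left cup' ->
          connecting_right cup' ->
          forall (r s n : nat) (e : (r + s)%N = n) (X Y : A),
            cup' r s n e (X, Y) = cup r s n e (X, Y)].
Proof.
have [f' [adjf [fx flatf]]] := hf; have [g' [adjg [gx flatg]]] := hg.
have [ef [efN efE]] := derived_counit Rf adjf fx.
have [eg [egN egE]] := derived_counit Rg adjg gx.
have [ps psN psE] := derived_pair_ex torB TA TB Rh mu adjf adjg fx gx flatf flatg.
pose D := dcup ef eg ps; have DN := dcup_natural efN egN psN.
have DE := dcup_reta efE egE psN psE.
pose k p q n := projT1 (cid (ext_product_ex torB TB p q n)).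
have kP p q n : ext_product (k p q n) := projT2 (cid (ext_product_ex torB TB p q n)).
(* The components are defined by matching on pairs, because an object of a product category is not
   convertible to the pair of its projections. *)
have PhiN (X Y : der_plus A × der_plus A) (w : hom X Y) :
    (let: (M, N) as Z := Y return hom ((TB ⊚ prod_functor Rf Rg) Z) ((Rh ⊚ TA) Z) in D M N)
      ∘ fmap (TB ⊚ prod_functor Rf Rg) w
    = fmap (Rh ⊚ TA) w
      ∘ (let: (M, N) as Z := X return hom ((TB ⊚ prod_functor Rf Rg) Z) ((Rh ⊚ TA) Z) in D M N).
  by case: X Y w => [X X'] [Y Y'] [u v]; exact: DN.
have cupN r s n (X Y : A × A) (w : hom X Y) :
    (let: (M, N) as Z := Y return hom ((tens B ⊚ prod_functor (rderived Rf r) (rderived Rg s)) Z)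
       ((rderived Rh n ⊚ tens A) Z) in cup_mor D k r s n M N)
      ∘ fmap (tens B ⊚ prod_functor (rderived Rf r) (rderived Rg s)) w
    = fmap (rderived Rh n ⊚ tens A) w
      ∘ (let: (M, N) as Z := X return hom ((tens B ⊚ prod_functor (rderived Rf r) (rderived Rg s)) Z)
       ((rderived Rh n ⊚ tens A) Z) in cup_mor D k r s n M N).
  by case: X Y w => [X X'] [Y Y'] [u v]; exact: (cup_mor_natural DN kP).
have kN p q n (X Y : der_plus B × der_plus B) (w : hom X Y) :
    (let: (M, N) as Z := Y return hom ((tens B ⊚ prod_functor (der_coh B p) (der_coh B q)) Z)
       ((der_coh B n ⊚ TB) Z) in k p q n M N)
      ∘ fmap (tens B ⊚ prod_functor (der_coh B p) (der_coh B q)) w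
    = fmap (der_coh B n ⊚ TB) w
      ∘ (let: (M, N) as Z := X return hom ((tens B ⊚ prod_functor (der_coh B p) (der_coh B q)) Z)
       ((der_coh B n ⊚ TB) Z) in k p q n M N).
  by case: X Y w => [X X'] [Y Y'] [u v]; exact: (kP p q n).1.
pose Phi : cup_pairing TA TB Rf Rg Rh := NatTrans PhiN.
pose cup : cup_products Rf Rg Rh := fun r s n _ => NatTrans (cupN r s n).
have cupE : extends_pairing mu cup by move=> X Y; exact: (cup_mor_extends DE kP).
have cupL : connecting_left cup.
  move=> X' X X'' Y i p ip ipY r s n e.
  (* With [true] the first variable is shifted; [connecting_right] uses [false]. *)
  have [tA tAN tAE] := tensor_shift_ex torA TA true.
  have [tB tBN tBE] := tensor_shift_ex torB TB true.
  apply: (cup_mor_connectingl DN kP tBN tAE tBE) => //.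
  exact: (dcup_shift torB flatf flatg efN egN efE egE psN psE tAN tBN tAE tBE).
have cupR : connecting_right cup.
  move=> X Y' Y Y'' i p ip Xip r s n e.
  have [tA tAN tAE] := tensor_shift_ex torA TA false.
  have [tB tBN tBE] := tensor_shift_ex torB TB false.
  apply: (cup_mor_connectingr DN kP tBN tAE tBE) => //.
  exact: (dcup_shift torB flatf flatg efN egN efE egE psN psE tAN tBN tAE tBE).
exists Phi, cup; split=> //.
- move=> r s n e; exists (NatTrans (kN r s n)) => // X Y.
  apply: etrans (congr1 (fun z => comp z _) ((kP r s n).2 X Y)) _.
  exact: coh_productE.
- move=> cup' cE cL cR r s n e X Y.
  exact: (cup_products_unique torA torB hf hg cupE cupL cupR cE cL cR).
Qed.
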